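(* Let $\mathbf A$ be a finite algebra belonging to a congruence modular variety. If $\mathbf A$ has no quotient $\mathbf A'$ for which $\mathrm{CEQV}(\mathbf A')$ is co-NP-complete, then $\mathbf A$ is nilpotent.
   Context: A circuit over an algebra $\mathbf A$ is a directed acyclic graph whose input nodes are labelled by variables or constants from $A$ and whose gates are labelled by fundamental operations of $\mathbf A$ (ordered inputs, matching arity); each gate computes a polynomial of $\mathbf A$; size = size of the graph. $\mathrm{CEQV}(\mathbf A)$: given a circuit over $\mathbf A$ with two output gates $g_1,g_2$, decide whether $g_1(\bar a)=g_2(\bar a)$ for all input tuples $\bar a$. ''Belongs to a congruence modular variety'' means the variety generated by $\mathbf A$ is congruence modular. Nilpotency is with respect to the modular commutator: $1^{(1)}=1_A$, $1^{(i+1)}=[1_A,1^{(i)}]$, and $\mathbf A$ is nilpotent if $1^{(k+1)}=0_A$ for some $k$. *)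

(* Defs.v *)
From Stdlib Require Import Relations.
From mathcomp Require Import all_boot.

Set Implicit Arguments.
Unset Strict Implicit.
Unset Printing Implicit Defensive.

Record signature := Signature { sym : finType; arity : sym -> nat }.

Record algebra (S : signature) := Algebra {
  car :> Type;
  op : forall f : sym S, ('I_(arity f) -> car) -> car }.

Record finAlgebra (S : signature) := FinAlgebra {
  fcar : finType;
  fop : forall f : sym S, ('I_(arity f) -> fcar) -> fcar }.

Definition alg_of_fin (S : signature) (A : finAlgebra S) : algebra S :=
  @Algebra S (fcar A) (@fop S A).
Arguments op {S} a f _.
Coercion alg_of_fin : finAlgebra >-> algebra.

Section UA.
Variable S : signature.

Definition is_hom (A B : algebra S) (h : A -> B) : Prop :=
  forall (f : sym S) (x : 'I_(arity f) -> A),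
    h (op A f x) = op B f (fun i => h (x i)).

Definition is_congruence (A : algebra S) (th : A -> A -> Prop) : Prop :=
  equivalence A th /\
  forall (f : sym S) (x y : 'I_(arity f) -> A),
    (forall i, th (x i) (y i)) -> th (op A f x) (op A f y).

Definition con_join (A : algebra S) (a b : A -> A -> Prop) : A -> A -> Prop :=
  clos_trans A (fun x y => a x y \/ b x y).

Definition con_meet (A : algebra S) (a b : A -> A -> Prop) : A -> A -> Prop :=
  fun x y => a x y /\ b x y.

Definition con_modular (A : algebra S) : Prop :=
  forall a b c : A -> A -> Prop,
    is_congruence a -> is_congruence b -> is_congruence c ->
    (forall x y, a x y -> c x y) ->
    forall x y, con_meet (con_join a b) c x y <-> con_join a (con_meet b c) x y.

Definition in_HSP (A B : algebra S) : Prop :=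
  exists (I : Type) (P : (I -> A) -> Prop) (h : (I -> A) -> B),
    (forall (f : sym S) (x : 'I_(arity f) -> I -> A),
        (forall j, P (x j)) -> P (fun i => op A f (fun j => x j i))) /\
    (forall b : B, exists x, P x /\ h x = b) /\
    (forall (f : sym S) (x : 'I_(arity f) -> I -> A),
        (forall j, P (x j)) ->
        h (fun i => op A f (fun j => x j i)) = op B f (fun j => h (x j))).

Definition CM_variety (A : algebra S) : Prop :=
  forall B : algebra S, in_HSP A B -> con_modular B.

Inductive term (n : nat) : Type :=
  | tvar of 'I_n
  | tapp (f : sym S) of ('I_(arity f) -> term n).

Fixpoint teval (A : algebra S) (n : nat) (e : 'I_n -> A) (t : term n) : A :=
  match t with
  | tvar i => e i
  | tapp f ts => op A f (fun j => teval e (ts j))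
  end.

Definition join_env (A : Type) n m (a : 'I_n -> A) (c : 'I_m -> A)
  : 'I_(n + m) -> A :=
  fun i => match split i with inl i => a i | inr j => c j end.

Definition term_condition (A : algebra S) (al be de : A -> A -> Prop) : Prop :=
  forall (n m : nat) (t : term (n + m)) (a b : 'I_n -> A) (c d : 'I_m -> A),
    (forall i, al (a i) (b i)) -> (forall j, be (c j) (d j)) ->
    de (teval (join_env a c) t) (teval (join_env a d) t) ->
    de (teval (join_env b c) t) (teval (join_env b d) t).

Definition commutator (A : algebra S) (al be : A -> A -> Prop) : A -> A -> Prop :=
  fun x y => forall de : A -> A -> Prop,
    is_congruence de -> term_condition al be de -> de x y.

(* lcs k = 1^(k+1): lcs 0 = 1_A, lcs (k+1) = [1_A, lcs k]. *)
Fixpoint lcs (A : algebra S) (k : nat) {struct k} : A -> A -> Prop :=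
  match k with
  | 0 => fun _ _ => True
  | k'.+1 => @commutator A (fun _ _ => True) (@lcs A k')
  end.

Definition nilpotent (A : algebra S) : Prop :=
  exists k : nat, forall x y : A, @lcs A k x y <-> x = y.

(* A circuit is a list of nodes in topological order; a gate refers to
   earlier nodes by their positions. *)
Inductive node (T : Type) : Type :=
  | NVar of nat
  | NConst of T
  | NGate (f : sym S) of seq nat.

Fixpoint valid_nodes (T : Type) (k : nat) (C : seq (node T)) : bool :=
  match C with
  | [::] => true
  | nd :: C' =>
      (match nd with
       | NGate f ins => (size ins == arity f) && all (fun i => i < k) ins
       | _ => true
       end) && valid_nodes k.+1 C'
  end.

Definition valid_instance (T : Type) (C : seq (node T)) (g1 g2 : nat) : bool :=
  [&& valid_nodes 0 C, g1 < size C & g2 < size C].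

Definition eval_node (A : algebra S) (a : nat -> A) (vals : seq A) (nd : node A) : A :=
  match nd with
  | NVar i => a i
  | NConst c => c
  | NGate f ins => op A f (fun j => nth (a 0) vals (nth 0 ins j))
  end.

Definition circuit_values (A : algebra S) (a : nat -> A) (C : seq (node A)) : seq A :=
  foldl (fun vals nd => rcons vals (eval_node a vals nd)) [::] C.

(* Binary encoding of naturals, self-delimiting. *)
Fixpoint binrev (fuel n : nat) : seq bool :=
  match fuel with
  | 0 => [::]
  | fuel'.+1 => if n is 0 then [::] else odd n :: binrev fuel' n./2
  end.

Definition enc_nat (n : nat) : seq bool :=
  flatten [seq [:: b; b] | b <- binrev n n] ++ [:: false; true].

Definition enc_node (T : finType) (nd : node T) : seq bool :=
  match nd with
  | NVar i => enc_nat 0 ++ enc_nat i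
  | NConst c => enc_nat 1 ++ enc_nat (enum_rank c)
  | NGate f ins => enc_nat 2 ++ enc_nat (enum_rank f) ++ flatten (map enc_nat ins)
  end.

Definition enc_instance (T : finType) (C : seq (node T)) (g1 g2 : nat) : seq bool :=
  enc_nat (size C) ++ flatten (map (@enc_node T) C) ++ enc_nat g1 ++ enc_nat g2.

Definition CEQV (A : finAlgebra S) (x : seq bool) : Prop :=
  exists (C : seq (node (fcar A))) (g1 g2 : nat),
    valid_instance C g1 g2 /\ enc_instance C g1 g2 = x /\
    forall a : nat -> fcar A,
      nth (a 0) (circuit_values (A := A) a C) g1 =
      nth (a 0) (circuit_values (A := A) a C) g2.

End UA.

Unset Implicit Arguments.

Inductive dir := DL | DR | DN.

Record TM := {
  tQ : finType;
  tG : finType;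
  tblank : tG;
  tin : bool -> tG;
  tout : tG -> option bool;
  tstart : tQ;
  thalt : tQ -> bool;
  tacc : tQ -> bool;
  tdelta : tQ -> tG -> tQ * tG * dir }.

(* configuration: state, left part (reversed), head symbol, right part *)
Definition config (M : TM) := (tQ M * seq (tG M) * tG M * seq (tG M))%type.

Definition tm_init (M : TM) (x : seq bool) : config M :=
  match map (tin M) x with
  | [::] => (tstart M, [::], tblank M, [::])
  | g :: gs => (tstart M, [::], g, gs)
  end.

Definition tm_step (M : TM) (c : config M) : config M :=
  let '(q, l, h, r) := c in
  if thalt M q then c else
  let '(q', g, d) := tdelta M q h in
  match d with
  | DN => (q', l, g, r)
  | DL => match l with
          | [::] => (q', [::], tblank M, g :: r)
          | l1 :: ls => (q', ls, l1, g :: r)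
          end
  | DR => match r with
          | [::] => (q', g :: l, tblank M, [::])
          | r1 :: rs => (q', g :: l, r1, rs)
          end
  end.

Definition tm_run (M : TM) (n : nat) (x : seq bool) : config M :=
  iter n (tm_step M) (tm_init M x).

Definition tm_state (M : TM) (c : config M) : tQ M := c.1.1.1.

Fixpoint readout (M : TM) (s : seq (tG M)) : seq bool :=
  match s with
  | [::] => [::]
  | g :: s' => match tout M g with Some b => b :: readout M s' | None => [::] end
  end.

Definition tm_output (M : TM) (c : config M) : seq bool := readout M (c.1.2 :: c.2).

Definition poly (c k n : nat) : nat := c * n ^ k + c.

Definition language := seq bool -> Prop.

Definition in_P (L : language) : Prop :=
  exists (M : TM) (c k : nat), forall x,
    let cf := tm_run M (poly c k (size x)) x in
    thalt M (tm_state M cf) /\ (tacc M (tm_state M cf) <-> L x).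

Definition polytime_computable (f : seq bool -> seq bool) : Prop :=
  exists (M : TM) (c k : nat), forall x,
    let cf := tm_run M (poly c k (size x)) x in
    thalt M (tm_state M cf) /\ tm_output M cf = f x.

Definition pair_enc (x w : seq bool) : seq bool :=
  flatten [seq [:: b; b] | b <- x] ++ [:: false; true] ++ w.

Definition in_NP (L : language) : Prop :=
  exists (V : language) (c k : nat), in_P V /\
    forall x, L x <-> exists w, size w <= poly c k (size x) /\ V (pair_enc x w).

Definition in_coNP (L : language) : Prop := in_NP (fun x => ~ L x).

Definition coNP_complete (L : language) : Prop :=
  in_coNP L /\
  forall L' : language, in_coNP L' ->
    exists f, polytime_computable f /\ forall x, L' x <-> L (f x).

(* Main.v *)
(** If A is not nilpotent, its lower central series becomes stationary at some g > 0,
    and a congruence maximal among those not above g has a quotient B with a monolith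
    mu for which the term condition C(1,mu;0) fails.  On a minimal set U of B for mu,
    this failure and Day's terms give a polynomial s(u,x) that, depending on x, is the
    identity of U or identifies two points z and o of U.  Composing such polynomials
    in u yields, for every set of clauses, a polynomial that fixes z and o when the
    clauses hold and identifies them otherwise.  The computation tableaux of a
    polynomial-time verifier are the tilings of a region by locally constrained
    windows; two circuits that run the gadgets of all windows from z and from o
    disagree for some input exactly when such a tableau exists, so CEQV(B) is
    coNP-hard.  It is in coNP because a falsifying assignment can be checked by a
    machine that reads the circuit once and keeps the values of variables and nodes in
    an associative memory addressed by binary keys.  Both the reduction and the checker
    are loop programs over stacks, compiled to one-tape Turing machines. *)
Require Import Defs.
From Stdlib Require Import Relations Classical ClassicalEpsilon.
From Stdlib Require Import FunctionalExtensionality ProofIrrelevance.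
From HB Require Import structures.
From mathcomp Require Import all_boot zify.

Set Implicit Arguments.
Unset Strict Implicit.
Unset Printing Implicit Defensive.

(** * Polynomials and Day terms *)

Section Polynomials.
Variables (S : signature) (B : algebra S).

(** [U] is not known to carry operations that compute on truth values: non-nilpotency only yields a
    parameter that decides whether a map of [U] is the identity or collapses. Gadgets therefore act
    by composition in a distinguished variable, and every element of the algebra counts as true or
    false, so no input has to be excluded. The dichotomy comes from minimality of [U]: a polynomial
    mapping [U] to itself permutes it or collapses its related pairs. Iterating it as often as the
    factorial of the size of the algebra turns a permutation into the identity; this exponent is the
    same for all parameters, so the iterate is again a polynomial in them. Composition is also why
    circuits matter: a gadget may use its distinguished variable repeatedly, so a chain of gadgets
    is short as a circuit but possibly exponential as a term. Tableaux need nine kinds of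
    constraints, hence nine fixed gadgets. Padding these to a common length that is a power of two
    makes every node address a fixed word followed by a block counter, and writing the circuit
    becomes filling in templates. *)

Inductive pterm (V : Type) : Type :=
  | PV of V
  | PC of B
  | PA (f : sym S) of ('I_(arity f) -> pterm V).

Fixpoint peval (V : Type) (e : V -> B) (t : pterm V) : B :=
  match t with
  | PV v => e v
  | PC c => c
  | PA f ts => op B f (fun j => peval e (ts j))
  end.

Fixpoint psub (V W : Type) (h : V -> pterm W) (t : pterm V) : pterm W :=
  match t with
  | PV v => h v
  | PC c => PC W c
  | PA f ts => PA (fun j => psub h (ts j))
  end.

Lemma peval_sub V W (h : V -> pterm W) e t :
  peval e (psub h t) = peval (fun v => peval e (h v)) t.
Proof.
elim: t => //= f ts IH; congr (op B f _).
by apply: functional_extensionality.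
Qed.

Definition polyfun (V : Type) (F : (V -> B) -> B) : Prop :=
  exists t, forall e, peval e t = F e.

Lemma polyfun_ext V (F F' : (V -> B) -> B) : F =1 F' -> polyfun F -> polyfun F'.
Proof. by move=> FF [t tE]; exists t => e; rewrite tE. Qed.

Lemma polyfun_var V (v : V) : polyfun (fun e => e v).
Proof. by exists (PV v). Qed.

Lemma polyfun_const V (c : B) : polyfun (fun _ : V -> B => c).
Proof. by exists (PC V c). Qed.

Lemma polyfun_op V (f : sym S) (H : 'I_(arity f) -> (V -> B) -> B) :
  (forall j, polyfun (H j)) -> polyfun (fun e => op B f (fun j => H j e)).
Proof.
move=> pH.
pose t j := proj1_sig (constructive_indefinite_description _ (pH j)).
exists (PA t) => e /=; congr (op B f _); apply: functional_extensionality => j.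
exact: (proj2_sig (constructive_indefinite_description _ (pH j))).
Qed.

Lemma polyfun_comp V W (F : (W -> B) -> B) (H : W -> (V -> B) -> B) :
  polyfun F -> (forall w, polyfun (H w)) -> polyfun (fun e => F (fun w => H w e)).
Proof.
move=> [t tE] pH.
pose h w := proj1_sig (constructive_indefinite_description _ (pH w)).
exists (psub h t) => e; rewrite peval_sub -tE; congr peval.
apply: functional_extensionality => w.
exact: (proj2_sig (constructive_indefinite_description _ (pH w))).
Qed.

Lemma polyfun_term V n (t : term S n) (H : 'I_n -> (V -> B) -> B) :
  (forall i, polyfun (H i)) -> polyfun (fun e => teval (A := B) (fun i => H i e) t).
Proof. by move=> pH; elim: t => //= f ts IH; apply: polyfun_op. Qed.

Lemma polyfun_cong V (F : (V -> B) -> B) (th : B -> B -> Prop) e e' :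
  is_congruence th -> polyfun F -> (forall v, th (e v) (e' v)) -> th (F e) (F e').
Proof.
move=> [[rf _ _] co] [t tE] h; rewrite -!tE.
by elim: t {tE} => [v|c|f ts IH] /=; [apply: h | apply: rf | apply: co].
Qed.

Definition upoly (f : B -> B) : Prop := polyfun (fun e : unit -> B => f (e tt)).

Lemma upolyP f : upoly f <-> forall V (F : (V -> B) -> B), polyfun F -> polyfun (fun e => f (F e)).
Proof.
split=> [uf V F pF|h]; last exact: (h _ _ (polyfun_var tt)).
exact: (polyfun_comp (H := fun _ => F) uf).
Qed.

Lemma upoly_comp f g : upoly f -> upoly g -> upoly (f \o g).
Proof. by move/upolyP=> h ug; apply: h. Qed.

Lemma upoly_id : upoly id. Proof. exact: polyfun_var. Qed.

Lemma upoly_iter n f : upoly f -> upoly (iter n f).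
Proof. by move=> uf; elim: n => [|n IH]; [apply: upoly_id | apply: (upoly_comp uf IH)]. Qed.

Lemma upoly_cong f th x y : is_congruence th -> upoly f -> th x y -> th (f x) (f y).
Proof.
by move=> ct uf h; apply: (polyfun_cong (e := fun=> x) (e' := fun=> y) ct uf).
Qed.

Definition upd (I : eqType) (T : Type) (z : I -> T) (i : I) (x : T) : I -> T :=
  fun j => if j == i then x else z j.

(** A hybrid argument: the coordinates of [a] are replaced by those of [b] one after another, and
    some single replacement destroys [P]. This reduces failures in many variables to one
    variable. *)
Lemma walk n (T : Type) (P : ('I_n -> T) -> Prop) a b :
  P a -> ~ P b -> exists i z, P (upd z i (a i)) /\ ~ P (upd z i (b i)).
Proof.
move=> Pa Pb; pose z k := fun i : 'I_n => if i < k then b i else a i.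
have z0 : z 0 = a by [].
have zn : z n = b by apply: functional_extensionality => i; rewrite /z ltn_ord.
have [k [kn Pk Pk1]] : exists k, [/\ k < n, P (z k) & ~ P (z k.+1)].
  apply: NNPP => H; case: Pb; rewrite -zn.
  suff Hk k : k <= n -> P (z k) by apply: Hk.
  elim: k => [|k IH] kn; first by rewrite z0.
  by apply: NNPP => Pk1; apply: H; exists k; split=> //; apply/IH/ltnW.
exists (Ordinal kn), (z k).
have -> : upd (z k) (Ordinal kn) (a (Ordinal kn)) = z k.
  apply: functional_extensionality => j; rewrite /upd /z.
  by case: eqP => // -> /=; rewrite ltnn.
have -> // : upd (z k) (Ordinal kn) (b (Ordinal kn)) = z k.+1.
apply: functional_extensionality => j; rewrite /upd /z.
case: eqP => [-> /=|]; first by rewrite ltnSn.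
move=> jk; have {}jk : nat_of_ord j <> k by move=> E; apply: jk; apply: val_inj.
by have -> : (j < k.+1) = (j < k) by lia.
Qed.

Lemma polyfun_upd V (I : eqType) (z : I -> B) i (H : (V -> B) -> B) :
  polyfun H -> forall j, polyfun (fun e => upd z i (H e) j).
Proof.
move=> pH j; rewrite /upd; case: (j == i) => //; exact: polyfun_const.
Qed.

(** The arguments of a basic operation are changed one at a time, and each change is an instance of
    a unary polynomial. *)
Lemma congruence_upoly (th : B -> B -> Prop) :
  equivalence B th -> (forall f x y, upoly f -> th x y -> th (f x) (f y)) ->
  is_congruence th.
Proof.
move=> et H; split=> // f x y hxy; apply: NNPP => hn.
have [rf tr sy] := et.
have [i [z []]] := @walk _ _ (fun z => th (op B f x) (op B f z)) x y (rf _) hn.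
move=> h1; apply; apply: (tr _ _ _ h1).
apply: (H (fun u => op B f (upd z i u))) => //.
apply: (polyfun_op (H := fun j (e : unit -> B) => upd z i (e tt) j)) => j.
by apply: polyfun_upd; apply: polyfun_var.
Qed.

Definition polyop4 (m : B -> B -> B -> B -> B) : Prop :=
  exists t : term S 4, forall x y z u,
    m x y z u = teval (A := B) (fun i => nth x [:: x; y; z; u] i) t.

Lemma polyfun4 V m (F1 F2 F3 F4 : (V -> B) -> B) :
  polyop4 m -> polyfun F1 -> polyfun F2 -> polyfun F3 -> polyfun F4 ->
  polyfun (fun e => m (F1 e) (F2 e) (F3 e) (F4 e)).
Proof.
move=> [t tE] p1 p2 p3 p4.
have pH (i : 'I_4) : polyfun (nth F1 [:: F1; F2; F3; F4] i) by case: i => [[|[|[|[|]]]]].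
apply: polyfun_ext (polyfun_term t pH) => e.
rewrite tE; congr teval; apply: functional_extensionality => i.
by case: i => [[|[|[|[|]]]]].
Qed.

End Polynomials.

Section Day.
Variables (S : signature) (B : algebra S).
Hypothesis CM : CM_variety B.

Let env := 'I_4 -> B.
Definition is_term4 (f : env -> B) : Prop :=
  exists t : term S 4, f = fun e => teval (A := B) e t.

Lemma is_term4_op (f : sym S) (x : 'I_(arity f) -> {g | is_term4 g}) :
  is_term4 (fun e => op B f (fun j => proj1_sig (x j) e)).
Proof.
pose t j := proj1_sig (constructive_indefinite_description _ (proj2_sig (x j))).
exists (tapp t); apply: functional_extensionality => e /=; congr (op B f _).
apply: functional_extensionality => j.
by rewrite (proj2_sig (constructive_indefinite_description _ (proj2_sig (x j)))).
Qed.

(** The free algebra on four generators in the variety of [B], as a subalgebra of a power of [B].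
    Congruence modularity of the variety is applied to this algebra. *)
Definition free4 : algebra S :=
  @Algebra S {g | is_term4 g} (fun f x => exist _ _ (is_term4_op x)).

Lemma free4_inj (x y : free4) : proj1_sig x = proj1_sig y -> x = y.
Proof. by case: x y => [x px] [y py] /= e; apply: subset_eq_compat. Qed.

Lemma is_term4_proj i : is_term4 (fun e => e i).
Proof. by exists (tvar S i). Qed.

Definition proj4 i : free4 := exist _ _ (is_term4_proj i).

Lemma free4_HSP : in_HSP B free4.
Proof.
(* [in_HSP] asks for a map on the whole power; outside the subalgebra its value is arbitrary. *)
pose h (x : env -> B) : free4 :=
  match excluded_middle_informative (is_term4 x) with
  | left p => exist _ x p | right _ => proj4 ord0 end.
have hE x : is_term4 x -> proj1_sig (h x) = x.
  by move=> px; rewrite /h; case: excluded_middle_informative.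
exists env, is_term4, h; split; [|split].
- by move=> f x px; apply: (@is_term4_op f (fun j => exist _ (x j) (px j))).
- by case=> x px; exists x; split=> //; apply: free4_inj; rewrite hE.
- move=> f x px; apply: free4_inj; rewrite hE /=.
    apply: functional_extensionality => e; congr (op B f _).
    by apply: functional_extensionality => j; rewrite hE.
  exact: (@is_term4_op f (fun j => exist _ (x j) (px j))).
Qed.

Definition agree (R : env -> Prop) (f g : free4) : Prop :=
  forall e, R e -> proj1_sig f e = proj1_sig g e.

Lemma agree_congruence R : is_congruence (agree R).
Proof.
split; first split.
- by move=> f e.
- by move=> f g h fg gh e Re; rewrite fg // gh.
- by move=> f g fg e Re; rewrite fg.
move=> f x y xy e Re /=; congr (op B f _).
by apply: functional_extensionality => j; apply: xy.
Qed.

Let i0 : 'I_4 := inord 0.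
Let i1 : 'I_4 := inord 1.
Let i2 : 'I_4 := inord 2.
Let i3 : 'I_4 := inord 3.

Definition tup (x y z u : B) : env := fun i => nth x [:: x; y; z; u] i.

Lemma tupE x y z u :
  (tup x y z u i0 = x) * (tup x y z u i1 = y) * (tup x y z u i2 = z) *
  (tup x y z u i3 = u).
Proof. by rewrite /tup /i0 /i1 /i2 /i3 !inordK. Qed.

(* One step of Day's chain of terms between the first and the last projection
   separates [v] from [w]. *)
Theorem day (v w p : B) : v <> w ->
  exists m, [/\ polyop4 m, forall x y, m x y y x = x & m v v w w <> m v p p w].
Proof.
move=> vw; apply: NNPP => H.
pose psi := agree (fun e => e i1 = e i2).
pose phi := agree (fun e => e i1 = e i2 /\ e i0 = e i3).
pose the := agree (fun e => e i0 = e i1 /\ e i2 = e i3).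
have le f g : psi f g -> phi f g by move=> h e [h1 _]; apply: h.
have HQ (f : free4) : phi (proj4 i0) f ->
    proj1_sig f (tup v v w w) = proj1_sig f (tup v p p w).
  move=> pf; apply: NNPP => hf; apply: H.
  exists (fun x y z u => proj1_sig f (tup x y z u)); split=> //.
    by have [t ft] := proj2_sig f; exists t => x y z u; rewrite ft.
  by move=> x y; rewrite -pf /= ?tupE //; split; rewrite !tupE.
(* The value at [(v,v,w,w)] will be constant along a chain between projections whose values there
   are [v] and [w], a contradiction. Steps in [the] preserve it by definition; steps in [psi]
   preserve the value at [(v,p,p,w)], which agrees with it by [HQ]. *)
pose Q (f g : free4) := phi f g /\ (phi (proj4 i0) f ->
  proj1_sig f (tup v v w w) = proj1_sig g (tup v v w w)).
suff [_ h] : Q (proj4 i0) (proj4 i3) by case: vw; rewrite /= !tupE in h; apply: h.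
(* Modular law for [psi] below [phi]: the path through the four projections alternates between [the]
   and [psi] and its ends are [phi]-related, so there is also a path all of whose steps lie in
   [phi]. *)
have mod := CM free4_HSP (agree_congruence _) (agree_congruence _)
  (agree_congruence _) le (proj4 i0) (proj4 i3) (b := the).
have : con_join psi (con_meet the phi) (proj4 i0) (proj4 i3).
  apply/mod; split; last by move=> e [_ /= ->].
  apply: (t_trans _ _ _ (proj4 i1)); first by apply: t_step; right=> e [].
  apply: (t_trans _ _ _ (proj4 i2)); first by apply: t_step; left=> e.
  by apply: t_step; right=> e [].
elim=> [f g [fg|[fg fg']]|f g h _ [fg Qfg] _ [gh Qgh]].
- split; first exact: le.
  move=> pf; rewrite (HQ f pf) (HQ g); last first.
    by move=> e Re; rewrite (pf e Re); apply: le.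
  by apply: fg; rewrite !tupE.
- by split=> // _; apply: fg; rewrite !tupE.
- split=> [e Re|pf]; first by rewrite fg // gh.
  by rewrite Qfg // Qgh // => e Re; rewrite (pf e Re) fg.
Qed.

End Day.

(** * Minimal sets and gadgets *)

(** Each point lies on a cycle of length at most [#|T|], which divides the factorial. The exponent
    depends on neither [g] nor [u], so the iteration is uniform in the parameters of a
    polynomial. *)
Lemma iter_fact_in (T : finType) (U : {set T}) (g : T -> T) :
  {in U, forall u, g u \in U} -> {in U &, injective g} ->
  {in U, forall u, iter #|T|`! g u = u}.
Proof.
move=> gU gi u uU.
have /dvdnP[q ->] : fingraph.order g u %| #|T|`!.
  by apply: dvdn_fact; rewrite fingraph.order_gt0 max_card.
have h : iter (fingraph.order g u) g u = u by apply: (iter_order_in gU gi).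
by elim: q => // q IH; rewrite mulSn iterD IH.
Qed.

Section MinimalSets.
Variables (S : signature) (B : finAlgebra S).
Notation T := (fcar B).
Notation cong := (is_congruence (A := alg_of_fin B)).
Notation upoly := (upoly (B := alg_of_fin B)).
Variable mu : T -> T -> Prop.
Hypothesis mu_cong : cong mu.
Hypothesis mu_min : forall th x0 y0, cong th -> th x0 y0 -> x0 <> y0 ->
  forall x y, mu x y -> th x y.
Hypothesis mu_ne : exists x y, mu x y /\ x <> y.

Definition separating (U : {set T}) :=
  forall x y, x <> y -> exists h, [/\ upoly h, forall x, h x \in U & h x <> h y].

Definition perm_or_collapse (U : {set T}) := forall g,
  upoly g -> {in U, forall u, g u \in U} ->
  (exists x y, [/\ x \in U, y \in U, mu x y & g x <> g y]) -> {in U &, injective g}.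

(** [U] is the image of a polynomial [f0] with least image among those that do not collapse [mu], a
    minimal set in the sense of tame congruence theory. The retraction [e] is an iterate of a
    polynomial into [U] that separates the [f0]-images of a [mu]-pair: minimality makes it a
    permutation of [U]. *)
Lemma minimal_set : exists (U : {set T}) (e : T -> T),
  [/\ upoly e, (forall x, e x \in U) /\ {in U, e =1 id},
      exists z o, [/\ z \in U, o \in U, mu z o & z <> o],
      separating U & perm_or_collapse U].
Proof.
pose im (f : T -> T) : {set T} := [set f x | x in T].
pose good f := upoly f /\ exists x y, mu x y /\ f x <> f y.
have [f0 [g0 min]] : exists f, good f /\ forall g, good g -> #|im f| <= #|im g|.
  have gid : good id by split; [apply: upoly_id | ].
  apply: NNPP => H.
  suff Hn n g : #|im g| <= n -> ~ good g by apply: (Hn #|im id| id).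
  elim: n g => [|n IH] g le gg; apply: H; exists g; split=> // h gh.
    exact: leq_trans le _.
  rewrite leqNgt; apply/negP => lt; apply: (IH h _ gh); rewrite -ltnS.
  exact: leq_trans lt le.
pose U := im f0; have fU x : f0 x \in U by apply: imset_f.
have [uf0 [x1 [y1 [m1 n1]]]] := g0.
have sep : separating U.
  move=> x y xy; apply: NNPP => H.
  (* Pairs that no polynomial into [U] separates form a congruence; if nontrivial, it contains [mu],
     but [f0] separates a pair of [mu]. *)
  pose th (x y : T) := forall h, upoly h -> (forall x, h x \in U) -> h x = h y.
  apply: n1; apply: (@mu_min th x y _ _ xy x1 y1) => //.
    apply: congruence_upoly; first split.
    - by move=> ? h.
    - by move=> a b c ab bc h uh hU; rewrite (ab h) // (bc h).
    - by move=> a b ab h uh hU; rewrite (ab h).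
    move=> f a b uf ab h uh hU; apply: (ab (h \o f)) => // [|c]; last exact: hU.
    exact: upoly_comp.
  by move=> h uh hU; apply: NNPP => hxy; apply: H; exists h.
have inj_im g : {in U, forall u, g u \in U} -> #|U| <= #|g @: U| ->
    {in U &, injective g}.
  move=> gU le; apply/imset_injP; rewrite eqn_leq le andbT.
  by apply: subset_leq_card; apply/subsetP => _ /imsetP[x xU ->]; apply: gU.
have [h [uh hU h1]] := sep _ _ n1.
have hi : {in U &, injective h}.
  apply: inj_im; first by move=> u _; apply: hU.
  apply: leq_trans (min (h \o f0) _) _.
    by split; [apply: upoly_comp | exists x1, y1].
  apply: subset_leq_card; apply/subsetP => _ /imsetP[x _ ->] /=.
  by apply: imset_f.
have hK := @iter_fact_in T U h (fun u _ => hU u) hi.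
have eU x : iter #|T|`! h x \in U by rewrite -(prednK (fact_gt0 #|T|)) iterS hU.
exists U, (iter #|T|`! h); split=> //.
- exact: upoly_iter.
- by exists (f0 x1), (f0 y1); split=> //; apply: (upoly_cong mu_cong uf0 m1).
- move=> g ug gU [x [y [xU yU mxy gxy]]]; apply: inj_im => //.
  apply: leq_trans (min (g \o iter #|T|`! h) _) _.
    split; first by apply: upoly_comp => //; apply: upoly_iter.
    by exists x, y; split=> //=; rewrite !hK.
  apply: subset_leq_card; apply/subsetP => _ /imsetP[z _ ->] /=.
  by apply: imset_f.
Qed.

End MinimalSets.

(** * Switches and clause gates on a minimal set *)

Section Gadgets.
Variables (S : signature) (B : finAlgebra S).
Notation A := (alg_of_fin B).
Notation T := (fcar B).
Notation cong := (is_congruence (A := A)).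
Notation upoly := (upoly (B := A)).
Notation polyfun := (polyfun (B := A)).
Notation polyop4 := (polyop4 (B := A)).
Variable mu : T -> T -> Prop.
Hypothesis mu_cong : cong mu.
Hypothesis mu_min : forall th x0 y0, cong th -> th x0 y0 -> x0 <> y0 ->
  forall x y, mu x y -> th x y.
Hypothesis dayH : forall v w p : T, v <> w ->
  exists m, [/\ polyop4 m, forall x y, m x y y x = x & m v v w w <> m v p p w].
Variables (U : {set T}) (e : T -> T) (z0 o0 : T).
Hypothesis upoly_e : upoly e.
Hypothesis eU : forall x, e x \in U.
Hypothesis eK : {in U, e =1 id}.
Hypotheses (z0U : z0 \in U) (o0U : o0 \in U) (mu0 : mu z0 o0) (zo0 : z0 <> o0).
Hypothesis sepU : separating U.
Hypothesis pocU : perm_or_collapse mu U.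

Let mu_refl x : mu x x. Proof. by case: mu_cong => [[]]. Qed.
Let mu_sym x y : mu x y -> mu y x. Proof. by case: mu_cong => [[_ _ h] _]; apply: h. Qed.
Let mu_trans x y z : mu x y -> mu y z -> mu x z.
Proof. by case: mu_cong => [[_ h _] _]; apply: h. Qed.

(** The variables [Some v] are parameters, and [None] is the distinguished variable in which gadgets
    are composed. *)
Definition ppoly (V : Type) (w : (V -> T) -> T -> T) : Prop :=
  polyfun (fun E : option V -> T => w (fun v => E (Some v)) (E None)).

Definition bpoly (s : T -> T -> T) : Prop :=
  polyfun (fun E : bool -> T => s (E true) (E false)).

Lemma polyfun_b V s (F1 F2 : (V -> T) -> T) :
  bpoly s -> polyfun F1 -> polyfun F2 -> polyfun (fun E => s (F1 E) (F2 E)).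
Proof.
move=> bs p1 p2; apply: (polyfun_comp (B := A) (H := fun b : bool => if b then F1 else F2) bs).
by case.
Qed.

Lemma polyfun_u V h (F : (V -> T) -> T) : upoly h -> polyfun F -> polyfun (fun E => h (F E)).
Proof. by move/upolyP; apply. Qed.

Lemma upoly_fix V (w : (V -> T) -> T -> T) E : ppoly w -> upoly (w E).
Proof.
move=> pw; pose H (o : option V) (c : unit -> T) := if o is Some v then E v else c tt.
apply: (polyfun_comp (B := A) (H := H) pw) => - [v|]; first exact: polyfun_const.
exact: polyfun_var.
Qed.

Lemma ppoly_comp V (w w' : (V -> T) -> T -> T) :
  ppoly w -> ppoly w' -> ppoly (fun E u => w E (w' E u)).
Proof.
move=> pw pw'.
pose H (o : option V) (E : option V -> T) :=
  if o is Some v then E (Some v) else w' (fun v => E (Some v)) (E None).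
by apply: (polyfun_comp (B := A) (H := H) pw) => - [v|] //; apply: polyfun_var.
Qed.

Lemma ppoly_iter V n (w : (V -> T) -> T -> T) :
  ppoly w -> ppoly (fun E => iter n (w E)).
Proof.
move=> pw; elim: n => [|n IH]; first exact: polyfun_var.
exact: (ppoly_comp pw IH).
Qed.

Lemma ppoly_at V (w : (V -> T) -> T -> T) c : ppoly w -> ppoly (fun E _ => w E c).
Proof. by move=> pw; apply: (@ppoly_comp V w (fun _ _ => c)) => //; apply: polyfun_const. Qed.

Lemma upoly_b s x : bpoly s -> upoly (s x).
Proof. by move=> bs; apply: polyfun_b => //; [apply: polyfun_const | apply: polyfun_var]. Qed.

Let K := #|T|`!.
Let K_gt0 : 0 < K. Proof. exact: fact_gt0. Qed.

Definition closedU (g : T -> T) := {in U, forall u, g u \in U}.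
Definition idU (g : T -> T) := {in U, g =1 id}.
Definition collapses (g : T -> T) := forall x y, x \in U -> y \in U -> mu x y -> g x = g y.

Lemma closed_iter n g : closedU g -> closedU (iter n g).
Proof. by move=> gU u uU; elim: n => //= n IH; apply: gU. Qed.

Lemma iter_idU g x y : upoly g -> closedU g -> x \in U -> y \in U -> mu x y -> g x <> g y ->
  idU (iter K g).
Proof.
move=> ug gU xU yU mxy gxy; apply: iter_fact_in => //.
by apply: pocU => //; exists x, y.
Qed.

(** If [g] separates a [mu]-pair of [U], it permutes [U] and the iterate is the identity; otherwise
    the first application already identifies all such pairs. *)
Lemma idU_or_collapses g : upoly g -> closedU g -> idU (iter K g) \/ collapses (iter K g).
Proof.
move=> ug gU; case: (classic (collapses g)) => [cg|ncg]; [right|left].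
  by move=> x y xU yU mxy; rewrite -(prednK K_gt0) !iterSr (cg x y).
apply: NNPP => H; apply: ncg => x y xU yU mxy; apply: NNPP => gxy.
by apply: H; apply: (iter_idU ug gU xU yU).
Qed.

Lemma idU_not_collapses g : idU g -> ~ collapses g.
Proof. by move=> ig /(_ _ _ z0U o0U mu0); rewrite !ig. Qed.

Definition U_switch (s : T -> T -> T) : Prop :=
  [/\ bpoly s, forall x, closedU (s x), exists x, idU (s x) & exists x, ~ idU (s x)].

Section Switch.
Variables (n m : nat) (t : term S (n + m)) (a b : 'I_n -> T) (c d : 'I_m -> T).
Hypothesis mu_cd : forall j, mu (c j) (d j).
Notation tv x y := (teval (A := A) (join_env x y) t).
Hypothesis eq_a : tv a c = tv a d.
Hypothesis neq_b : tv b c <> tv b d.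

(* Day's term turns the failure of C(1,mu;0) into one of C(mu,1;0), whose
   mu-related arguments can be moved one polynomial image of (z0,o0) at a time. *)
Lemma transposed_failure : exists (q : ('I_n -> T) -> T -> T) z1 o1,
  [/\ ppoly q, z1 \in U, o1 \in U & mu z1 o1] /\ (q a z1 = q b z1 /\ q a o1 <> q b o1).
Proof.
have [m1 [pm1 m1E m1d]] := dayH (tv a c) neq_b.
(* For [y = c] the two middle arguments coincide and the outer ones are both [tv b c], so the value
   does not depend on [x]. For [y = d] the choices [x = a] and [x = b] give the two sides of
   [m1d]. *)
pose F y x := m1 (tv b c) (tv x c) (tv x y) (tv b y).
have Fc : F c a = F c b by rewrite /F !m1E.
have Fd : F d a <> F d b by rewrite /F -eq_a => h; apply: m1d.
have [i [w [h1 h2]]] := @walk _ _ (fun y => F y a = F y b) c d Fc Fd.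
(* The equivalence generated by the polynomial images of [(z0,o0)] is a congruence, hence contains
   [mu]. So [c i] and [d i] are joined by a chain of such images, and [P] changes along one of its
   links. *)
pose step x y := exists phi, [/\ upoly phi, x = phi z0 & y = phi o0].
pose th := clos_refl_sym_trans T step.
have th_cong : cong th.
  apply: congruence_upoly; first split.
  - exact: rst_refl.
  - exact: rst_trans.
  - exact: rst_sym.
  move=> f x y uf; elim=> [u v [phi [up -> ->]]|u|u v _|u v w' _ + _].
  - by apply: rst_step; exists (f \o phi); split=> //; apply: upoly_comp.
  - exact: rst_refl.
  - exact: rst_sym.
  - exact: rst_trans.
have thcd : th (c i) (d i).
  apply: (mu_min (x0 := z0) (y0 := o0) th_cong) => //.
  by apply: rst_step; exists id; split=> //; apply: upoly_id.
pose P u := F (upd w i u) a = F (upd w i u) b.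
have pq phi : upoly phi ->
    ppoly (fun (x : 'I_n -> T) u => F (upd w i (phi u)) x).
  move=> up; apply: polyfun4 => //.
  - exact: polyfun_const.
  - apply: polyfun_term => j; rewrite /join_env.
    by case: (split j) => l; [apply: polyfun_var | apply: polyfun_const].
  - apply: polyfun_term => j; rewrite /join_env.
    case: (split j) => l; first exact: polyfun_var.
    by apply: polyfun_upd; apply: polyfun_u => //; apply: polyfun_var.
  - apply: polyfun_term => j; rewrite /join_env.
    case: (split j) => l; first exact: polyfun_const.
    by apply: polyfun_upd; apply: polyfun_u => //; apply: polyfun_var.
apply: NNPP => H; apply: h2; rewrite -/(P (d i)).
suff [h _] : P (c i) <-> P (d i) by apply: h.
elim: thcd => {h1} [x y [phi [up -> ->]]|x|x y _ []|x y u _ [h1 h2] _ [h3 h4]] //; last by split; tauto.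
split=> hP; apply: NNPP => hn; apply: H.
- by exists (fun x u => F (upd w i (phi u)) x), z0, o0; split=> //; split=> //; apply: pq.
- exists (fun x u => F (upd w i (phi u)) x), o0, z0; split=> //; split=> //; first exact: pq.
  exact: mu_sym.
Qed.

Lemma exists_switch : exists s, U_switch s /\
  forall x, idU (s x) \/ collapses (s x).
Proof.
have [q [z1 [o1 [[pq z1U o1U mzo] [qz qo]]]]] := transposed_failure.
have [m1 [pm1 m1E m1d]] := dayH (q a z1) qo.
have [h [uh hU h1]] := sepU m1d.
(* For [x = a] this is constant in [u]. For [x = b] its values at [z1] and [o1] are the [h]-images
   of the two sides of [m1d], so the iterate is the identity of [U]. *)
pose w0 x u := h (m1 (q a o1) (q a u) (q x u) (q x o1)).
have pw0 : ppoly w0.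
  apply: (polyfun_u uh); apply: polyfun4 => //; first exact: polyfun_const.
  - exact: (polyfun_u (upoly_fix a pq) (polyfun_var _ None)).
  - exact: (ppoly_at o1 pq).
have cl x : closedU (w0 x) by move=> u _; apply: hU.
have idb : idU (iter K (w0 b)).
  apply: (iter_idU (upoly_fix b pw0) (cl b) z1U o1U mzo).
  by rewrite /w0 -qz => E; apply: h1.
have na : ~ idU (iter K (w0 a)).
  move/idU_not_collapses; apply=> x y _ _ _.
  by rewrite -(prednK K_gt0) !iterSr /w0 !m1E.
have [i [z [hn]]] := @walk _ _ (fun x => ~ idU (iter K (w0 x))) a b na (fun h => h idb).
move=> /NNPP hi.
exists (fun x => iter K (w0 (upd z i x))); split; last first.
  move=> x; apply: idU_or_collapses => //; exact: upoly_fix.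
split; last by exists (a i).
- have pk := ppoly_iter K pw0.
  pose H (o : option 'I_n) (E : bool -> T) :=
    if o is Some j then upd z i (E true) j else E false.
  apply: (polyfun_comp (B := A) (H := H) pk) => - [j|]; last exact: polyfun_var.
  by apply: polyfun_upd; apply: polyfun_var.
- by move=> x; apply: closed_iter.
- by exists (b i).
Qed.

End Switch.

(** The collapse now goes to a value [z] that the identity also keeps, so that composing switches
    with different parameters computes a conjunction. *)
Definition zero_switch (s : T -> T -> T) (z o : T) : Prop :=
  [/\ U_switch s, [/\ z \in U, o \in U, mu z o & z <> o] &
      forall x, idU (s x) \/ (s x z = z /\ s x o = z)].

Lemma polyop4_mu m x x' y y' z z' u u' :
  polyop4 m -> mu x x' -> mu y y' -> mu z z' -> mu u u' ->
  mu (m x y z u) (m x' y' z' u').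
Proof.
move=> pm hx hy hz hu.
have pF : polyfun (fun E : bool * bool -> T =>
    m (E (true, true)) (E (true, false)) (E (false, true)) (E (false, false))).
  by apply: polyfun4 => //; apply: polyfun_var.
pose mk (x y z u : T) (b : bool * bool) :=
  if b.1 then (if b.2 then x else y) else (if b.2 then z else u).
apply: (polyfun_cong (B := A) (e := mk x y z u) (e' := mk x' y' z' u') mu_cong pF).
by case=> [[] []].
Qed.

Lemma upoly_diag s : bpoly s -> forall o n, upoly (fun x => iter n (s x) o).
Proof.
move=> bs o; elim=> [|n IH]; first exact: polyfun_const.
by apply: polyfun_b => //; apply: polyfun_var.
Qed.

Lemma upoly_flip s o : bpoly s -> upoly (fun x => s x o).
Proof. by move=> bs; apply: (upoly_diag bs o 1). Qed.

Lemma iter_pred_idU g x y : upoly g -> closedU g -> x \in U -> y \in U -> mu x y ->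
  g x <> g y -> forall u, u \in U -> iter K.-1 g (g u) = u /\ g (iter K.-1 g u) = u.
Proof.
move=> ug gU xU yU mxy gxy u uU; have := iter_idU ug gU xU yU mxy gxy uU.
by rewrite -iterSr -iterS prednK.
Qed.

(** [M] behaves like a meet with unit [o] and idempotent [z]. First, the [mu]-class of [z] meets [U]
    only in [z] and [o]. Then Day's term gives a permutation [g] of [U] that sends every [v] other
    than [o] into the [mu]-class of [g z]; undoing [g] puts [v] into the class of [z]. *)
Lemma two_element (M : T -> T -> T) z o :
  bpoly M -> (forall x, closedU (M x)) -> z \in U -> o \in U -> mu z o -> z <> o ->
  (forall u, u \in U -> M o u = u) -> (forall u, u \in U -> M u o = u) ->
  M z z = z -> forall v, v \in U -> v = z \/ v = o.
Proof.
move=> bM cM zU oU mzo zo Mo1 Mo2 Mzz.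
have uM x : upoly (M x) by apply: (upoly_b x bM).
(* the K-th power map fixes [z] and [o], hence is a permutation, but it sends
   every [x] acting invertibly to [o] *)
pose f x := iter K (M x) o.
have f_inj : {in U &, injective f}.
  apply: pocU => [|u uU|]; first exact: (upoly_diag bM o K).
    exact: closed_iter.
  exists z, o; split=> //.
  have -> : f o = o by rewrite /f; elim: {1}K => //= n ->; rewrite Mo1.
  have -> // : f z = z.
  rewrite /f -(prednK K_gt0) iterSr Mo2 //.
  by elim: K.-1 => //= n ->.
have f_o : f o = o by rewrite /f; elim: {1}K => //= n ->; rewrite Mo1.
have act x : x \in U -> x <> o -> M x z = x.
  move=> xU xo; rewrite -[RHS](Mo2 x xU); apply: NNPP => H.
  apply: xo; apply: f_inj => //; rewrite f_o.
  exact: (iter_idU (uM x) (cM x) zU oU mzo H).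
have cls v : v \in U -> mu v z -> v = z \/ v = o.
  move=> vU mvz; case: (classic (v = o)) => [->|vo]; first by right.
  left; rewrite -(act v vU vo) -[RHS]Mzz; apply: NNPP => H.
  have gi : {in U &, injective (fun x => M x z)}.
    apply: pocU; [exact: (upoly_flip z bM) | by move=> u uU; apply: cM | ].
    by exists v, z.
  by apply: zo; apply: gi => //; rewrite Mzz Mo1.
move=> v vU; case: (classic (v = o)) => [->|vo]; first by right.
have [m [pm mE md]] := dayH z zo.
have [h [uh hU h1]] := sepU md.
pose g x := h (m z (M x z) (M x o) o).
have ug : upoly g.
  apply: (polyfun_u uh); apply: polyfun4 => //; try exact: polyfun_const.
    exact: (upoly_flip z bM).
  exact: (upoly_flip o bM).
have gU : closedU g by move=> u _; apply: hU.
have gzo : g z <> g o by rewrite /g Mzz !Mo2 // Mo1 // => E; apply: h1.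
apply: cls => //; have gK u uU := (iter_pred_idU ug gU zU oU mzo gzo (u := u) uU).1.
rewrite -(gK v vU) -[z in mu _ z](gK z zU).
apply: (upoly_cong mu_cong (upoly_iter _ ug)); rewrite /g Mzz !Mo2 // act //.
apply: (upoly_cong mu_cong uh); apply: (@mu_trans _ z).
  by rewrite -{2}(mE z v); apply: polyop4_mu => //; apply: mu_sym.
by apply: mu_sym; rewrite -{4}(mE z z); apply: polyop4_mu => //; apply: mu_sym.
Qed.

(** After iteration [c] acts as the identity and [d] collapses. The map [g] from parameters to the
    image of [w] permutes [U]; undoing it in the parameter makes [w] a two-sided unit and [r]
    idempotent, the situation of [two_element]. *)
Lemma zero_switch_of_meet (M : T -> T -> T) c d :
  bpoly M -> (forall x, closedU (M x)) -> c \in U -> d \in U -> mu c d ->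
  M c c <> M c d -> M d c = M d d -> exists s z o, zero_switch s z o.
Proof.
move=> bM cM cU dU mcd Mc Md.
have uM x : upoly (M x) by apply: (upoly_b x bM).
pose M1 x := iter K (M x).
have bM1 : bpoly M1.
  rewrite /M1 /bpoly; elim: K => [|n IH]; first exact: polyfun_var.
  by apply: polyfun_b => //; apply: polyfun_var.
have cM1 x : closedU (M1 x) by apply: closed_iter.
have M1c : idU (M1 c) by apply: (iter_idU (uM c) (cM c) cU dU).
have M1d : collapses (M1 d).
  case: (idU_or_collapses (uM d) (cM d)) => // H.
  have := H c cU; have := H d dU; rewrite -(prednK K_gt0) !iterSr Md => -> E.
  by case: Mc; rewrite E.
pose r := M1 d d.
have rU : r \in U by apply: cM1.
have [w [wU wr mw]] : exists w, [/\ w \in U, w <> r & mu w d].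
  case: (classic (d = r)) => [E|ne]; last by exists d.
  by exists c; split=> // E'; apply: Mc; rewrite E' -E.
pose g x := M1 x w.
have ug : upoly g by apply: (upoly_flip w bM1).
have gU : closedU g by move=> u uU; apply: cM1.
have gc : g c = w by apply: M1c.
have gd : g d = r by apply: M1d.
have mr : mu r w.
  by rewrite -gd -gc; apply: (upoly_cong mu_cong ug); apply: mu_sym.
have gcd : g c <> g d by rewrite gc gd.
have gK u uU := iter_pred_idU ug gU cU dU mcd gcd (u := u) uU.
pose gi := iter K.-1 g.
have ugi : upoly gi by apply: upoly_iter.
have giw : gi w = c by rewrite -gc; apply: (gK c cU).1.
have gir : gi r = d by rewrite -gd; apply: (gK d dU).1.
pose M2 x u := M1 (gi x) u.
have M2r : M2 r r = r by rewrite /M2 gir; apply: M1d => //; apply: mu_trans mw.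
have bM2 : bpoly M2.
  exact: (polyfun_b bM1 (polyfun_u ugi (polyfun_var _ true)) (polyfun_var _ false)).
have M2w u : u \in U -> M2 u w = u by move=> uU; apply: (gK u uU).2.
have M2w' u : u \in U -> M2 w u = u by move=> uU; rewrite /M2 giw M1c.
have rw : r <> w by move=> E; apply: wr.
have two := @two_element M2 r w bM2 (fun x => cM1 _) rU wU mr rw M2w' M2w M2r.
(* Precomposing with [e] sends an arbitrary parameter into [U], hence to [r] or to [w]. *)
exists (fun x => M2 (e x)), r, w; split=> //; first split.
- exact: (polyfun_b bM2 (polyfun_u upoly_e (polyfun_var _ true)) (polyfun_var _ false)).
- by move=> x; apply: cM1.
- by exists w; rewrite eK.
- exists r; rewrite eK // => /(_ w wU); rewrite M2w // => E; exact: rw.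
- move=> x; case: (two _ (eU x)) => ->; [right | left] => //.
  by rewrite M2r M2w.
Qed.

(** If a Day term violates [m z z y z = z] on a [mu]-pair of [U], it sends the collapsing [s x] to
    the value [h z] and the identity to a permutation [g], which [iter K.-1 g] undoes. If none does,
    [m o0 u z0 x] takes equal values at [u = z0] and [u = o0] for [x = o0] but not for [x = z0], and
    [zero_switch_of_meet] applies. *)
Lemma exists_zero_switch s : U_switch s ->
  (forall x, idU (s x) \/ collapses (s x)) -> exists s z o, zero_switch s z o.
Proof.
move=> [bs cs [xg hg] [xb hb]] dich.
case: (classic (exists m y z, [/\ polyop4 m, forall x y, m x y y x = x,
    [/\ y \in U, z \in U & mu z y] & m z z y z <> z])).
  move=> [m [y [z [pm mE [yU zU mzy] md]]]].
  have [h [uh hU h1]] := sepU md.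
  pose s1 x u := h (m z (s x z) (s x u) z).
  pose g u := h (m z z u z).
  have ug : upoly g.
    by apply: (polyfun_u uh); apply: polyfun4 => //; try exact: polyfun_const; apply: polyfun_var.
  have gU : closedU g by move=> u _; apply: hU.
  have gz : g z = h z by rewrite /g mE.
  have gK u uU := (iter_pred_idU ug gU zU yU mzy (fun E => h1 (etrans (esym E) gz)) (u := u) uU).1.
  have zy : z <> y by move=> E; apply: md; rewrite -E mE.
  have bad x : collapses (s x) -> iter K.-1 g (s1 x z) = z /\ iter K.-1 g (s1 x y) = z.
    by move=> cx; rewrite /s1 -(cx z y) // mE -gz gK.
  exists (fun x u => iter K.-1 g (s1 x u)), z, y; split=> //; first split.
  - apply: (polyfun_u (upoly_iter K.-1 ug)).
    apply: (polyfun_u uh); apply: polyfun4 => //; try exact: polyfun_const.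
    have pc : polyfun (fun _ : bool -> T => z) by exact: polyfun_const.
    exact: (polyfun_b bs (polyfun_var _ true) pc).
  - by move=> x u uU; apply: closed_iter => //; apply: hU.
  - by exists xg => u uU; rewrite /s1 !hg // gK.
  - exists xb; case: (dich xb) => // cx hx.
    by apply: zy; rewrite -[RHS](hx y yU) (bad xb cx).2.
  - move=> x; case: (dich x) => [hx|cx]; [left=> u uU | right; exact: bad].
    by rewrite /s1 !hx // gK.
move=> nalpha.
have [m [pm mE md]] := dayH z0 (fun E => zo0 (esym E) : False).
have [h [uh hU h1]] := sepU md.
apply: (@zero_switch_of_meet (fun x u => h (m o0 u z0 x)) z0 o0) => //.
- apply: (polyfun_u uh); apply: polyfun4 => //; try exact: polyfun_const; exact: polyfun_var.
- by move=> x u _; apply: hU.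
- by move=> /esym.
- rewrite mE; congr h; apply: NNPP => H; apply: nalpha.
  exists m, z0, o0; split=> //; last by move=> E; apply: H.
  by split=> //; apply: mu_sym.
Qed.

(** In [h (m o u (w E u) (w E o))] an identity [w E] gives [m o u u o = o], a constant. A collapse
    to [z] gives [m o z z z] at [z] and [m o o z z] at [o], which [h] separates, so an iterate is
    the identity. The [mu]-pair [r], [r'] lets the complement be used in a conjunction in its
    turn. *)
Lemma complement V (w : (V -> T) -> T -> T) z o :
  ppoly w -> (forall E, closedU (w E)) -> z \in U -> o \in U -> mu z o -> z <> o ->
  (forall E, idU (w E) \/ (w E z = z /\ w E o = z)) ->
  exists w' r r', [/\ ppoly w' /\ (forall E, closedU (w' E)),
    [/\ r \in U, r' \in U, mu r r' & r <> r'],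
    forall E, idU (w E) -> {in U, forall u, w' E u = r} &
    forall E, ~ idU (w E) -> idU (w' E)].
Proof.
move=> pw cw zU oU mzo zo dich.
have [m [pm mE md]] := dayH z (fun E => zo (esym E) : False).
have [h [uh hU h1]] := sepU md.
pose w0 E u := h (m o u (w E u) (w E o)).
have pw0 : ppoly w0.
  apply: (polyfun_u uh); apply: polyfun4 => //.
  - exact: polyfun_const.
  - exact: polyfun_var.
  - exact: ppoly_at.
have c0 E : closedU (w0 E) by move=> u _; apply: hU.
have moz : mu o z by apply: mu_sym.
have [r' [r'U mr rr]] : exists r', [/\ r' \in U, mu (h o) r' & h o <> r'].
  have H x : mu o x -> mu (h o) (h x) by move=> ox; apply: (upoly_cong mu_cong uh ox).
  case: (classic (h o = h (m o o z z))) => [E|ne].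
    exists (h (m o z z z)); split=> //; last by rewrite E.
    by apply: H; rewrite -{1}(mE o o); apply: polyop4_mu.
  exists (h (m o o z z)); split=> //.
  by apply: H; rewrite -{1}(mE o o); apply: polyop4_mu.
exists (fun E => iter K (w0 E)), (h o), r'; split.
- by split; [apply: ppoly_iter | move=> E; apply: closed_iter].
- by split.
- move=> E iw; have H u : u \in U -> w0 E u = h o by move=> uU; rewrite /w0 !iw // mE.
  move=> u uU; rewrite -(prednK K_gt0) iterSr H //.
  by elim: K.-1 => //= n ->; apply: H.
- move=> E nw; apply: (iter_idU (upoly_fix E pw0) (c0 E) zU oU mzo).
  by case: (dich E) => // - [wz wo]; rewrite /w0 wz wo => E'; apply: h1.
Qed.

Definition truth (s : T -> T -> T) (x : T) : bool := [forall u in U, s x u == u].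

Lemma truthP s x : reflect (idU (s x)) (truth s x).
Proof.
by apply: (iffP forall_inP) => h u uU; [apply/eqP/h | apply/eqP/h].
Qed.

Definition clause_sat V (tr : pred T) (E : V -> T) (c : bool * seq V) : bool :=
  if c.1 then has (fun v => tr (E v)) c.2 else ~~ all (fun v => tr (E v)) c.2.

Definition gate_for V (w : (V -> T) -> T -> T) (P : (V -> T) -> bool) : Prop :=
  [/\ ppoly w, forall E, closedU (w E) &
      forall E, if P E then idU (w E) else exists c, {in U, forall u, w E u = c}].

(* conjunction: composition in the distinguished variable *)
Lemma ppoly_chain V s z o (vs : seq V) :
  bpoly s -> (forall x, closedU (s x)) -> z \in U -> o \in U -> 
  (forall x, idU (s x) \/ (s x z = z /\ s x o = z)) ->
  exists w, [/\ @ppoly V w, forall E, closedU (w E),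
    forall E, all (fun v => truth s (E v)) vs -> idU (w E) &
    forall E, ~~ all (fun v => truth s (E v)) vs -> w E z = z /\ w E o = z].
Proof.
move=> bs cs zU oU dich.
have sz x : s x z = z by case: (dich x) => [->|[]].
elim: vs => [|v vs [w [pw cw w1 w2]]].
  by exists (fun _ u => u); split; [exact: polyfun_var | move=> E u | move=> E _ u | ].
exists (fun E u => s (E v) (w E u)); split.
- exact: (polyfun_b bs (polyfun_var _ (Some v)) pw).
- by move=> E u uU; apply/cs/cw.
- by move=> E /= /andP[/truthP h1 h2] u uU; rewrite w1 // h1.
- move=> E /=; rewrite negb_and.
  case: (boolP (all _ vs)) => h2; last by move=> _; have [-> ->] := w2 E h2; rewrite sz.
  rewrite orbF => /truthP h1; rewrite !w1 //.
  by case: (dich (E v)).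
Qed.

Lemma negative_clause V s z o (vs : seq V) : zero_switch s z o ->
  exists w, gate_for w (fun E => clause_sat (truth s) E (false, vs)).
Proof.
move=> [[bs cs _ _] [zU oU mzo zo] dich].
have [w [pw cw w1 w2]] := ppoly_chain vs bs cs zU oU dich.
have dw E : idU (w E) \/ (w E z = z /\ w E o = z).
  by case: (boolP (all (fun v => truth s (E v)) vs)) => h; [left; apply: w1 | right; apply: w2].
have [w' [r [r' [[pw' cw'] _ c1 c2]]]] := complement pw cw zU oU mzo zo dw.
exists w'; split=> // E; rewrite /clause_sat /=; case: ifP => [h|/negbFE h].
  apply: c2 => iw; have [_] := w2 E h; rewrite iw // => /esym; exact: zo.
by exists r; apply: c1; apply: w1.
Qed.

(** De Morgan: a disjunction is the complement of a conjunction of complements. The complement of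
    [s] fixes [U] or sends [r] and [r'] to [r], so [ppoly_chain] applies to it. *)
Lemma positive_clause V s z o (vs : seq V) : zero_switch s z o ->
  exists w, gate_for w (fun E => clause_sat (truth s) E (true, vs)).
Proof.
move=> [[bs cs _ _] [zU oU mzo zo] dich].
have pbs : ppoly (fun E : unit -> T => s (E tt)).
  exact: (polyfun_b bs (polyfun_var _ (Some tt)) (polyfun_var _ None)).
have [n [r [r' [[pn cn] [rU r'U mr rr] n1 n2]]]] :=
  complement pbs (fun E => cs _) zU oU mzo zo (fun E => dich _).
pose n' x := n (fun=> x).
have bn : bpoly n'.
  pose H (o : option unit) (E : bool -> T) := if o is Some _ then E true else E false.
  by apply: (polyfun_comp (B := A) (H := H) pn) => - [v|]; apply: polyfun_var.
have dn x : idU (n' x) \/ (n' x r = r /\ n' x r' = r).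
  case: (classic (idU (s x))) => h; last by left; apply: (n2 (fun=> x)).
  by right; split; apply: (n1 (fun=> x)).
have ntr x : truth n' x = ~~ truth s x.
  case: (boolP (truth s x)) => /truthP h.
    by apply/truthP => /(_ r' r'U); rewrite /n' n1.
  by apply/truthP; apply: n2.
have [w [pw cw w1 w2]] := ppoly_chain vs bn (fun x => cn _) rU r'U dn.
have dw E : idU (w E) \/ (w E r = r /\ w E r' = r).
  by case: (boolP (all (fun v => truth n' (E v)) vs)) => h; [left; apply: w1 | right; apply: w2].
have [w' [r1 [r1' [[pw' cw'] _ c1 c2]]]] := complement pw cw rU r'U mr rr dw.
exists w'; split=> // E; rewrite /clause_sat /=.
have -> : has (fun v => truth s (E v)) vs = ~~ all (fun v => truth n' (E v)) vs.
  by rewrite -has_predC; apply: eq_has => v /=; rewrite ntr negbK.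
case: ifP => [h|/negbFE h].
  apply: c2 => iw; have [_] := w2 E h; rewrite iw // => /esym; exact: rr.
by exists r1; apply: c1; apply: w1.
Qed.

(** Identities compose to the identity, and one constant factor makes the composite constant on
    [U]. *)
Lemma clauses_gate V s z o (cl : seq (bool * seq V)) : zero_switch s z o ->
  exists w, gate_for w (fun E => all (clause_sat (truth s) E) cl).
Proof.
move=> zs; elim: cl => [|[pol vs] cl [w [pw cw wE]]].
  by exists (fun _ u => u); split; [exact: polyfun_var | move=> E u | move=> E u].
have [w' [pw' cw' w'E]] : exists w', gate_for w' (fun E => clause_sat (truth s) E (pol, vs)).
  by case: pol; [apply: positive_clause zs | apply: negative_clause zs].
exists (fun E u => w' E (w E u)); split.
- exact: ppoly_comp.
- by move=> E u uU; apply/cw'/cw.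
move=> E /=; have := w'E E; have := wE E.
case: ifP => h; last first.
  rewrite andbF => - [c hc] _; exists (w' E c) => u uU; by rewrite hc.
move=> wi; case: ifP => /= [h1 w'i u uU|h1 [c hc]]; first by rewrite wi // w'i.
by exists c => u uU; rewrite wi // hc.
Qed.

End Gadgets.

(** * A quotient with gadgets *)

Definition asb (P : Prop) : bool :=
  if excluded_middle_informative P then true else false.

Lemma asbP P : reflect P (asb P).
Proof. by rewrite /asb; case: excluded_middle_informative => h; constructor. Qed.

Section Relations.
Variables (S : signature) (A : finAlgebra S).
Notation T := (fcar A).
Notation cong := (is_congruence (A := alg_of_fin A)).

Definition graph (r : T -> T -> Prop) : {set T * T} := [set p | asb (r p.1 p.2)].

Lemma graphP r x y : reflect (r x y) ((x, y) \in graph r).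
Proof. by rewrite inE; apply: asbP. Qed.

Lemma cong_teval (th : T -> T -> Prop) n (t : term S n) (e e' : 'I_n -> T) :
  cong th -> (forall i, th (e i) (e' i)) ->
  th (teval (A := A) e t) (teval (A := A) e' t).
Proof. by move=> [_ co] h; elim: t => //= f ts IH; apply: co. Qed.

Lemma lcs_cong k : cong (lcs (A := A) k).
Proof.
case: k => [|k] /=; first by split; [split | ].
split; first split.
- by move=> x de [[rf _ _] _] _; apply: rf.
- move=> x y z xy yz de cd td; have [[_ tr _] _] := cd.
  exact: tr (xy _ cd td) (yz _ cd td).
- move=> x y xy de cd td; have [[_ _ sy] _] := cd; exact: sy (xy _ cd td).
- by move=> f x y xy de cd td; have [_ co] := cd; apply: co => i; apply: xy.
Qed.

(** [lcs k] is itself one of the congruences over which the commutator is intersected: terms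
    preserve it, so the conclusion of the term condition always holds. *)
Lemma lcs_desc k x y : lcs (A := A) k.+1 x y -> lcs (A := A) k x y.
Proof.
apply; first exact: lcs_cong.
move=> n m t a b c d _ cd _; apply: cong_teval; first exact: lcs_cong.
move=> i; rewrite /join_env; case: (split i) => j; last exact: cd.
by have [[rf _ _] _] := lcs_cong k; apply: rf.
Qed.

Lemma lcs_stable : exists k, forall x y, lcs (A := A) k x y -> lcs (A := A) k.+1 x y.
Proof.
apply: NNPP => H.
have lt k : #|graph (lcs (A := A) k.+1)| < #|graph (lcs (A := A) k)|.
  apply: proper_card; apply/andP; split.
    by apply/subsetP => - [x y] /graphP h; apply/graphP; apply: lcs_desc.
  apply/negP => /subsetP h; apply: H; exists k => x y /graphP hxy.
  by apply/graphP; apply: h.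
have le k : #|graph (lcs (A := A) k)| + k <= #|graph (lcs (A := A) 0)|.
  elim: k => [|k IH]; first by rewrite addn0.
  by apply: leq_trans IH; rewrite addnS -addSn leq_add2r.
by have := le (#|graph (lcs (A := A) 0)|).+1; lia.
Qed.

(** Strictly larger congruences have strictly larger graphs, so the search ends. Every congruence
    properly above [de] contains [ga]; in the quotient by [de] the image of [ga] thus lies in every
    nontrivial congruence. *)
Lemma maximal_avoiding (ga : T -> T -> Prop) :
  (exists x y, ga x y /\ x <> y) ->
  exists de, [/\ cong de, ~ (forall x y, ga x y -> de x y) &
    forall th, cong th -> (forall x y, de x y -> th x y) ->
      (exists x y, th x y /\ ~ de x y) -> forall x y, ga x y -> th x y].
Proof.
move=> [x0 [y0 [g0 n0]]]; apply: NNPP => H.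
suff Hn n de : cong de -> ~ (forall x y, ga x y -> de x y) -> 
    #|graph de| + n <= #|{: T * T}|.
  have ce : cong eq.
    split; first by split; [move=> x | move=> x y z -> -> | move=> x y ->].
    by move=> f x y xy; congr (op _ f _); apply: functional_extensionality.
  have ne : ~ (forall x y, ga x y -> x = y) by move=> h; apply: n0; apply: h.
  by have := Hn (#|{: T * T}|).+1 eq ce ne; lia.
elim: n de => [|n IH] de cd nd; first by rewrite addn0 max_card.
apply: NNPP => hn; apply: H; exists de; split=> // th ct le [x [y [txy dxy]]].
apply: NNPP => nt; apply: hn.
have : #|graph de| < #|graph th|; last by have := IH th ct nt; lia.
apply: proper_card; apply/andP; split.
  by apply/subsetP => - [u v] /graphP h; apply/graphP; apply: le.
by apply/negP => /subsetP h; apply: dxy; apply/graphP; apply: h; apply/graphP.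
Qed.

End Relations.

(** * Quotient algebras on canonical representatives *)

Section Quotient.
Variables (S : signature) (A : finAlgebra S).
Notation T := (fcar A).
Variable de : T -> T -> Prop.
Hypothesis de_cong : is_congruence (A := alg_of_fin A) de.

(** [pick] sees only the class of [x], so its choice is constant on classes; the fixed points form
    the finite type required of a quotient. *)
Definition canon (x : T) : T := odflt x [pick y | asb (de x y)].

Lemma canon_de x : de x (canon x).
Proof.
rewrite /canon; case: pickP => [y /asbP //|_].
by have [[rf _ _] _] := de_cong; apply: rf.
Qed.

Lemma canon_eq x y : de x y -> canon x = canon y.
Proof.
move=> xy; have [[rf tr sy] _] := de_cong.
rewrite /canon; have -> : [pick u | asb (de x u)] = [pick u | asb (de y u)].
  apply: eq_pick => u; apply/asbP/asbP; apply: tr => //; exact: sy.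
case: pickP => //= /(_ y) /asbP; case; exact: rf.
Qed.

Lemma canonK x : canon (canon x) == canon x.
Proof. by apply/eqP; apply/esym/canon_eq/canon_de. Qed.

Definition quot_type : finType := {x : T | canon x == x}.
Definition quot_map (x : T) : quot_type := exist _ (canon x) (canonK x).
Definition quot : finAlgebra S :=
  @FinAlgebra S quot_type
    (fun f x => quot_map (fop (f := f) (fun j => val (x j)))).

Lemma quot_mapP x y : quot_map x = quot_map y <-> de x y.
Proof.
have [[rf tr sy] _] := de_cong; split; last first.
  by move=> h; apply: val_inj; apply: canon_eq.
move=> [h]; apply: (tr _ (canon x)); first exact: canon_de.
by rewrite h; apply/sy/canon_de.
Qed.

Lemma quot_hom : is_hom (A := A) (B := quot) quot_map.
Proof.
move=> f x; apply/quot_mapP; have [_ co] := de_cong.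
by apply: co => i; apply: canon_de.
Qed.

Lemma quot_surj (y : fcar quot) : exists x, quot_map x = y.
Proof. by case: y => x h; exists x; apply: val_inj; apply/eqP. Qed.

End Quotient.

(** A subalgebra of a power of [B] is pulled back along [h] to a subalgebra of the same power of
    [A], which has the same image. *)
Lemma CM_variety_image (S : signature) (A B : algebra S) (h : A -> B) :
  is_hom h -> (forall y, exists x, h x = y) -> CM_variety A -> CM_variety B.
Proof.
move=> hh hs CM C [I [P [g [P1 [P2 P3]]]]]; apply: CM.
have comp_op f (x : 'I_(arity f) -> I -> A) :
    (fun i => h (op A f (fun j => x j i))) = (fun i => op B f (fun j => h (x j i))).
  by apply: functional_extensionality => i; rewrite hh.
exists I, (fun x => P (fun i => h (x i))), (fun x => g (fun i => h (x i))).
split; [|split].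
- by move=> f x px; rewrite comp_op; apply: (P1 f (fun j i => h (x j i))).
- move=> c; have [x [px gx]] := P2 c.
  pose sec y := proj1_sig (constructive_indefinite_description _ (hs y)).
  have secK y : h (sec y) = y by rewrite /sec; case: constructive_indefinite_description.
  exists (fun i => sec (x i)).
  have -> // : (fun i => h (sec (x i))) = x.
  by apply: functional_extensionality => i; apply: secK.
- by move=> f x px; rewrite comp_op; apply: (P3 f (fun j i => h (x j i))).
Qed.

Lemma teval_hom (S : signature) (A B : algebra S) (h : A -> B) n (t : term S n) e :
  is_hom h -> h (teval (A := A) e t) = teval (A := B) (fun i => h (e i)) t.
Proof.
move=> hh; elim: t => //= f ts IH; rewrite hh; congr (op B f _).
by apply: functional_extensionality => j; apply: IH.
Qed.

Definition penv (V T : Type) (E : V -> T) (u : T) (o : option V) : T :=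
  if o is Some v then E v else u.

(* [tr] reads a truth value off an element; a gadget for a set of clauses is a
   polynomial in a distinguished variable which, depending on the truth values of
   the other variables, fixes [z] and [o] or identifies them. *)
Definition has_gadgets (S : signature) (B : finAlgebra S) : Prop :=
  exists (z o : fcar B) (tr : pred (fcar B)),
  [/\ z <> o, exists x, tr x, exists x, ~~ tr x &
    forall V (cl : seq (bool * seq V)), exists t : pterm (alg_of_fin B) (option V),
    forall E : V -> fcar B,
      if all (clause_sat tr E) cl then
        peval (B := alg_of_fin B) (penv E z) t = z /\ peval (B := alg_of_fin B) (penv E o) t = o
      else peval (B := alg_of_fin B) (penv E z) t = peval (B := alg_of_fin B) (penv E o) t].

Lemma has_gadgets_monolith (S : signature) (B : finAlgebra S) (mu : fcar B -> fcar B -> Prop)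
    n m (t : term S (n + m)) (a b : 'I_n -> fcar B) (c d : 'I_m -> fcar B) :
  CM_variety B ->
  is_congruence (A := B) mu ->
  (forall th x0 y0, is_congruence (A := B) th -> th x0 y0 -> x0 <> y0 ->
     forall x y, mu x y -> th x y) ->
  (forall j, mu (c j) (d j)) ->
  teval (A := B) (join_env a c) t = teval (A := B) (join_env a d) t ->
  teval (A := B) (join_env b c) t <> teval (A := B) (join_env b d) t ->
  has_gadgets B.
Proof.
move=> CM mc mm mcd ea nb.
have mne : exists x y, mu x y /\ x <> y.
  exists (teval (A := B) (join_env b c) t), (teval (A := B) (join_env b d) t).
  split=> //; apply: cong_teval => // i; rewrite /join_env; case: (split i) => //.
  by move=> j; have [[rf _ _] _] := mc; apply: rf.
have [U [e [ue [eU eK] [z0 [o0 [z0U o0U m0 zo0]]] sep poc]]] := minimal_set mc mm mne.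
have dy := day CM.
have [s0 [s0s s0d]] := exists_switch mc mm dy z0U o0U m0 zo0 sep poc mcd ea nb.
have [s [z [o zs]]] := exists_zero_switch mc dy ue eU eK z0U o0U m0 zo0 sep poc s0s s0d.
have [[_ _ [xt ht] [xf hf]] [zU oU _ zo] _] := zs.
exists z, o, (truth U s); split=> //.
- by exists xt; apply/truthP.
- by exists xf; apply/negP => /truthP.
move=> V cl; have [w [[tw twE] _ wE]] := clauses_gate mc dy sep poc cl zs.
exists tw => E; have := wE E; rewrite !twE /=.
case: ifP => _ h; first by rewrite !h.
by have [k hk] := h; rewrite !hk.
Qed.

Theorem nonnilpotent_quotient (S : signature) (A : finAlgebra S) :
  CM_variety (alg_of_fin A) -> ~ nilpotent (alg_of_fin A) ->
  exists (B : finAlgebra S) (h : fcar A -> fcar B),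
    [/\ is_hom (A := A) (B := B) h, forall y, exists x, h x = y & has_gadgets B].
Proof.
move=> CM nn.
have [k st] := lcs_stable A; pose ga := lcs (A := A) k.
have gne : exists x y, ga x y /\ x <> y.
  apply: NNPP => H; apply: nn; exists k => x y; split.
    by move=> h; apply: NNPP => xy; apply: H; exists x, y.
  by move=> ->; have [[rf _ _] _] := lcs_cong A k; apply: rf.
have [de [cd nde max]] := maximal_avoiding gne.
(* By stability [ga] is contained in its commutator with the full congruence, the intersection of
   all congruences that satisfy the term condition. As [de] is not above [ga], it violates that
   condition. *)
have [n [m [t [a [b [c [d [gcd ea nb]]]]]]]] : exists n m (t : term S (n + m))
    (a b : 'I_n -> fcar A) (c d : 'I_m -> fcar A),
  [/\ forall j, ga (c j) (d j),
      de (teval (A := A) (join_env a c) t) (teval (A := A) (join_env a d) t) &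
      ~ de (teval (A := A) (join_env b c) t) (teval (A := A) (join_env b d) t)].
  apply: NNPP => H; apply: nde => x y /st; apply=> //.
  move=> n m t a b c d _ gcd ea; apply: NNPP => nb; apply: H.
  by exists n, m, t, a, b, c, d.
pose B := quot cd; pose h := quot_map cd; exists B, h.
have hh := quot_hom cd; have hs := quot_surj (de_cong := cd).
split=> //.
(* The intersection of all nontrivial congruences of [B]. Maximality of [de] puts the image of [ga]
   below each of them. *)
pose mu (x y : fcar B) := forall th u v, is_congruence (A := B) th -> th u v -> u <> v -> th x y.
have mh x y : ga x y -> mu (h x) (h y).
  move=> gxy th u v ct tuv uv.
  pose th' (x y : fcar A) := th (h x) (h y).
  have [[rf tr sy] co] := ct.
  apply: (max th') => //.
  - split; first split.
    + by move=> ?; apply: rf.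
    + by move=> ? ? ?; apply: tr.
    + by move=> ? ?; apply: sy.
    + by move=> f x1 y1 h1; rewrite /th' /h !hh; apply: co.
  - by move=> x1 y1 /(quot_mapP cd) E; rewrite /th' /h E; apply: rf.
  - have [u' hu] := hs u; have [v' hv] := hs v; exists u', v'; split.
      by rewrite /th' /h hu hv.
    by move/(quot_mapP cd) => E; apply: uv; rewrite -hu -hv.
have jE p (x : 'I_p -> fcar A) q (y : 'I_q -> fcar A) (t' : term S (p + q)) :
    teval (A := B) (join_env (fun i => h (x i)) (fun j => h (y j))) t' =
    h (teval (A := A) (join_env x y) t').
  rewrite /h (teval_hom _ _ hh); congr teval; apply: functional_extensionality => i.
  by rewrite /join_env; case: (split i).
apply: (@has_gadgets_monolith S B mu n m t (h \o a) (h \o b) (h \o c) (h \o d)).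
- exact: CM_variety_image hh hs CM.
- split; first split.
  + by move=> x th u v [[rf _ _] _] _ _; apply: rf.
  + move=> x y z xy yz th u v ct tuv uv; have [[_ tr _] _] := ct.
    exact: tr (xy _ _ _ ct tuv uv) (yz _ _ _ ct tuv uv).
  + move=> x y xy th u v ct tuv uv; have [[_ _ sy] _] := ct.
    exact: sy (xy _ _ _ ct tuv uv).
  + move=> f x y xy th u v ct tuv uv; have [_ co] := ct.
    apply: co => i; exact: (xy i _ _ _ ct tuv uv).
- by move=> th x0 y0 ct t0 n0 x y h1; apply: (h1 _ _ _ ct t0 n0).
- by move=> j; apply: mh.
- by rewrite /comp !jE; apply/(quot_mapP cd).
- by rewrite /comp !jE => /(quot_mapP cd).
Qed.

(** * Turing machines and stack machines *)

Section TapeContents.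
Variable M : TM.
Implicit Types (c : nat -> tG M) (cf : config M).

(* Cell 0 lies [i - size l] blank cells to the left of the stored left part. *)
Definition conf_at (q : tQ M) (i : nat) c cf : Prop :=
  let: (q', l, h, r) := cf in
  [/\ q' = q, size l <= i &
      forall n, c n = nth (tblank M)
        (nseq (i - size l) (tblank M) ++ rev l ++ h :: r) n].

Definition write c (i : nat) (g : tG M) : nat -> tG M :=
  fun n => if n == i then g else c n.

Definition move_head (d : dir) (i : nat) : nat :=
  match d with DL => i.-1 | DR => i.+1 | DN => i end.

Lemma conf_at_ext q i c c' cf : c =1 c' -> conf_at q i c cf -> conf_at q i c' cf.
Proof.
move=> ecc; case: cf => [[[q' l] h] r] [-> sl cE]; split=> // n.
by rewrite -ecc cE.
Qed.

Lemma conf_at_state q i c cf : conf_at q i c cf -> tm_state M cf = q.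
Proof. by case: cf => [[[q' l] h] r] [->]. Qed.

Lemma conf_at_halt q i c cf : conf_at q i c cf -> thalt M q -> tm_step M cf = cf.
Proof. by case: cf => [[[q' l] h] r] [-> _ _] hq; rewrite /tm_step hq. Qed.

Lemma conf_at_step q i c cf q' g d :
  conf_at q i c cf -> thalt M q = false -> tdelta M q (c i) = (q', g, d) ->
  (d = DL -> 0 < i) ->
  conf_at q' (move_head d i) (write c i g) (tm_step M cf).
Proof.
case: cf => [[[q0 l] h] r] [-> sl cE] hq.
have -> : c i = h.
  rewrite cE nth_cat size_nseq ltnNge leq_subr /= nth_cat size_rev.
  have -> : i - (i - size l) = size l by lia.
  by rewrite ltnn subnn.
rewrite /tm_step hq => ->.
have wE n : write c i g n = nth (tblank M)
        (nseq (i - size l) (tblank M) ++ rev l ++ g :: r) n.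
  rewrite /write cE !nth_cat size_nseq size_rev.
  case: eqP => [->|ni].
    rewrite ltnNge leq_subr /=.
    have -> : i - (i - size l) = size l by lia.
    by rewrite ltnn subnn.
  case: ltnP => // h1; case: ltnP => // h2.
  by case E: (n - _ - _) => //; exfalso; lia.
case: d => /= di.
- case: l sl cE wE => [|l1 ls] /= sl cE wE.
    split=> // n; rewrite wE subn0 /=.
    have i0 := di erefl; rewrite -[in LHS](prednK i0) subn0.
    by rewrite -addn1 nseqD -catA.
  split=> //; first by lia.
  move=> n; rewrite wE.
  have -> : i.-1 - size ls = i - (size ls).+1 by lia.
  by rewrite rev_cons cat_rcons.
- case: r cE wE => [|r1 rs] cE wE; split=> // n; rewrite ?wE /= subSS //.
    rewrite rev_cons cat_rcons !nth_cat; case: ltnP => // _; case: ltnP => // _.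
    by case: (n - _ - _) => [|[|m]] /=; rewrite ?nth_nil.
  by rewrite rev_cons cat_rcons.
- by split.
Qed.

(** The position [k] of the first input symbol is free: 0 for stack machines, which never move left
    of the input, and the left margin [2 * D] for tableaux, so that head positions stay natural
    numbers. *)
Lemma conf_at_init x k :
  conf_at (tstart M) k
    (fun n => if n < k then tblank M else nth (tblank M) (map (tin M) x) (n - k))
    (tm_init M x).
Proof.
rewrite /tm_init; case: x => [|b x] /=; split=> // n; rewrite subn0 nth_cat;
  rewrite size_nseq nth_nseq; case: (ltnP n k) => //= _.
by case: (n - k) => [|m] /=; rewrite ?nth_nil.
Qed.

Lemma tm_run_mono (x : seq bool) n m :
  n <= m -> thalt M (tm_state M (tm_run M n x)) -> tm_run M m x = tm_run M n x.
Proof.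
move=> /subnK <- h; elim: (m - n) => // d IH.
have -> : tm_run M (d.+1 + n) x = tm_step M (tm_run M (d + n) x) by [].
rewrite IH; case: (tm_run M n x) h => [[[q l] hd] r].
by rewrite /tm_state /= => ->.
Qed.

End TapeContents.

Definition stacks (G : Type) := seq (seq G).

Section Stacks.
Variable G : Type.
Implicit Types (s : stacks G) (u : seq G).

Definition get s (j : nat) : seq G := nth [::] s j.
Definition put s (j : nat) u : stacks G := set_nth [::] s j u.
Definition total s : nat := sumn (map size s).

Lemma get_put s i j u : get (put s j u) i = if i == j then u else get s i.
Proof. by rewrite /get nth_set_nth. Qed.

Lemma put_put s j u v : put (put s j u) j v = put s j v.
Proof. by rewrite /put set_set_nth eqxx. Qed.

Lemma put_comm s i j u v : i != j -> put (put s i u) j v = put (put s j v) i u.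
Proof. by rewrite /put set_set_nth => /negbTE ->. Qed.

Lemma size_put s j u : j < size s -> size (put s j u) = size s.
Proof. by rewrite size_set_nth; lia. Qed.

Lemma put_get s j : j < size s -> put s j (get s j) = s.
Proof.
move=> js; apply: (@eq_from_nth _ [::]); first by rewrite size_put.
by move=> i _; have := get_put s i j (get s j); rewrite /get => ->; case: eqP => // ->.
Qed.

Lemma size_get_total s j : size (get s j) <= total s.
Proof.
elim: s j => [|v s IH] [|j] //=; rewrite ?leq_addr //.
by apply: leq_trans (IH j) _; rewrite /total /= leq_addl.
Qed.

Lemma total_put s j u :
  j < size s -> total (put s j u) + size (get s j) = total s + size u.
Proof.
elim: s j => [|v s IH] [|j] //= js; rewrite /total /=; first by rewrite /get /=; lia.
by have := IH j js; rewrite /total /get /=; lia.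
Qed.

End Stacks.
Arguments get : simpl never.
Arguments put : simpl never.

Inductive action (G X : Type) :=
  | APush (j : nat) (a : G) (x : X)
  | APop (j : nat) (f : option G -> X)
  | AGo (x : X)
  | AHalt.

Definition action_ok (G X : Type) (k : nat) (a : action G X) : bool :=
  match a with APush j _ _ => j < k | APop j _ => j < k | _ => true end.

Definition do_action (G X : Type) (x0 : X) (a : action G X) (s : stacks G) :=
  match a with
  | APush j b x => (x, put s j (b :: get s j))
  | APop j f =>
      if get s j is b :: u then (f (Some b), put s j u) else (f None, s)
  | AGo x => (x, s)
  | AHalt => (x0, s)
  end.

(** To act on a stack the head walks right along its track to the first empty cell ([PScan]), for a
    pop steps back and erases the top ([PTake]), and returns to the marked cell 0 ([PReturn]).
    [PInit] sets that mark at the start. The coding in ['I_4] makes the states a finite type. *)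
Inductive phase := PScan | PTake | PReturn | PInit.
Definition phase_ord (p : phase) : 'I_4 :=
  match p with
  | PScan => inord 0 | PTake => inord 1 | PReturn => inord 2 | PInit => inord 3
  end.
Definition ord_phase (i : 'I_4) : phase :=
  match val i with 0 => PScan | 1 => PTake | 2 => PReturn | _ => PInit end.
Arguments phase_ord : simpl never.
Arguments ord_phase : simpl never.
Lemma phase_ordK : cancel phase_ord ord_phase.
Proof. by case; rewrite /ord_phase /= inordK. Qed.

(** * Simulating stacks on the tracks of one tape *)

Section StackMachine.
Variables (G X : finType) (k : nat) (act : X -> action G X) (start : X) (acc : pred X).
Variables (inj : bool -> G) (outj : nat) (outb : G -> option bool).
Hypothesis act_ok : forall x, action_ok k (act x).

Definition tracks := {ffun 'I_k -> option G}.
Definition sym_t : finType := (bool * tracks)%type.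
Definition track (f : tracks) (j : nat) : option G := oapp f None (insub j).
Definition set_track (f : tracks) (j : nat) (o : option G) : tracks :=
  [ffun i : 'I_k => if val i == j then o else f i].

Definition sm_delta (q : X * 'I_4) (g : sym_t) : (X * 'I_4) * sym_t * dir :=
  let x := q.1 in
  match ord_phase q.2 with
  | PInit => ((start, phase_ord PScan), (true, g.2), DN)
  | PScan =>
      match act x with
      | APush j a y =>
          if track g.2 j is Some _ then (q, g, DR)
          else ((y, phase_ord PReturn), (g.1, set_track g.2 j (Some a)), DN)
      | APop j f =>
          if track g.2 j is Some _ then (q, g, DR)
          else if g.1 then ((f None, phase_ord PScan), g, DN)
          else ((x, phase_ord PTake), g, DL)
      | AGo y => ((y, phase_ord PScan), g, DN)
      | AHalt => (q, g, DN)
      end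
  | PTake =>
      match act x with
      | APop j f =>
          ((f (track g.2 j), phase_ord PReturn), (g.1, set_track g.2 j None), DN)
      | _ => (q, g, DN)
      end
  | PReturn => if g.1 then ((x, phase_ord PScan), g, DN) else (q, g, DL)
  end.

Definition is_halt (x : X) : bool := if act x is AHalt then true else false.

(* Stack j lives on track j of the tape, bottom at cell 0; cell 0 is marked. *)
Definition sm_tm : TM := {|
  tQ := (X * 'I_4)%type; tG := sym_t;
  tblank := (false, [ffun => None]);
  tin := fun b => (false, set_track [ffun => None] 0 (Some (inj b)));
  tout := fun g => obind outb (track g.2 outj);
  tstart := (start, phase_ord PInit);
  thalt := fun q => if ord_phase q.2 is PScan then is_halt q.1 else false;
  tacc := fun q => acc q.1;
  tdelta := sm_delta |}.

Notation run x := (x, phase_ord PScan).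

Definition cell (s : stacks G) (n : nat) : sym_t :=
  (n == 0, [ffun j : 'I_k => onth (rev (get s j)) n]).

Arguments cell : simpl never.

Lemma track_cell s n j : j < k -> track (cell s n).2 j = onth (rev (get s j)) n.
Proof. by move=> jk; rewrite /track insubT /= ffunE. Qed.

Lemma conf_at_keep q i c cf q' d :
  conf_at (M := sm_tm) q i c cf -> thalt sm_tm q = false ->
  tdelta sm_tm q (c i) = (q', c i, d) -> (d = DL -> 0 < i) ->
  conf_at q' (move_head d i) c (tm_step sm_tm cf).
Proof.
move=> h1 h2 h3 h4; apply: conf_at_ext (conf_at_step h1 h2 h3 h4) => n.
by rewrite /write; case: eqP => // ->.
Qed.

Definition scans (x : X) (j : nat) : Prop :=
  match act x with APush j' _ _ | APop j' _ => j' = j | _ => False end.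

Lemma scan_right x j s i m cf :
  scans x j -> j < k -> i + m <= size (get s j) ->
  conf_at (M := sm_tm) (run x) i (cell s) cf ->
  conf_at (M := sm_tm) (run x) (i + m) (cell s) (iter m (tm_step sm_tm) cf).
Proof.
move=> sc jk; elim: m => [|m IH] le h; first by rewrite addn0.
have {}IH := IH (ltnW (ltac:(lia) : i + m < size (get s j))) h.
rewrite addnS iterS; apply: (conf_at_keep (d := DR) IH) => //.
- rewrite /= phase_ordK; move: sc; rewrite /scans /is_halt; by case: (act x).
- rewrite /= /sm_delta phase_ordK /=; move: sc; rewrite /scans.
  have im : (onth (rev (get s j)) (i + m) : bool) by rewrite onthTE size_rev; lia.
  case: (act x) => // [j' a y|j' f] ->; rewrite (track_cell _ _ jk);
  by case: onth im.
Qed.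

Lemma return_left y s i cf :
  conf_at (M := sm_tm) (y, phase_ord PReturn) i (cell s) cf ->
  conf_at (M := sm_tm) (run y) 0 (cell s) (iter i.+1 (tm_step sm_tm) cf).
Proof.
elim: i cf => [|i IH] cf h.
  by apply: (conf_at_keep (d := DN) h) => //; rewrite /= /sm_delta /= ?phase_ordK.
rewrite iterSr; apply: IH.
by apply: (conf_at_keep (d := DL) h) => //; rewrite /= /sm_delta /= ?phase_ordK.
Qed.

Lemma write_cell s j o n u :
  j < k -> j < size s ->
  (forall i, onth (rev u) i = if i == n then o else onth (rev (get s j)) i) ->
  write (M := sm_tm) (cell s) n ((cell s n).1, set_track (cell s n).2 j o)
    =1 cell (put s j u).
Proof.
move=> jk js uE i; rewrite /write /cell; case: eqP => [->|ni] /=; congr pair;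
  apply/ffunP => l; rewrite !ffunE get_put.
  by case: eqP => // lj; rewrite uE eqxx.
by case: eqP => // ->; rewrite uE (introF eqP ni).
Qed.

Lemma sm_sim x s cf :
  size s = k -> is_halt x = false ->
  conf_at (M := sm_tm) (run x) 0 (cell s) cf ->
  exists2 n, n <= 2 * total s + 2 &
    conf_at (M := sm_tm) (run (do_action x (act x) s).1) 0
      (cell (do_action x (act x) s).2) (iter n (tm_step sm_tm) cf).
Proof.
move=> sk hx h; have := act_ok x; move: hx; rewrite /is_halt.
case E: (act x) => [j a y|j f|y|] //= _ jk.
- have le := size_get_total s j.
  exists ((size (get s j)).+1 + (size (get s j)).+1); first by lia.
  rewrite iterD; apply: return_left; rewrite iterS.
  have sc : scans x j by rewrite /scans E.
  have {}h := @scan_right x j s 0 (size (get s j)) cf sc jk (leqnn _) h.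
  apply: conf_at_ext (conf_at_step (d := DN) h _ _ _); last first.
  + by [].
  + rewrite /= /sm_delta phase_ordK /= E track_cell // onth_default //.
    by rewrite size_rev.
  + by rewrite /= phase_ordK /is_halt E.
  + rewrite add0n; apply: write_cell; rewrite ?sk // => i.
    rewrite rev_cons -cats1 onth_cat size_rev.
    case: eqP => [->|ni]; first by rewrite ltnn subnn.
    case: ltnP => // li; rewrite [RHS]onth_default ?size_rev //.
    by case E1: (i - _) => [|m]; [exfalso; lia | rewrite /= onth0n].
- case Eg: (get s j) => [|a u] /=.
    exists 1; first by lia.
    apply: (conf_at_keep (d := DN) h) => //.
      by rewrite /= phase_ordK /is_halt E.
    have := track_cell s 0 jk; rewrite Eg /= /sm_delta phase_ordK /= E => -> //.
  have le := size_get_total s j.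
  have sc : scans x j by rewrite /scans E.
  have {}h := @scan_right x j s 0 (size (get s j)) cf sc jk (leqnn _) h.
  exists ((size u).+1 + (size (get s j)).+2); first by rewrite Eg /= in le *; lia.
  rewrite iterD; apply: return_left; rewrite 2!iterS.
  have {}h : conf_at (M := sm_tm) (x, phase_ord PTake) (size u) (cell s)
    (tm_step sm_tm (iter (size (get s j)) (tm_step sm_tm) cf)).
    rewrite -[size u]/(move_head DL (size u).+1) -[(size u).+1]/(0 + size (a :: u)) -Eg.
    apply: (conf_at_keep (d := DL) h) => //; last by rewrite Eg.
      by rewrite /= phase_ordK /is_halt E.
    rewrite /= /sm_delta phase_ordK /= E track_cell // onth_default ?size_rev //.
    by rewrite Eg.
  have oa : onth (rev (get s j)) (size u) = Some a.
    by rewrite Eg rev_cons -cats1 onth_cat size_rev ltnn subnn.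
  apply: conf_at_ext (conf_at_step (d := DN) h _ _ _); last first.
  + by [].
  + by rewrite /= /sm_delta phase_ordK /= E track_cell // oa.
  + by rewrite /= phase_ordK.
  + apply: write_cell; rewrite ?sk // => i; rewrite Eg rev_cons -cats1 onth_cat size_rev.
    case: eqP => [->|ni]; first by rewrite onth_default ?size_rev.
    case: ltnP => // li; rewrite onth_default ?size_rev //.
    by case E1: (i - _) => [|m]; [exfalso; lia | rewrite /= onth0n].
- exists 1; first by lia.
  apply: (conf_at_keep (d := DN) h) => //.
    by rewrite /= phase_ordK /is_halt E.
  by rewrite /= /sm_delta phase_ordK /= E.
Qed.

Definition sm_step (xs : X * stacks G) := do_action xs.1 (act xs.1) xs.2.

Lemma sm_step_size xs :
  size xs.2 = k -> size (sm_step xs).2 = k /\ total (sm_step xs).2 <= (total xs.2).+1.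
Proof.
case: xs => x s /= sk; rewrite /sm_step /=; have := act_ok x.
case: (act x) => [j a y|j f|y|] //= jk; rewrite ?size_put ?sk //; split=> //.
- by have := @total_put _ s j (a :: get s j); rewrite sk => /(_ jk) /=; lia.
- by case: (get s j) => [|a u] //=; rewrite size_put ?sk.
- case Eg: (get s j) => [|a u] //=.
  by have := @total_put _ s j u; rewrite sk => /(_ jk); rewrite Eg /=; lia.
Qed.

(** A step costs a walk to the top of a stack and back, and the stacks grow by at most one symbol
    per step; hence [total s + t] bounds every walk. *)
Lemma sm_simn t x s cf xs :
  size s = k -> iter t sm_step (x, s) = xs ->
  conf_at (M := sm_tm) (run x) 0 (cell s) cf ->
  exists2 n, n <= t * (2 * (total s + t) + 2) &
    conf_at (M := sm_tm) (run xs.1) 0 (cell xs.2) (iter n (tm_step sm_tm) cf).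
Proof.
elim: t x s cf => [|t IH] x s cf sk; first by move=> <- /= h; exists 0.
rewrite iterSr; case hx: (is_halt x).
  have -> : sm_step (x, s) = (x, s).
    by rewrite /sm_step /=; move: hx; rewrite /is_halt; case: (act x).
  move=> e h; have [n le hn] := IH _ _ _ sk e h; exists n => //.
  by apply: leq_trans le _; apply: leq_mul; lia.
have [sk' tot] := @sm_step_size (x, s) sk.
case Es: (sm_step (x, s)) sk' tot => [x' s'] /= sk' tot e h.
have [n1 le1 h1] := sm_sim sk hx h.
have e1 : do_action x (act x) s = (x', s') by [].
rewrite e1 /= in h1; have [n2 le2 h2] := IH _ _ _ sk' e h1.
exists (n2 + n1); last by rewrite iterD.
have : t * (2 * (total s' + t) + 2) <= t * (2 * (total s + t.+1) + 2).
  by apply: leq_mul; lia.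
by rewrite mulSn; lia.
Qed.

(** Cell 0 holds the bottom of a stack, whereas the list starts with its top; an input read from
    left to right is therefore reversed. *)
Definition sm_input (x : seq bool) : stacks G :=
  put (nseq k [::]) 0 (rev (map inj x)).

Hypothesis k_gt0 : 0 < k.

Lemma size_sm_input x : size (sm_input x) = k.
Proof. by rewrite size_put size_nseq. Qed.

Lemma total_sm_input x : total (sm_input x) = size x.
Proof.
have := @total_put _ (nseq k [::]) 0 (rev (map inj x)).
rewrite size_nseq => /(_ k_gt0); rewrite /sm_input /get nth_nseq k_gt0 /= addn0 => ->.
rewrite size_rev size_map /total map_nseq.
by elim: k => //= n IH; rewrite add0n.
Qed.

Lemma input_cell x n :
  nth (tblank sm_tm) (map (tin sm_tm) x) n = (false, (cell (sm_input x) n).2).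
Proof.
case: (ltnP n (size x)) => nx.
  rewrite (nth_map false) //; apply: (congr1 (pair false)).
  apply/ffunP => j; rewrite !ffunE get_put.
  case: eqP => j0; last by rewrite /get nth_nseq if_same onth0n.
  rewrite revK onth_map; have := onthTE x n; rewrite nx.
  by case E: onth => [b|] // _; rewrite -odflt_onth E.
rewrite nth_default ?size_map //; apply: (congr1 (pair false)).
apply/ffunP => j; rewrite !ffunE get_put.
case: eqP => j0; last by rewrite /get nth_nseq if_same onth0n.
by rewrite revK onth_default // size_map.
Qed.

Lemma sm_start x :
  conf_at (M := sm_tm) (run start) 0 (cell (sm_input x)) (tm_run sm_tm 1 x).
Proof.
have h := conf_at_init sm_tm x 0.
rewrite -[0]/(move_head DN 0).
apply: conf_at_ext (conf_at_step (d := DN) h _ _ _); last first.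
- by [].
- by rewrite /= /sm_delta phase_ordK.
- by rewrite /= phase_ordK.
move=> n; rewrite /write !ltn0 !subn0 !input_cell.
by case: n => [|n].
Qed.

Lemma readout_conf q s c cf bs :
  conf_at (M := sm_tm) q 0 c cf -> c =1 cell s -> outj < k ->
  get s outj = rev (map inj bs) -> (forall b, outb (inj b) = Some b) ->
  tm_output sm_tm cf = bs.
Proof.
case: cf => [[[q' l] h] r] [_ sl cE] cc ok gs ob.
have {sl} l0 : l = [::] by case: l sl {cE}.
rewrite l0 /= in cE.
rewrite /tm_output /=; change (readout sm_tm (h :: r) = bs).
have {cE} rE n : obind outb (track (nth (tblank sm_tm) (h :: r) n).2 outj) = onth bs n.
  rewrite -cE cc track_cell // gs revK onth_map.
  by case: (onth bs n) => //= b; rewrite ob.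
move: (h :: r) rE => t {gs}; elim: t bs => [|g t IH] bs tE.
  by have := tE 0; rewrite /= /track; case: bs {tE} => //= b bs; rewrite insubT /= ffunE.
have /= := tE 0; case: bs tE => [|b bs] tE ->//=.
by rewrite (IH bs) // => n; apply: (tE n.+1).
Qed.

End StackMachine.

(** * Loop programs *)

Lemma leq_wexpn m n e : m <= n -> m ^ e <= n ^ e.
Proof. by case: e => // e mn; rewrite leq_exp2r. Qed.

(** This form of bound is plainly closed under products; sums reduce to products by
    [f + g <= f.+1 * g.+1]. *)
Definition poly_bounded (f : nat -> nat) : Prop :=
  exists a b, forall n, f n <= (n + a) ^ b.

Lemma poly_bounded_le f g :
  (forall n, f n <= g n) -> poly_bounded g -> poly_bounded f.
Proof. by move=> fg [a [b h]]; exists a, b => n; apply: leq_trans (fg n) _. Qed.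

Lemma poly_bounded_const c : poly_bounded (fun _ => c).
Proof. by exists c, 1 => n; rewrite expn1 leq_addl. Qed.

Lemma poly_bounded_id : poly_bounded id.
Proof. by exists 0, 1 => n; rewrite expn1 addn0. Qed.

Lemma poly_bounded_mul f g :
  poly_bounded f -> poly_bounded g -> poly_bounded (fun n => f n * g n).
Proof.
move=> [a [b hf]] [a' [b' hg]]; exists (a + a'), (b + b') => n.
rewrite expnD; apply: leq_mul.
  by apply: leq_trans (hf n) _; apply: leq_wexpn; lia.
by apply: leq_trans (hg n) _; apply: leq_wexpn; lia.
Qed.

Lemma poly_bounded_add f g :
  poly_bounded f -> poly_bounded g -> poly_bounded (fun n => f n + g n).
Proof.
move=> bf bg; have b1 h : poly_bounded h -> poly_bounded (fun n => (h n).+1).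
  move=> [a [b hh]]; exists a.+2, b.+1 => n.
  have h1 : (n + a) ^ b <= (n + a.+2) ^ b by apply: leq_wexpn; lia.
  have h2 : 0 < (n + a.+2) ^ b by rewrite expn_gt0; lia.
  by have := hh n; rewrite expnS; nia.
by apply: poly_bounded_le (poly_bounded_mul (b1 _ bf) (b1 _ bg)) => n; nia.
Qed.

Lemma poly_bounded_expn f k :
  poly_bounded f -> poly_bounded (fun n => f n ^ k).
Proof.
move=> bf; elim: k => [|k IH]; first exact: poly_bounded_const.
by apply: poly_bounded_le (poly_bounded_mul bf IH) => n; rewrite expnS.
Qed.

Lemma poly_bounded_poly c k f :
  poly_bounded f -> poly_bounded (fun n => poly c k (f n)).
Proof.
move=> bf; apply: poly_bounded_add _ (poly_bounded_const c).
exact: poly_bounded_mul (poly_bounded_const c) (poly_bounded_expn k bf).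
Qed.

Lemma poly_bounded_S f : poly_bounded f -> poly_bounded (fun n => (f n).+1).
Proof.
move=> bf; apply: poly_bounded_le (poly_bounded_add bf (poly_bounded_const 1)) => n.
by rewrite addn1.
Qed.

Lemma poly_bounded_double f : poly_bounded f -> poly_bounded (fun n => (f n).*2).
Proof.
move=> bf; apply: poly_bounded_le (poly_bounded_add bf bf) => n; by rewrite addnn.
Qed.

Ltac pbound := cbv beta; lazymatch goal with
  | |- poly_bounded (fun _ => ?c) => exact (poly_bounded_const c)
  | |- poly_bounded (fun n => @?f n + @?g n) => refine (@poly_bounded_add f g _ _); pbound
  | |- poly_bounded (fun n => @?f n * @?g n) => refine (@poly_bounded_mul f g _ _); pbound
  | |- poly_bounded (fun n => (@?f n).+1) => refine (@poly_bounded_S f _); pbound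
  | |- poly_bounded (fun n => (@?f n).*2) => refine (@poly_bounded_double f _); pbound
  | |- poly_bounded (fun n => (@?f n) ^ ?k) => refine (@poly_bounded_expn f k _); pbound
  | |- poly_bounded (fun n => poly ?c ?k (@?f n)) => refine (@poly_bounded_poly c k f _); pbound
  | |- poly_bounded (fun n => n) => exact poly_bounded_id
  | |- _ => try assumption
  end.

(** For positive [n], [n + a <= a.+1 * n]; the additive constant of [poly] covers [n = 0]. *)
Lemma poly_boundedP f :
  poly_bounded f -> exists c k, forall n, f n <= poly c k n.
Proof.
move=> [a [b h]]; exists (a.+1 ^ b), b => n; apply: leq_trans (h n) _.
rewrite /poly -expnMn; case: n => [|n].
  by rewrite add0n; apply: leq_trans (leq_addl _ _); apply: leq_wexpn; lia.
apply: leq_trans (leq_addr _ _).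
by apply: leq_wexpn; nia.
Qed.

(** [For] empties a stack before its body runs, so every loop is bounded by data already present:
    evaluation is total, and cost is computed by the same recursion. *)
Inductive prog (G : Type) :=
  | Skip
  | Push (j : nat) (a : G)
  | Seq (p q : prog G)
  | Case (j : nat) (f : option G -> prog G)
  | For (j : nat) (f : G -> prog G).

Section Prog.
Variable G : finType.
Implicit Types (p q : prog G) (s : stacks G).

Fixpoint eval p s : stacks G :=
  match p with
  | Skip => s
  | Push j a => put s j (a :: get s j)
  | Seq p q => eval q (eval p s)
  | Case j f =>
      if get s j is a :: u then eval (f (Some a)) (put s j u)
      else eval (f None) s
  | For j f => foldl (fun s' a => eval (f a) s') (put s j [::]) (get s j)
  end.

Fixpoint cost p s : nat :=
  match p with
  | Skip => 1
  | Push j a => 1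
  | Seq p q => cost p s + cost q (eval p s)
  | Case j f =>
      if get s j is a :: u then (cost (f (Some a)) (put s j u)).+1
      else (cost (f None) s).+1
  | For j f =>
      (foldl (fun cs a => (cs.1 + (cost (f a) cs.2).+1, eval (f a) cs.2))
         (1, put s j [::]) (get s j)).1
  end.

Definition loop_step (f : G -> prog G) (cs : nat * stacks G) a :=
  (cs.1 + (cost (f a) cs.2).+1, eval (f a) cs.2).

Lemma loop_cost f n m s v :
  (foldl (loop_step f) (n + m, s) v).1 = n + (foldl (loop_step f) (m, s) v).1.
Proof. by elim: v n m s => [|a v IH] n m s //=; rewrite {2}/loop_step /= -addnA IH. Qed.

(* [eval] hides the unread part of the stack a loop runs on, so the body must
   not refer to that stack. *)
Fixpoint avoids j p : Prop :=
  match p with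
  | Skip => True
  | Push i a => i != j
  | Seq p q => avoids j p /\ avoids j q
  | Case i f => i != j /\ forall o, avoids j (f o)
  | For i f => i != j /\ forall a, avoids j (f a)
  end.

Fixpoint wf k p : Prop :=
  match p with
  | Skip => True
  | Push i a => i < k
  | Seq p q => wf k p /\ wf k q
  | Case i f => i < k /\ forall o, wf k (f o)
  | For i f => [/\ i < k, forall a, wf k (f a) & forall a, avoids i (f a)]
  end.

Lemma eval_avoids j p s u :
  avoids j p -> eval p (put s j u) = put (eval p s) j u.
Proof.
elim: p s => [|i a|p IHp q IHq|i f IH|i f IH] s //=.
- by move=> ij; rewrite get_put (negbTE ij) put_comm // eq_sym.
- by case=> hp hq; rewrite IHp // IHq.
- case=> ij hf; rewrite get_put (negbTE ij); case: (get s i) => [|a v].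
    by rewrite IH.
  by rewrite put_comm 1?eq_sym // IH.
- case=> ij hf; rewrite get_put (negbTE ij) put_comm 1?eq_sym //.
  elim: (get s i) (put s i [::]) => //= a v IHv s'; by rewrite IH.
Qed.

Lemma cost_avoids j p s u :
  avoids j p -> cost p (put s j u) = cost p s.
Proof.
elim: p s => [|i a|p IHp q IHq|i f IH|i f IH] s //=.
- by case=> hp hq; rewrite IHp // eval_avoids // IHq.
- case=> ij hf; rewrite get_put (negbTE ij); case: (get s i) => [|a v].
    by rewrite IH.
  by rewrite put_comm 1?eq_sym // IH.
- case=> ij hf; rewrite get_put (negbTE ij) put_comm 1?eq_sym //.
  elim: (get s i) 1 (put s i [::]) => //= a v IHv n s'.
  by rewrite IH // eval_avoids.
Qed.

Lemma get_eval_avoids j p s : avoids j p -> get (eval p s) j = get s j.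
Proof.
elim: p s => [|i a|p IHp q IHq|i f IH|i f IH] s //=.
- by move=> ij; rewrite get_put eq_sym (negbTE ij).
- by case=> hp hq; rewrite IHq // IHp.
- case=> ij hf; case: (get s i) => [|a v]; rewrite IH // get_put.
  by rewrite eq_sym (negbTE ij).
- case=> ij hf; have -> : get s j = get (put s i [::]) j.
    by rewrite get_put eq_sym (negbTE ij).
  by elim: (get s i) (put s i [::]) => //= a v IHv s'; rewrite IHv IH.
Qed.

Lemma size_eval k p s : wf k p -> size s = k -> size (eval p s) = k.
Proof.
elim: p s => [|i a|p IHp q IHq|i f IH|i f IH] s //=.
- by move=> ik sk; rewrite size_put // sk.
- by case=> hp hq sk; rewrite IHq // IHp.
- case=> ik hf sk; case: (get s i) => [|a v]; apply: IH => //.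
  by rewrite size_put // sk.
- case=> ik hf _ sk; have : size (put s i [::]) = k by rewrite size_put sk.
  by elim: (get s i) (put s i [::]) => //= a v IHv s' sk'; apply/IHv/IH.
Qed.

(** The target [None] is the exit of a fragment; [relink] directs it to the continuation. *)
Record fragment := Fragment {
  fr_state : finType;
  fr_start : fr_state;
  fr_act : fr_state -> action G (option fr_state) }.

Definition map_action X Y (h : X -> Y) (a : action G X) : action G Y :=
  match a with
  | APush j b x => APush j b (h x)
  | APop j f => APop j (fun o => h (f o))
  | AGo x => AGo G (h x)
  | AHalt => AHalt G Y
  end.

Definition relink X Y (h : X -> Y) (k : option Y) (o : option X) : option Y :=
  if o is Some x then Some (h x) else k.

Definition fragment_one (a : action G (option unit)) : fragment :=
  Fragment tt (fun _ => a).

(** The code that follows a pop depends on the popped symbol, so the states of [Case] and [For] are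
    a dependent sum over symbols, with [None] as the popping state. In a loop the exits of the body
    lead back to that state. *)
Fixpoint compile p : fragment :=
  match p with
  | Skip => fragment_one (AGo G None)
  | Push j a => fragment_one (APush j a None)
  | Seq p q =>
      let P := compile p in let Q := compile q in
      @Fragment (fr_state P + fr_state Q)%type (inl (fr_start P))
        (fun x => match x with
         | inl y => map_action (relink inl (Some (inr (fr_start Q)))) (fr_act y)
         | inr y => map_action (relink inr None) (fr_act y)
         end)
  | Case j f =>
      let F o := compile (f o) in
      @Fragment (option {o : option G & fr_state (F o)}) None
        (fun x => match x with
         | None => APop j (fun o => 
             Some (Some (Tagged (fun o => fr_state (F o)) (fr_start (F o)))))
         | Some y =>
             map_action
               (relink (fun z => Some (Tagged (fun o => fr_state (F o)) z)) None)
               (fr_act (tagged y))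
         end)
  | For j f =>
      let F a := compile (f a) in
      @Fragment (option {a : G & fr_state (F a)}) None
        (fun x => match x with
         | None => APop j (fun o =>
             if o is Some a then
               Some (Some (Tagged (fun a => fr_state (F a)) (fr_start (F a))))
             else None)
         | Some y =>
             map_action
               (relink (fun z => Some (Tagged (fun o => fr_state (F o)) z))
                  (Some None))
               (fr_act (tagged y))
         end)
  end.

Inductive run_path (X : Type) (act : X -> action G (option X)) :
    nat -> option X -> stacks G -> option X -> stacks G -> Prop :=
  | RunNil o s : run_path act 0 o s o s
  | RunCons n x s o' s' :
      run_path act n (do_action (Some x) (act x) s).1
        (do_action (Some x) (act x) s).2 o' s' ->
      run_path act n.+1 (Some x) s o' s'.

Lemma run_path_cat X (act : X -> action G (option X)) n m o1 s1 o2 s2 o3 s3 :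
  run_path act n o1 s1 o2 s2 -> run_path act m o2 s2 o3 s3 ->
  run_path act (n + m) o1 s1 o3 s3.
Proof. by elim=> // {}n x s o' s' _ IH h; apply: RunCons; apply: IH. Qed.

Definition no_halt X (a : action G X) : bool :=
  if a is AHalt then false else true.

Lemma run_path_lift X Y (act : X -> action G (option X))
    (act' : Y -> action G (option Y)) (h : X -> Y) k n o s o' s' :
  (forall x, act' (h x) = map_action (relink h k) (act x)) ->
  (forall x, no_halt (act x)) ->
  run_path act n o s o' s' ->
  run_path act' n (relink h k o) s (relink h k o') s'.
Proof.
move=> hE nh; elim=> {n o s o' s'} [o s|n x s o' s' _ IH]; first exact: RunNil.
apply: RunCons; rewrite hE; have := nh x.
by case: (act x) IH => //= j f; case: (get s j).
Qed.

Lemma compile_no_halt p (x : fr_state (compile p)) : no_halt (fr_act x).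
Proof.
have mapP X Y (h : X -> Y) a : no_halt a -> no_halt (map_action h a) by case: a.
elim: p x => [|j a|p IHp q IHq|j f IH|j f IH] //=.
- by case=> y; apply: mapP.
- by case=> [y|] //; apply: mapP; apply: IH.
- by case=> [y|] //; apply: mapP; apply: IH.
Qed.

Lemma compile_ok k p (x : fr_state (compile p)) :
  wf k p -> action_ok k (fr_act x).
Proof.
have mapP X Y (h : X -> Y) a : action_ok k a -> action_ok k (map_action h a).
  by case: a.
elim: p x => [|j a|p IHp q IHq|j f IH|j f IH] //=.
- by case=> y [hp hq]; apply: mapP; [apply: IHp|apply: IHq].
- by case=> [y|] [jk hf] //; apply: mapP; apply: IH.
- by case=> [y|] [jk hf _] //; apply: mapP; apply: IH.
Qed.

Lemma run_path_compile k p s :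
  wf k p -> size s = k ->
  run_path (fr_act (f := compile p)) (cost p s) (Some (fr_start (compile p))) s
    None (eval p s).
Proof.
elim: p s => [|j a|p IHp q IHq|j f IH|j f IH] s /=.
- by move=> _ _; apply/RunCons/RunNil.
- by move=> _ _; apply/RunCons/RunNil.
- case=> hp hq sk.
  have h1 := IHp s hp sk; have h2 := IHq _ hq (size_eval hp sk).
  apply: run_path_cat (run_path_lift _ _ h1) _ => //=.
  + by move=> x; apply: compile_no_halt.
  + apply: (run_path_lift (h := inr) (k := None) _ _ h2) => //= x.
    exact: compile_no_halt.
- case=> jk hf sk; case E: (get s j) => [|a u]; apply: RunCons; rewrite /= E /=.
    have h := IH None s (hf _) sk.
    apply: (run_path_lift (k := None)
      (h := fun z => Some (Tagged (fun o => fr_state (compile (f o))) z)) _ _ h) => // x.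
    exact: compile_no_halt.
  have h := IH (Some a) (put s j u) (hf _) _.
  rewrite size_put sk // in h; have {}h := h erefl.
  apply: (run_path_lift (k := None)
    (h := fun z => Some (Tagged (fun o => fr_state (compile (f o))) z)) _ _ h) => // x.
  exact: compile_no_halt.
- case=> jk hf av sk.
  (* During the loop the machine keeps the unread symbols [u] on stack [j], while [eval] works with
     that stack empty; the two agree because the body avoids [j]. *)
  suff H u s0 : get s0 j = [::] -> size s0 = k ->
      run_path (fr_act (f := compile (For j f))) (foldl (loop_step f) (1, s0) u).1
        (Some None) (put s0 j u) None (foldl (fun s' a => eval (f a) s') s0 u).
    have := H (get s j) (put s j [::]); rewrite get_put eqxx put_put put_get ?sk //.
    by rewrite size_put ?sk //; apply.
  elim: u s0 => [|a u IHu] s0 g0 sk0.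
    apply: RunCons; rewrite /= get_put eqxx /=.
    by rewrite -g0 put_get ?sk0 //; apply: RunNil.
  rewrite /= {2}/loop_step /= [1 + _]addnC loop_cost addSn; apply: RunCons.
  rewrite /= get_put eqxx /= put_put.
  have h := IH a (put s0 j u) (hf _) _; rewrite size_put sk0 // in h.
  have {}h := h erefl; rewrite cost_avoids // eval_avoids // in h.
  apply: (run_path_cat (o2 := Some None)).
    apply: (run_path_lift (k := Some None)
      (h := fun z => Some (Tagged (fun o => fr_state (compile (f o))) z)) _ _ h) => // x.
    exact: compile_no_halt.
  by apply: IHu; [rewrite get_eval_avoids | apply: size_eval].
Qed.

End Prog.

(** * Loop programs as deciders and transducers *)

Section ProgTM.
Variables (G : finType) (inj : bool -> G) (outb : G -> option bool).
Variables (p : prog G) (k : nat) (outj : nat) (yes : G).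

Let F := compile p.
Let X : finType := (option (fr_state F) + option G)%type.

(** After the program the machine pops stack [outj] into its state and halts. For a decider this
    symbol is the verdict; a transducer pushes a dummy symbol on its output, hence [behead] in
    [prog_polytime]. *)
Definition prog_act (x : X) : action G X :=
  match x with
  | inl (Some y) => map_action inl (fr_act y)
  | inl None => APop outj inr
  | inr _ => AHalt G X
  end.

Definition prog_tm : TM :=
  sm_tm k prog_act (inl (Some (fr_start F)))
    (fun x => x == inr (Some yes)) inj outj outb.

Definition prog_input (x : seq bool) : stacks G := sm_input k inj x.

Hypothesis p_wf : wf k p.
Hypothesis outk : outj < k.

Lemma prog_act_ok x : action_ok k (prog_act x).
Proof.
case: x => [[y|]|o] //=; have := compile_ok y p_wf.
by case: (fr_act y).
Qed.

Lemma prog_run s :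
  size s = k ->
  iter (cost p s) (sm_step prog_act) (inl (Some (fr_start F)), s) =
    (inl None, eval p s).
Proof.
move=> sk; have := run_path_compile p_wf sk.
move: (cost p s) (Some (fr_start F)) {sk} => n o.
suff H o' s' : run_path (fr_act (f := F)) n o s o' s' ->
    iter n (sm_step prog_act) (inl o, s) = (inl o', s') by move/H.
elim=> // m x s1 o1 s2 _ <-; rewrite iterSr; congr iter.
rewrite /sm_step /=; have := compile_no_halt x.
by case: (fr_act x) => //= j f _; case: (get s1 j).
Qed.

Lemma k_pos : 0 < k. Proof. exact: leq_ltn_trans outk. Qed.

Definition prog_time (x : seq bool) : nat :=
  let t := (cost p (prog_input x)).+1 in t * (2 * (size x + t) + 2) + 1.

Lemma prog_tm_run x :
  let s := eval p (prog_input x) in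
  exists2 n, n <= prog_time x &
  conf_at (M := prog_tm) (inr (ohead (get s outj)), phase_ord PScan) 0
    (cell k (put s outj (behead (get s outj)))) (tm_run prog_tm n x).
Proof.
move=> s; have sk := @size_sm_input G k inj k_pos x.
have h0 : conf_at (M := prog_tm) (inl (Some (fr_start F)), phase_ord PScan) 0
    (cell k (prog_input x)) (tm_run prog_tm 1 x) by apply: sm_start; apply: k_pos.
have rE := prog_run sk.
have sks : size s = k by apply: size_eval sk.
have r1 : iter (cost p (prog_input x)).+1 (sm_step prog_act)
   (inl (Some (fr_start F)), prog_input x) =
   (inr (ohead (get s outj)), put s outj (behead (get s outj))).
  rewrite iterS rE /sm_step /= -/s; case E: (get s outj) => [|a u] //=.
  by rewrite -E put_get ?sks.
have [n le h] := sm_simn prog_act_ok sk r1 h0.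
exists (n + 1); last by rewrite /tm_run iterD.
by rewrite /prog_time leq_add2r -(total_sm_input inj k_pos).
Qed.

Lemma prog_time_poly (B : nat -> nat) :
  (forall x, cost p (prog_input x) <= B (size x)) -> poly_bounded B ->
  exists c d, forall x, prog_time x <= poly c d (size x).
Proof.
move=> hB pB.
have [|c [d h]] := @poly_boundedP (fun n => (B n).+1 * (2 * (n + (B n).+1) + 2) + 1).
  have pS : poly_bounded (fun n => (B n).+1).
    apply: poly_bounded_le (poly_bounded_add pB (poly_bounded_const 1)) => n.
    by rewrite addn1.
  apply: poly_bounded_add _ (poly_bounded_const 1).
  apply: (poly_bounded_mul pS); apply: poly_bounded_add _ (poly_bounded_const 2).
  apply: (poly_bounded_mul (poly_bounded_const 2)).
  exact: poly_bounded_add poly_bounded_id pS.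
exists c, d => x; apply: leq_trans (h (size x)); rewrite /prog_time leq_add2r.
by have := hB x; move=> le; apply: leq_mul; lia.
Qed.

Theorem prog_in_P (B : nat -> nat) :
  (forall x, cost p (prog_input x) <= B (size x)) -> poly_bounded B ->
  in_P (fun x => ohead (get (eval p (prog_input x)) outj) = Some yes).
Proof.
move=> hB pB; have [c [d h]] := prog_time_poly hB pB.
exists prog_tm, c, d => x /=.
have [n le hn] := prog_tm_run x.
have hs := conf_at_state hn.
have hh : thalt prog_tm (tm_state prog_tm (tm_run prog_tm n x)).
  by rewrite hs /= phase_ordK.
rewrite (tm_run_mono (leq_trans le (h x)) hh); split=> //.
rewrite hs /=; split; first by move/eqP=> [->].
by move=> ->.
Qed.

Theorem prog_polytime (B : nat -> nat) (f : seq bool -> seq bool) :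
  (forall x, cost p (prog_input x) <= B (size x)) -> poly_bounded B ->
  (forall b, outb (inj b) = Some b) -> 
  (forall x, behead (get (eval p (prog_input x)) outj) = rev (map inj (f x))) ->
  polytime_computable f.
Proof.
move=> hB pB ob fE; have [c [d h]] := prog_time_poly hB pB.
exists prog_tm, c, d => x /=.
have [n le hn] := prog_tm_run x.
have hs := conf_at_state hn.
have hh : thalt prog_tm (tm_state prog_tm (tm_run prog_tm n x)).
  by rewrite hs /= phase_ordK.
rewrite (tm_run_mono (leq_trans le (h x)) hh); split=> //.
apply: (readout_conf hn) => //; rewrite get_put eqxx; exact: fE.
Qed.

End ProgTM.

(** * Binary encodings *)

Definition bin (n : nat) : seq bool := binrev n n.
Definition dbl (s : seq bool) : seq bool := flatten [seq [:: b; b] | b <- s].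
Definition bval (s : seq bool) : nat := foldr (fun (b : bool) n => b + n.*2) 0 s.

Lemma dbl_cat s t : dbl (s ++ t) = dbl s ++ dbl t.
Proof. by rewrite /dbl map_cat flatten_cat. Qed.

Lemma size_dbl s : size (dbl s) = (size s).*2.
Proof. by elim: s => //= b s IH; rewrite /dbl /= IH doubleS. Qed.

Lemma enc_natE n : enc_nat n = dbl (bin n) ++ [:: false; true].
Proof. by []. Qed.

Lemma binrev_fuel f n : n <= f -> binrev f n = bin n.
Proof.
suff H g h m : m <= g -> m <= h -> binrev g m = binrev h m by move=> le; apply: H.
elim: g h m => [|g IH] [|h] [|m] //= mg mh; congr cons; apply: IH; lia.
Qed.

Lemma binE n : bin n = if n is 0 then [::] else odd n :: bin n./2.
Proof. by case: n => // n; rewrite {1}/bin /= binrev_fuel //; lia. Qed.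

Lemma bin_pos n : 0 < n -> bin n = odd n :: bin n./2.
Proof. by case: n => // n _; rewrite binE. Qed.

Lemma bin_ind (P : nat -> Prop) :
  P 0 -> (forall n, 0 < n -> P n./2 -> P n) -> forall n, P n.
Proof.
move=> P0 PS n; elim: n {-2}n (leqnn n) => [|m IH] [|n] //= le.
by apply: PS => //; apply: IH; lia.
Qed.

Lemma bvalK n : bval (bin n) = n.
Proof.
elim/bin_ind: n => // n n0 IH.
by rewrite bin_pos //= IH odd_double_half.
Qed.

Lemma bin_inj : injective bin.
Proof. exact: can_inj bvalK. Qed.

Lemma size_bin n : size (bin n) <= n.
Proof. by elim/bin_ind: n => // n n0 IH; rewrite bin_pos //=; lia. Qed.

Lemma bin_bval s : last true s -> bin (bval s) = s.
Proof.
elim: s => // b s IH /= h.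
have ls : last true s by case: s h {IH} => //.
have IHs := IH ls.
have pos : 0 < b + (bval s).*2.
  case: (posnP (bval s)) => [e0|p0]; last by rewrite addn_gt0 double_gt0 p0 orbT.
  have s0 : s = [::] by rewrite -IHs e0.
  by rewrite s0 /= in h; rewrite h.
rewrite bin_pos //; have -> : (b + (bval s).*2)./2 = bval s by rewrite half_bit_double.
by rewrite IH // oddD odd_double addbF oddb.
Qed.

Lemma last_bin n : last true (bin n).
Proof.
elim/bin_ind: n => // n n0 IH; rewrite bin_pos //=.
case: n n0 IH => [|[|n]] // _; rewrite (bin_pos (n := n.+2./2)) //=.
Qed.

Fixpoint binc (s : seq bool) : seq bool :=
  match s with
  | [::] => [:: true]
  | false :: s' => true :: s'
  | true :: s' => false :: binc s'
  end.

Lemma binc_bin n : binc (bin n) = bin n.+1.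
Proof.
elim/bin_ind: n => // n n0 IH; rewrite bin_pos // [RHS]bin_pos //=.
case on: (odd n) => /=.
  by rewrite IH; congr (_ :: bin _); lia.
by congr (_ :: bin _); lia.
Qed.

Fixpoint bits (b o : nat) : seq bool :=
  if b is b'.+1 then odd o :: bits b' o./2 else [::].

(** Numerals list the low digit first, so the address of node [o] in block [i] of length [2 ^ b] is
    a fixed word followed by the numeral of [i]. For [i = 0] the high zeros of [o] would have to be
    dropped. *)
Lemma bin_bits b i o : 0 < i -> o < 2 ^ b -> bin (i * 2 ^ b + o) = bits b o ++ bin i.
Proof.
move=> i0; elim: b o => [|b IH] o; first by rewrite expn0 muln1; case: o => //; rewrite addn0.
rewrite expnS => lo.
have pos : 0 < i * (2 * 2 ^ b) + o by have := expn_gt0 2 b; nia.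
rewrite bin_pos //= -IH; last by lia.
congr (_ :: bin _); last by lia.
by rewrite oddD !oddM /= andbF.
Qed.

(** The address of the last node of a block. Here [i = 0] is allowed, since the top digit of the
    offset is a one. *)
Lemma bin_ones b i : bin (i * 2 ^ b + (2 ^ b).-1) = nseq b true ++ bin i.
Proof.
elim: b => [|b IH]; first by rewrite expn0 muln1 addn0.
have p : 0 < 2 ^ b by rewrite expn_gt0.
rewrite expnS mulnCA; rewrite /= -IH; move: p; set x := 2 ^ b; set y := i * x => p.
by rewrite bin_pos; [congr (_ :: bin _); lia | lia].
Qed.

Lemma dbl_prefix s t u v :
  dbl s ++ [:: false; true] ++ u = dbl t ++ [:: false; true] ++ v -> s = t /\ u = v.
Proof.
elim: s t => [|b s IH] [|c t] /=.
- by case.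
- by case: c.
- by case: b.
- by move=> [<- _ h]; have [-> ->] := IH _ h.
Qed.

Lemma enc_nat_prefix m n u v : enc_nat m ++ u = enc_nat n ++ v -> m = n /\ u = v.
Proof. by rewrite !enc_natE -!catA => /dbl_prefix[/bin_inj -> ->]. Qed.

Section EncInj.
Variables (S : signature) (T : finType).
Implicit Types (C : seq (node S T)).

Lemma enc_nats_prefix l l' u v : size l = size l' ->
  flatten (map enc_nat l) ++ u = flatten (map enc_nat l') ++ v -> l = l' /\ u = v.
Proof.
have ep := enc_nat_prefix; move: enc_nat ep => e ep.
elim: l l' => [|n l IH] [|n' l'] //= [sl]; rewrite -!catA => /ep[-> h].
by have [-> ->] := IH _ sl h.
Qed.

(** The code of a gate does not record how many arguments follow; validity fixes the number as the
    arity, which makes decoding unique. *)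
Lemma enc_nodes_prefix k C C' u v : size C = size C' ->
  valid_nodes k C -> valid_nodes k C' ->
  flatten (map (@enc_node S T) C) ++ u = flatten (map (@enc_node S T) C') ++ v ->
  C = C' /\ u = v.
Proof.
have ep := enc_nat_prefix; have eps := enc_nats_prefix.
rewrite /enc_node; move: enc_nat ep eps => e ep eps.
elim: C C' k => [|nd C IH] [|nd' C'] k //= [sC] /andP[v1 v2] /andP[v1' v2'].
rewrite -!catA => h.
move: h; set X := flatten _ ++ u; set X' := flatten _ ++ v => h.
suff [-> h'] : nd = nd' /\ X = X' by have [-> ->] := IH _ _ sC v2 v2' h'.
case: nd nd' v1 v1' h => [i|c|f l] [i'|c'|f' l'] //=; rewrite -?catA.
- by move=> _ _ /ep[_] /ep[-> ->].
- by move=> _ _ /ep[].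
- by move=> _ _ /ep[].
- by move=> _ _ /ep[].
- by move=> _ _ /ep[_] /ep[/val_inj/enum_rank_inj -> ->].
- by move=> _ _ /ep[].
- by move=> _ _ /ep[].
- by move=> _ _ /ep[].
- move=> /andP[/eqP s1 _] /andP[/eqP s2 _] /ep[_] /ep[].
  move=> /val_inj/enum_rank_inj E; rewrite -E in s2 *.
  by move=> /eps; rewrite s1 s2 => /(_ erefl)[-> ->].
Qed.

(** [CEQV] quantifies over the circuits that a word encodes, so correctness of the reduction rests
    on there being only one valid circuit. *)
Lemma enc_instance_inj C g1 g2 C' g1' g2' :
  valid_instance C g1 g2 -> valid_instance C' g1' g2' ->
  enc_instance C g1 g2 = enc_instance C' g1' g2' ->
  [/\ C = C', g1 = g1' & g2 = g2'].
Proof.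
move=> /and3P[v1 _ _] /and3P[v2 _ _]; rewrite /enc_instance => /enc_nat_prefix[sC].
move=> /(enc_nodes_prefix sC v1 v2)[-> /enc_nat_prefix[-> h]]; split=> //.
by have := @enc_nat_prefix g2 g2' [::] [::]; rewrite !cats0 => /(_ h)[].
Qed.

End EncInj.

(** * Circuits made of blocks *)

Lemma eq_map_all (T U : Type) (P : pred T) (f g : T -> U) s :
  all P s -> (forall x, P x -> f x = g x) -> map f s = map g s.
Proof. by move=> + h; elim: s => //= x s IH /andP[/h -> /IH ->]. Qed.

(** References inside a gadget that has not been placed yet: an offset in its own block, or the node
    that carries the distinguished variable. *)
Inductive sref := Loc of nat | Prev.

Section Circuits.
Variables (S : signature) (B : finAlgebra S).
Notation A := (alg_of_fin B).
Notation T := (fcar B).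
Notation node := (node S T).

Definition run_from (a : nat -> T) (vals : seq T) (C : seq node) : seq T :=
  foldl (fun vals nd => rcons vals (eval_node (A := A) a vals nd)) vals C.

Lemma run_from_cat a vals C1 C2 :
  run_from a vals (C1 ++ C2) = run_from a (run_from a vals C1) C2.
Proof. exact: foldl_cat. Qed.

Lemma size_run a vals C : size (run_from a vals C) = size vals + size C.
Proof.
elim: C vals => [|nd C IH] vals; first by rewrite addn0.
by rewrite /= IH size_rcons addSnnS.
Qed.

Lemma nth_run a vals C i d :
  i < size vals -> nth d (run_from a vals C) i = nth d vals i.
Proof.
elim: C vals => [|nd C IH] vals //= h.
by rewrite IH ?size_rcons 1?ltnW // nth_rcons h.
Qed.

Lemma valid_nodes_cat k (C1 C2 : seq node) :
  valid_nodes k (C1 ++ C2) = valid_nodes k C1 && valid_nodes (k + size C1) C2.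
Proof.
elim: C1 k => [|nd C1 IH] k /=; first by rewrite addn0.
by rewrite IH andbA addSnnS.
Qed.

Inductive snode (V : Type) :=
  | SVar of V
  | SConst of T
  | SGate (f : sym S) of seq sref.

Fixpoint comp V (t : pterm A (option V)) (pos : nat) : seq (snode V) * sref :=
  match t with
  | PV None => ([::], Prev)
  | PV (Some v) => ([:: SVar v], Loc pos)
  | PC c => ([:: SConst V c], Loc pos)
  | PA f ts =>
      let st := foldl (fun st j =>
          let r := comp (ts j) (pos + size st.1) in (st.1 ++ r.1, rcons st.2 r.2))
        ([::], [::]) (enum 'I_(arity f)) in
      (rcons st.1 (SGate V f st.2), Loc (pos + size st.1))
  end.

Definition comp_step V (f : sym S) (ts : 'I_(arity f) -> pterm A (option V)) pos
    (st : seq (snode V) * seq sref) j :=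
  let r := comp (ts j) (pos + size st.1) in (st.1 ++ r.1, rcons st.2 r.2).

Lemma comp_PA V (f : sym S) (ts : 'I_(arity f) -> pterm A (option V)) pos :
  let st := foldl (comp_step ts pos) ([::], [::]) (enum 'I_(arity f)) in
  comp (PA ts) pos = (rcons st.1 (SGate V f st.2), Loc (pos + size st.1)).
Proof. by []. Qed.

Lemma comp_size V (t : pterm A (option V)) pos pos' :
  size (comp t pos).1 = size (comp t pos').1.
Proof.
elim: t pos pos' => [[v|]|c|f ts IH] pos pos' //; rewrite !comp_PA !size_rcons.
congr _.+1.
suff H l st st' : size st.1 = size st'.1 ->
    size (foldl (comp_step ts pos) st l).1 = size (foldl (comp_step ts pos') st' l).1
  by apply: H.
elim: l st st' => //= j l IHl st st' h; apply: IHl.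
by rewrite /comp_step /= !size_cat h (IH j _ (pos' + size st'.1)).
Qed.

Lemma comp_last V (t : pterm A (option V)) pos : t <> PV A None ->
  0 < size (comp t pos).1 /\ (comp t pos).2 = Loc (pos + (size (comp t pos).1).-1).
Proof.
case: t => [[v|]|c|f ts] //= _; rewrite ?addn0 //.
by rewrite size_rcons.
Qed.

Section Concrete.
Variables (V : Type) (base prev : nat) (name : V -> nat).

Definition aref (r : sref) : nat := if r is Loc o then base + o else prev.

Definition cnode (nd : snode V) : node :=
  match nd with
  | SVar v => NVar S T (name v)
  | SConst c => NConst S c
  | SGate f rs => NGate T f (map aref rs)
  end.

Lemma comp_correct a (t : pterm A (option V)) pos vals :
  size vals = base + pos -> prev < base ->
  let: (ns, r) := comp t pos in
  [/\ aref r < base + pos + size ns, valid_nodes (base + pos) (map cnode ns) &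
      nth (a 0) (run_from a vals (map cnode ns)) (aref r) =
      peval (B := A) (penv (fun v => a (name v)) (nth (a 0) vals prev)) t].
Proof.
move=> sv pb; elim: t pos vals sv => [[v|]|c|f ts IH] pos vals sv.
- by split=> //=; rewrite ?addn1 // nth_rcons sv ltnn eqxx.
- by split=> //=; lia.
- by split=> //=; rewrite ?addn1 // nth_rcons sv ltnn eqxx.
pose ev := peval (B := A) (penv (fun v => a (name v)) (nth (a 0) vals prev)).
pose Inv (l : seq 'I_(arity f)) (st : seq (snode V) * seq sref) :=
  [/\ valid_nodes (base + pos) (map cnode st.1),
      all (fun r => aref r < base + pos + size st.1) st.2 &
      [seq nth (a 0) (run_from a vals (map cnode st.1)) (aref r) | r <- st.2] =
      [seq ev (ts j) | j <- l]].
have InvF l done st : Inv done st -> Inv (done ++ l) (foldl (comp_step ts pos) st l).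
  elim: l done st => [|j l IHl] done st; first by rewrite cats0.
  move=> [h1 h2 h3] /=; rewrite -cat_rcons; apply: IHl.
  have := IH j (pos + size st.1) (run_from a vals (map cnode st.1)) _.
  rewrite size_run size_map sv addnA => /(_ erefl); rewrite /comp_step.
  case: (comp (ts j) (pos + size st.1)) => ns r /= [r1 r2 r3]; split=> /=.
  - by rewrite map_cat valid_nodes_cat h1 size_map r2.
  - rewrite all_rcons size_cat addnA r1 /=; apply: sub_all h2 => x.
    by move=> lt; apply: leq_trans lt _; apply: leq_addr.
  - rewrite !map_rcons map_cat run_from_cat r3 /ev; congr rcons; last first.
      by rewrite nth_run // sv; apply: leq_trans pb _; apply: leq_addr.
    rewrite -h3; apply: (eq_map_all h2) => x lt.
    by rewrite nth_run // size_run size_map sv.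
rewrite comp_PA; set st := foldl _ _ _.
have [h1 h2 h3] : Inv (enum 'I_(arity f)) st by apply: (InvF _ [::]); split.
have s2 : size st.2 = arity f.
  by have := congr1 size h3; rewrite size_map => ->; rewrite size_map size_enum_ord.
split.
- by rewrite /= size_rcons; lia.
- rewrite map_rcons -cats1 valid_nodes_cat h1 /= andbT size_map s2 eqxx /=.
  rewrite all_map; apply: sub_all h2 => x /=; by rewrite size_map.
rewrite map_rcons -cats1 run_from_cat /= nth_rcons size_run size_map sv.
rewrite -addnA ltnn eqxx; congr (op A f _); apply: functional_extensionality => j.
have jl : j < size st.2 by rewrite s2.
rewrite (nth_map Prev) //.
have := congr1 (fun s => nth (a 0) s j) h3.
rewrite (nth_map Prev) // (nth_map j) ?size_enum_ord // nth_ord_enum => ->.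
by [].
Qed.

End Concrete.

Section Blocks.
Variables (K : Type) (V : Type) (G : K -> pterm A (option V)) (z o : T).
Variables (b : nat) (name : nat -> nat -> V -> nat).
Hypothesis G_nvar : forall k, G k <> PV A None.
Hypothesis G_size : forall k, size (comp (G k) 0).1 <= 2 ^ b.

Definition blen := 2 ^ b.
Lemma blen_gt0 : 0 < blen. Proof. by rewrite expn_gt0. Qed.

(** The padding comes first, so that the value of the gadget is always the last node of its
    block. *)
Definition snodes (k : K) : seq (snode V) :=
  let n := size (comp (G k) 0).1 in
  nseq (blen - n) (SConst V z) ++ (comp (G k) (blen - n)).1.

Lemma size_snodes k : size (snodes k) = blen.
Proof.
rewrite size_cat size_nseq (comp_size _ _ 0) subnK //; exact: G_size.
Qed.

Definition tail (i : nat) : nat := i * blen + blen.-1.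

(* A block reads the last node of the block two positions before it, so that the
   even and the odd blocks form two separate chains. *)
Definition block (i : nat) (c : K * nat * nat) : seq node :=
  map (cnode (i * blen) (tail (i - 2)) (name c.1.2 c.2)) (snodes c.1.1).

Lemma size_block i c : size (block i c) = blen.
Proof. by rewrite size_map size_snodes. Qed.

Definition gstep (a : nat -> T) (u : T) (c : K * nat * nat) : T :=
  peval (B := A) (penv (fun v => a (name c.1.2 c.2 v)) u) (G c.1.1).

Lemma run_nseq a n c d vals :
  run_from a vals (nseq n (NConst S c)) = vals ++ nseq n c /\
  valid_nodes d (nseq n (NConst S c)).
Proof.
split; last by elim: n d => //= n IH d.
elim: n vals => [|n IH] vals; first by rewrite cats0.
by rewrite /= IH cat_rcons.
Qed.

Lemma run_block a i c vals : 2 <= i -> size vals = i * blen ->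
  valid_nodes (i * blen) (block i c) /\
  nth (a 0) (run_from a vals (block i c)) (tail i) =
    gstep a (nth (a 0) vals (tail (i - 2))) c.
Proof.
move=> i2 sv; case: c => [[k t] p]; rewrite /block /snodes /=.
set n := size _; have nb : n <= blen := G_size k.
have b0 := blen_gt0.
rewrite map_cat map_nseq run_from_cat valid_nodes_cat size_nseq.
have [-> ->] := run_nseq a (blen - n) z (i * blen) vals.
have pb : tail (i - 2) < i * blen by rewrite /tail; nia.
have sv' : size (vals ++ nseq (blen - n) z) = i * blen + (blen - n).
  by rewrite size_cat size_nseq sv.
have := comp_correct (name t p) a (G k) sv' pb.
have [n0 rE] := comp_last (blen - n) (@G_nvar k).
have sc := comp_size (G k) (blen - n) 0; rewrite -/n in sc.
case: (comp (G k) (blen - n)) n0 rE sc => ns r /= n0 -> sn [_ h2 h3].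
split=> //; have <- : aref (i * blen) (tail (i - 2)) (Loc (blen - n + (size ns).-1)) = tail i.
  by rewrite /aref /tail; lia.
by rewrite h3 /gstep nth_cat sv pb.
Qed.

Fixpoint blocks (i : nat) (cl : seq (K * nat * nat)) : seq node :=
  if cl is c :: cl' then block i c ++ block i.+1 c ++ blocks i.+2 cl' else [::].

Lemma size_blocks i cl : size (blocks i cl) = (size cl).*2 * blen.
Proof.
elim: cl i => //= c cl IH i; rewrite !size_cat !size_block IH; lia.
Qed.

Lemma blocks_rcons i cl c :
  blocks i (rcons cl c) =
  blocks i cl ++ block (i + (size cl).*2) c ++ block (i + (size cl).*2).+1 c.
Proof.
elim: cl i => [|c' cl IH] i /=; first by rewrite addn0 cats0.
rewrite IH -!catA; do 2 congr cat; congr cat.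
by have -> : i.+2 + (size cl).*2 = i + (size cl).+1.*2 by lia.
Qed.

Lemma run_blocks a cl i vals : 2 <= i -> size vals = i * blen ->
  let j := i + (size cl).*2 in
  [/\ valid_nodes (i * blen) (blocks i cl),
   nth (a 0) (run_from a vals (blocks i cl)) (tail (j - 2)) =
     foldl (gstep a) (nth (a 0) vals (tail (i - 2))) cl &
   nth (a 0) (run_from a vals (blocks i cl)) (tail (j - 1)) =
     foldl (gstep a) (nth (a 0) vals (tail (i - 1))) cl].
Proof.
elim: cl i vals => [|c cl IH] i vals i2 sv /=; first by rewrite addn0.
have [v1 e1] := run_block a c i2 sv.
set vals1 := run_from a vals (block i c) in e1.
have s1 : size vals1 = i.+1 * blen by rewrite size_run sv size_block; lia.
have [v2 e2] := run_block a c (leqW i2) s1.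
set vals2 := run_from a vals1 (block i.+1 c) in e2.
have s2 : size vals2 = i.+2 * blen by rewrite size_run s1 size_block; lia.
have [v3 e3 e4] := IH i.+2 vals2 isT s2.
rewrite !valid_nodes_cat v1 size_block -mulSnr v2 size_block -mulSnr v3.
have b0 := blen_gt0.
rewrite !run_from_cat -/vals1 -/vals2.
have -> : i + (size cl).+1.*2 = i.+2 + (size cl).*2 by lia.
rewrite e3 e4; split=> //.
- rewrite (_ : i.+2 - 2 = i); last by lia.
  by rewrite nth_run ?e1 // s1 /tail; lia.
- have -> : i.+2 - 1 = i.+1 by lia.
  rewrite e2 (_ : i.+1 - 2 = i - 1); last by lia.
  by rewrite /vals1 nth_run // sv /tail; nia.
Qed.

(** Blocks 0 and 1 are constant and start the two chains with [z] and [o]. *)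
Definition circ (cl : seq (K * nat * nat)) : seq node :=
  nseq blen (NConst S z) ++ nseq blen (NConst S o) ++ blocks 2 cl.

Definition instance_code cl : seq bool :=
  enc_instance (circ cl) (tail (size cl).*2) (tail (size cl).*2.+1).

Lemma size_circ cl : size (circ cl) = (size cl).*2.+2 * blen.
Proof. by rewrite !size_cat !size_nseq size_blocks; lia. Qed.

Lemma circ_correct cl :
  valid_instance (circ cl) (tail (size cl).*2) (tail (size cl).*2.+1) /\
  forall a,
    nth (a 0) (circuit_values (A := A) a (circ cl)) (tail (size cl).*2) =
      foldl (gstep a) z cl /\
    nth (a 0) (circuit_values (A := A) a (circ cl)) (tail (size cl).*2.+1) =
      foldl (gstep a) o cl.
Proof.
have b0 := blen_gt0.
have H a : let v := nseq blen z ++ nseq blen o in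
    run_from a [::] (circ cl) = run_from a v (blocks 2 cl).
  rewrite /circ !run_from_cat; have [-> _] := run_nseq a blen z 0 [::].
  by have [-> _] := run_nseq a blen o 0 ([::] ++ nseq blen z).
have sv : size (nseq blen z ++ nseq blen o) = 2 * blen.
  by rewrite size_cat !size_nseq; lia.
split.
  have [v1 _ _] := run_blocks (fun=> z) cl (leqnn 2) sv.
  rewrite /valid_instance size_circ /circ !valid_nodes_cat !size_nseq.
  have [_ ->] := run_nseq (fun=> z) blen z 0 [::].
  have [_ ->] := run_nseq (fun=> z) blen o (0 + blen) [::].
  rewrite (_ : 0 + blen + blen = 2 * blen) ?v1 /tail; last by lia.
  by apply/andP; split=> /=; lia.
move=> a; rewrite -[circuit_values _ _]/(run_from a [::] (circ cl)) H.
have [_ h1 h2] := run_blocks a cl (leqnn 2) sv.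
move: h1 h2; rewrite (_ : 2 + _ - 2 = (size cl).*2); last by lia.
rewrite (_ : 2 + _ - 1 = (size cl).*2.+1); last by lia.
move=> -> ->; rewrite !nth_cat !size_nseq !nth_nseq /tail /=; split.
  by rewrite (_ : 0 * blen + blen.-1 < blen) //; lia.
rewrite (_ : 1 * blen + blen.-1 < blen = false); last by lia.
by rewrite (_ : 1 * blen + blen.-1 - blen < blen) //; lia.
Qed.

Lemma CEQV_instance cl :
  CEQV (S := S) B (instance_code cl) <->
  forall a, foldl (gstep a) z cl = foldl (gstep a) o cl.
Proof.
have [vi ve] := circ_correct cl; split; last first.
  move=> h; exists (circ cl), (tail (size cl).*2), (tail (size cl).*2.+1).
  by split=> //; split=> // a; have [-> ->] := ve a.
move=> [C [g1 [g2 [vC [eC hC]]]]] a.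
have [E1 E2 E3] := enc_instance_inj vC vi eC.
by have := hC a; rewrite E1 E2 E3; have [-> ->] := ve a.
Qed.

Variable sat : K -> (V -> T) -> bool.
Hypothesis G_gate : forall k E,
  if sat k E then
    peval (B := A) (penv E z) (G k) = z /\ peval (B := A) (penv E o) (G k) = o
  else peval (B := A) (penv E z) (G k) = peval (B := A) (penv E o) (G k).
Hypothesis zo : z <> o.

(** While the constraints hold, the chains carry [z] and [o]; the first violated one makes them
    equal, and equal values stay equal. *)
Lemma gstep_sat a cl :
  foldl (gstep a) z cl = foldl (gstep a) o cl <->
  ~~ all (fun c => sat c.1.1 (fun v => a (name c.1.2 c.2 v))) cl.
Proof.
elim: cl => [|c cl IH]; first by split.
rewrite /= negb_and; have := G_gate c.1.1 (fun v => a (name c.1.2 c.2 v)).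
case: ifP => _ /=; first by move=> [h1 h2]; rewrite /gstep h1 h2.
by rewrite -/(gstep a z c) -/(gstep a o c) => ->; split.
Qed.

End Blocks.

End Circuits.

(** * Tilings and computation tableaux *)

Section Tiling.
Variables (Sg K : finType) (R : K -> pred {ffun 'I_4 -> Sg}).

(** A window consists of three neighbouring cells of one row and the cell of the next row at the
    middle position: [(t,p)], [(t,p+1)], [(t,p+2)], [(t+1,p+1)]. *)
Definition dt (i : 'I_4) : nat := val i == 3.
Definition dp (i : 'I_4) : nat := nth 0 [:: 0; 1; 2; 1] i.

Definition window (F : nat -> nat -> Sg) (t p : nat) : {ffun 'I_4 -> Sg} :=
  [ffun i => F (t + dt i) (p + dp i)].

Definition tiles (F : nat -> nat -> Sg) (cl : seq (K * nat * nat)) : bool :=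
  all (fun c => R c.1.1 (window F c.1.2 c.2)) cl.

(** Unary coordinates can be printed directly from unary counters. The last run of ones is never
    empty, so the word is the numeral of its value. *)
Definition cell_bits (t p : nat) (x : Sg) : seq bool :=
  nseq t true ++ false :: nseq p true ++ false :: nseq (enum_rank x).+1 true.

Definition cell_name (t p : nat) (x : Sg) : nat := bval (cell_bits t p x).

Definition var_name (t p : nat) (v : 'I_4 * Sg) : nat :=
  cell_name (t + dt v.1) (p + dp v.1) v.2.

Lemma bin_cell t p x : bin (cell_name t p x) = cell_bits t p x.
Proof.
apply: bin_bval; rewrite /cell_bits last_cat /= last_cat /=.
by elim: (enum_rank x : nat).
Qed.

Lemma nseq_true_inj a a' u u' :
  nseq a true ++ false :: u = nseq a' true ++ false :: u' -> a = a' /\ u = u'.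
Proof.
elim: a a' => [|a IH] [|a'] //=; first by case.
by case=> /IH[-> ->].
Qed.

Lemma cell_name_inj t p x t' p' x' :
  cell_name t p x = cell_name t' p' x' -> [/\ t = t', p = p' & x = x'].
Proof.
move=> /(congr1 bin); rewrite !bin_cell => /nseq_true_inj[-> /nseq_true_inj[-> h]].
split=> //; apply/enum_rank_inj/val_inj.
by have := congr1 size h; rewrite !size_nseq => - [].
Qed.

(** Variable [(i, x)] says that cell [i] of the window carries [x]. The three families say: some
    symbol in each cell, no two symbols in a cell, no forbidden window. *)
Definition clauses (k : K) : seq (bool * seq ('I_4 * Sg)) :=
  [seq (true, [seq (i, x) | x <- enum Sg]) | i <- enum 'I_4] ++
  [seq (false, [:: q.1; (q.1.1, q.2)])
    | q <- [seq q <- enum ({: 'I_4 * Sg * Sg}) | q.1.2 != q.2]] ++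
  [seq (false, [seq (i, f i) | i <- enum 'I_4])
    | f : {ffun 'I_4 -> Sg} <- [seq f <- enum {: {ffun 'I_4 -> Sg}} | ~~ R k f]].

Lemma clausesP (T : finType) (tr : pred T) k (E : 'I_4 * Sg -> T) :
  reflect (exists2 s, R k s & forall i x, tr (E (i, x)) = (x == s i))
    (all (fun c => if c.1 then has (fun v => tr (E v)) c.2
                   else ~~ all (fun v => tr (E v)) c.2) (clauses k)).
Proof.
apply: (iffP idP).
  rewrite !all_cat => /and3P[/allP h1 /allP h2 /allP h3].
  have ex i : {x | tr (E (i, x))}.
    apply: constructive_indefinite_description.
    have /h1 /= /hasP[_ /mapP[x _ ->] /= hx] :
      (true, [seq (i, x) | x <- enum Sg]) \in
      [seq (true, [seq (i, x) | x <- enum Sg]) | i <- enum 'I_4].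
      by apply: map_f; rewrite mem_enum.
    by exists x.
  pose s := [ffun i => sval (ex i)].
  have sE i : tr (E (i, s i)) by rewrite ffunE; case: (ex i).
  have un i x : tr (E (i, x)) = (x == s i).
    apply/idP/eqP => [hx|-> //]; apply/eqP/negPn/negP => ne.
    have /h2 : (false, [:: (i, x); (i, s i)]) \in
      [seq (false, [:: q.1; (q.1.1, q.2)])
        | q <- [seq q <- enum ({: 'I_4 * Sg * Sg}) | q.1.2 != q.2]].
      apply/mapP; exists (i, x, s i) => //.
      by rewrite mem_filter /= ne mem_enum.
    by rewrite /= hx sE.
  exists s => //; apply/negPn/negP => nR.
  have /h3 /= : (false, [seq (i, s i) | i <- enum 'I_4]) \in
    [seq (false, [seq (i, f i) | i <- enum 'I_4])
    | f : {ffun 'I_4 -> Sg} <- [seq f <- enum {: {ffun 'I_4 -> Sg}} | ~~ R k f]].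
    by apply: map_f; rewrite mem_filter nR mem_enum.
  by move/negP; apply; apply/allP => _ /mapP[i _ ->]; apply: sE.
move=> [s Rs sE]; rewrite !all_cat; apply/and3P; split; apply/allP.
- move=> _ /mapP[i _ ->] /=; apply/hasP; exists (i, s i); last by rewrite sE.
  by apply: map_f; rewrite mem_enum.
- move=> c /mapP[[[i x] y]]; rewrite mem_filter /= => /andP[xy _] -> /=.
  rewrite !sE andbT negb_and; case: eqP => //= xs.
  by rewrite -xs eq_sym.
- move=> c /mapP[f]; rewrite mem_filter => /andP[nR _] -> /=.
  apply/negP => /allP h; move/negP: nR; apply.
  have -> // : f = s; apply/ffunP => i; apply/eqP; rewrite -sE.
  by apply: h; apply: map_f; rewrite mem_enum.
Qed.

Variables (S : signature) (B : finAlgebra S).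
Notation A := (alg_of_fin B).

Theorem tiling_CEQV : 0 < #|Sg| -> has_gadgets B ->
  exists (z o : fcar B) (G : K -> pterm A (option ('I_4 * Sg))) b,
  (forall k, size (comp (G k) 0).1 <= 2 ^ b) /\
  forall cl, CEQV (S := S) B (instance_code G z o b var_name cl) <->
    ~ exists F, tiles F cl.
Proof.
move=> Sg0 [z [o [tr [zo [xt ht] [xf hf] gad]]]].
pose G k := sval (constructive_indefinite_description _ (gad _ (clauses k))).
have GE k E : if all (clause_sat tr E) (clauses k) then
    peval (B := A) (penv E z) (G k) = z /\ peval (B := A) (penv E o) (G k) = o
  else peval (B := A) (penv E z) (G k) = peval (B := A) (penv E o) (G k).
  exact: svalP (constructive_indefinite_description _ (gad _ (clauses k))) E.
pose b := \max_(k : K) size (comp (G k) 0).1.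
have Gs k : size (comp (G k) 0).1 <= 2 ^ b.
  by apply: leq_trans (ltnW (ltn_expl b _)) => //; apply: (leq_bigmax k).
(* When all variables are false the clauses fail, so the gadget identifies [z] and [o], which the
   bare variable does not. *)
have Gn k : G k <> PV A None.
  move=> E; have := GE k (fun=> xf); case: ifP; last by rewrite E.
  move=> /(@clausesP (fcar B) tr k (fun=> xf)) [s _ sE].
  by have := sE ord0 (s ord0); rewrite eqxx (negbTE hf).
exists z, o, G, b; split=> // cl.
rewrite (CEQV_instance z o var_name Gn Gs cl).
have gs a := gstep_sat var_name GE zo a cl.
split.
  move=> H [F tF].
  (* Only the names of cells with their symbol in [F] get a true element; injectivity of the names
     makes this consistent. *)
  pose a n := if asb (exists t p, n = cell_name t p (F t p)) then xt else xf.
  have aE t p x : tr (a (cell_name t p x)) = (x == F t p).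
    rewrite /a; case: asbP => h; last first.
      rewrite (negbTE hf); apply/esym/eqP => xE; apply: h; exists t, p; by rewrite xE.
    by have [t' [p' /cell_name_inj[-> -> ->]]] := h; rewrite ht eqxx.
  have /gs := H a; move/negP; apply; apply: sub_all tF => c Rc.
  apply/clausesP; exists (window F c.1.2 c.2) => // i x.
  by rewrite ffunE aE.
move=> H a; apply/gs/negP => sa; apply: H.
have [x0 _] := card_gt0P Sg0.
pose F t p := odflt x0 [pick x | tr (a (cell_name t p x))].
exists F; apply: sub_all sa => c /clausesP[s Rs sE].
have -> // : window F c.1.2 c.2 = s; apply/ffunP => i; rewrite ffunE /F.
case: pickP => [x|/(_ (s i))] /=.
  by have := sE i x; rewrite /var_name /= => -> /eqP.
by have := sE i (s i); rewrite /var_name /= => ->; rewrite eqxx.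
Qed.

End Tiling.

(** * Computation tableaux of a machine with a guessed witness *)

Section Tableau.
Variable M : TM.
Notation Q := (tQ M).
Notation Gm := (tG M).
Notation blank := (tblank M).
Notation hcell := (option Q * Gm)%type.

(** A halted machine repeats its configuration, so row [D] shows the outcome of every shorter
    run. *)
Definition delta' (q : Q) (g : Gm) : Q * Gm * dir :=
  if thalt M q then (q, g, DN) else tdelta M q g.

Definition arrives (d : dir) (x : hcell) : option Q :=
  if x.1 is Some q then
    let: (q', _, d') := delta' q x.2 in
    match d, d' with DL, DL | DR, DR | DN, DN => Some q' | _, _ => None end
  else None.

Definition local (a b c : hcell) : hcell :=
  (if arrives DN b is Some q then Some q
   else if arrives DR a is Some q then Some q else arrives DL c,
   if b.1 is Some q then (delta' q b.2).1.2 else b.2).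

Definition aconf := (Q * nat * (nat -> Gm))%type.

Definition astep (s : aconf) : aconf :=
  let: (q, h, c) := s in
  let: (q', g, d) := delta' q (c h) in (q', move_head d h, write c h g).

Definition hcell_at (s : aconf) (p : nat) : hcell :=
  (if p == s.1.2 then Some s.1.1 else None, s.2 p).

Lemma local_step s p :
  local (hcell_at s p) (hcell_at s p.+1) (hcell_at s p.+2) = hcell_at (astep s) p.+1.
Proof.
case: s => [[q h] c]; rewrite /local /hcell_at /arrives /astep /=.
case E: (delta' q (c h)) => [[q' g] d] /=.
rewrite /write; congr pair; last first.
  by case: (eqVneq p.+1 h) => [->|] //; rewrite E.
case: (eqVneq p.+1 h) => [ph|ph].
  have -> : (p == h) = false by lia.
  have -> : (p.+2 == h) = false by lia.
  rewrite ph E /=; case: d {E} => /=.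
  - by have -> : (h == h.-1) = false by lia.
  - by have -> : (h == h.+1) = false by lia.
  - by rewrite eqxx.
case: (eqVneq p h) => [ph'|ph'] /=.
  have -> : (p.+2 == h) = false by lia.
  rewrite ph' E; case: d {E} => /=.
  - by have -> : (h.+1 == h.-1) = false by lia.
  - by rewrite eqxx.
  - by have -> : (h.+1 == h) = false by lia.
case: (eqVneq p.+2 h) => [ph2|ph2] /=.
  rewrite ph2 E; case: d {E} => /=.
  - by have -> : (p.+1 == h.-1) by lia.
  - by have -> : (p.+1 == h.+1) = false by lia.
  - by have -> : (p.+1 == h) = false by lia.
case: d {E} => /=.
- by have -> : (p.+1 == h.-1) = false by lia.
- by have -> : (p.+1 == h.+1) = false by lia.
- by have -> : (p.+1 == h) = false by lia.
Qed.

Variables (x : seq bool) (D m : nat).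
Let y0 := dbl x ++ [:: false; true].
Let L := size y0.
(** Row [t] is determined by row 0 only at distance at least [t] from both ends, and in [D] steps
    the head moves at most [D] cells from its start [2 * D]; margins of about [2 * D] keep it in the
    determined part. *)
Let W := 2 * D + L + m + (2 * D).+1.

Lemma pair_encE w : pair_enc x w = y0 ++ w.
Proof. by rewrite /pair_enc /y0 -catA. Qed.

Section Run.
Variable y : seq bool.

Definition ainit : aconf :=
  (tstart M, 2 * D, fun n => if n < 2 * D then blank
                             else nth blank (map (tin M) y) (n - 2 * D)).

Definition arun (t : nat) : aconf := iter t astep ainit.

Lemma arun_conf t : t <= 2 * D ->
  conf_at (arun t).1.1 (arun t).1.2 (arun t).2 (tm_run M t y) /\
  2 * D - t <= (arun t).1.2 <= 2 * D + t.
Proof.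
elim: t => [|t IH] le; first by split; [apply: conf_at_init | rewrite /= subn0 addn0 leqnn].
have [h1 h2] := IH (ltnW le).
rewrite /tm_run /arun !iterS -/(tm_run M t y) -/(arun t).
case: (arun t) h1 h2 => [[q h] c] /= h1 h2.
rewrite /delta'; case: (boolP (thalt M q)) => hq /=.
  split; last by lia.
  rewrite (conf_at_halt h1 hq); apply: conf_at_ext h1 => n.
  by rewrite /write; case: eqP => // ->.
case E: (tdelta M q (c h)) => [[q' g] d] /=; split.
  by apply: (conf_at_step h1 (negbTE hq) E); lia.
by case: d E => E /=; lia.
Qed.

End Run.

(** The flag marks the cells of row 0 beyond the witness. [witness_cell] lets it pass only from off
    to on, so a witness shorter than [m] is followed by blanks. The tape symbols alone would not do,
    as [tin] may produce the blank. *)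
Definition tcell := (option Q * Gm * bool)%type.

Definition witness_cell (a b : tcell) : bool :=
  [|| a == (None, tin M false, false), a == (None, tin M true, false)
    | (a == (None, blank, true)) && b.2].

Definition accept_cell (a : tcell) : bool :=
  if a.1.1 is Some q then tacc M q else true.

Record tableau (F : nat -> nat -> tcell) : Prop := Tableau {
  tab_left : forall p, p < 2 * D -> F 0 p = (None, blank, false);
  tab_start : (F 0 (2 * D)).1.1 = Some (tstart M);
  tab_input : forall j, j < L ->
    [/\ (F 0 (2 * D + j)).1.2 = tin M (nth false y0 j), (F 0 (2 * D + j)).2 = false &
        (F 0 (2 * D + j).+1).1.1 = None];
  tab_witness : forall i, i < m ->
    witness_cell (F 0 (2 * D + L + i)) (F 0 (2 * D + L + i).+1);
  tab_right : forall i, i < (2 * D).+1 -> F 0 (2 * D + L + m + i) = (None, blank, true);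
  tab_step : forall t p, t < D -> p < W ->
    F t.+1 p.+1 = (local (F t p).1 (F t p.+1).1 (F t p.+2).1, false);
  tab_accept : forall p, p < W -> accept_cell (F D p) }.

Lemma L_ge2 : 2 <= L. Proof. by rewrite /L /y0 size_cat addnC. Qed.

Lemma tableau_of_witness w : size w <= m ->
  tacc M (tm_state M (tm_run M D (pair_enc x w))) -> exists F, tableau F.
Proof.
move=> wm ac; rewrite pair_encE in ac; set y := y0 ++ w in ac.
have sy : size y = L + size w by rewrite size_cat.
have L2 := L_ge2.
pose F t p : tcell := (hcell_at (arun y t) p, (t == 0) && (2 * D + L + size w <= p)).
have F0 p : F 0 p = (if p == 2 * D then Some (tstart M) else None,
    if p < 2 * D then blank else nth blank (map (tin M) y) (p - 2 * D),
    2 * D + L + size w <= p) by [].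
exists F; split.
- move=> p hp; rewrite F0 hp; case: eqP => [|_]; first by lia.
  by congr (_, _); lia.
- by rewrite F0 eqxx.
- move=> j jL; rewrite !F0 /=.
  have -> : (2 * D + j < 2 * D) = false by lia.
  have -> : 2 * D + j - 2 * D = j by lia.
  rewrite (nth_map false) ?sy ?nth_cat -/L ?jL; try lia.
  by split=> //; [lia | case: eqP => //; lia].
- move=> i im; rewrite !F0 /witness_cell /=.
  have -> : (2 * D + L + i == 2 * D) = false by lia.
  have -> : (2 * D + L + i < 2 * D) = false by lia.
  have -> : 2 * D + L + i - 2 * D = L + i by lia.
  case: (ltnP i (size w)) => iw.
    rewrite (nth_map false) ?sy ?ltn_add2l //.
    have -> : (2 * D + L + size w <= 2 * D + L + i) = false by lia.
    by case: nth; rewrite eqxx ?orbT.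
  rewrite nth_default; last by rewrite size_map sy leq_add2l.
  have -> : (2 * D + L + size w <= 2 * D + L + i) by lia.
  have -> : (2 * D + L + size w <= (2 * D + L + i).+1) by lia.
  by rewrite eqxx !orbT.
- move=> i iD; rewrite !F0.
  have -> : (2 * D + L + m + i == 2 * D) = false by lia.
  have -> : (2 * D + L + m + i < 2 * D) = false by lia.
  rewrite nth_default ?size_map ?sy; last by lia.
  by congr (_, _); lia.
- by move=> t p tD pW; rewrite /F /= local_step.
- move=> p pW; rewrite /accept_cell /F /=; case: ifP => // _.
  have [h1 _] := arun_conf y (leq_pmull D (isT : 0 < 2)).
  by rewrite -(conf_at_state h1).
Qed.

Lemma witness_of_tableau F : tableau F ->
  exists2 w, size w <= m & tacc M (tm_state M (tm_run M D (pair_enc x w))).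
Proof.
move=> [hl hs hi hw hr hst ha]; have L2 := L_ge2.
pose tg i := (F 0 (2 * D + L + i)).2.
have tgm : tg m by rewrite /tg -[_ + m]addn0 hr.
have ex : exists l, tg l by exists m.
(* The witness ends at the first flagged cell; position [m] is flagged because it belongs to the
   right margin. *)
have [l tl lmin] := ex_minnP ex.
have lm : l <= m by apply: lmin.
have tprop i : l <= i -> i <= m -> tg i.
  move=> li; rewrite -(subnK li); elim: (i - l) => //= d IH dm.
  have /IH hd : d + l <= m by lia.
  have /hw : d + l < m by lia.
  rewrite /witness_cell; case/or3P => [/eqP E|/eqP E|/andP[_ h]].
  - by move: hd; rewrite /tg E.
  - by move: hd; rewrite /tg E.
  - by rewrite /tg addSn addnS.
(* If [tin] identifies the two bits, this may read the other bit than was meant, but it still writes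
   the same tape symbol. *)
pose bit i := (F 0 (2 * D + L + i)).1.2 == tin M true.
pose w := mkseq bit l.
have sw : size w = l by rewrite size_mkseq.
have cw i : i < l -> (F 0 (2 * D + L + i)).1 = (None, tin M (nth false w i)).
  move=> il; have nt : ~~ tg i by apply/negP => /lmin; lia.
  rewrite nth_mkseq // /bit; have /hw : i < m by lia.
  rewrite /witness_cell; case/or3P => [/eqP E|/eqP E|/andP[/eqP E _]].
  - by rewrite E /=; case: eqP => [<-|].
  - by rewrite E /= eqxx.
  - by move: nt; rewrite /tg E.
have cb i : l <= i -> i < m -> (F 0 (2 * D + L + i)).1 = (None, blank).
  move=> li im; have := hw i im; have := tprop i li (ltnW im); rewrite /tg.
  by rewrite /witness_cell => ht /or3P[/eqP E|/eqP E|/andP[/eqP -> _]] //; move: ht; rewrite E.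
exists w; rewrite ?sw // pair_encE; set y := y0 ++ w.
have row0 p : p < W -> (F 0 p).1 = hcell_at (arun y 0) p.
  move=> pW; rewrite /hcell_at /=.
  case: (ltnP p (2 * D)) => h1.
    by rewrite hl //=; case: eqP => //; lia.
  case: (ltnP p (2 * D + L)) => h2.
    have [j jL ->] : exists2 j, j < L & p = 2 * D + j by exists (p - 2 * D); lia.
    have [i1 i2 i3] := hi j jL; rewrite addKn (nth_map false); last first.
      by rewrite size_cat; apply: leq_trans jL (leq_addr _ _).
    rewrite nth_cat -/L jL -i1 [LHS]surjective_pairing; congr pair.
    case: j jL {i1 i2 i3} => [|j] jL; first by rewrite addn0 eqxx.
    rewrite addnS; case: eqP => [|_]; first by lia.
    by have [_ _] := hi j (ltnW jL).
  have [i pE] : exists i, p = 2 * D + L + i by exists (p - (2 * D + L)); lia.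
  rewrite {}pE in pW *.
  have -> : (2 * D + L + i == 2 * D) = false by lia.
  rewrite -addnA addKn addnA; case: (ltnP i l) => il.
    rewrite cw // (nth_map false); last by rewrite size_cat sw ltn_add2l.
    by rewrite nth_cat -/L ltnNge leq_addr /= addKn.
  rewrite nth_default; last by rewrite size_map size_cat sw leq_add2l.
  case: (ltnP i m) => im; first exact: cb.
  have -> : 2 * D + L + i = 2 * D + L + m + (i - m) by lia.
  by rewrite hr //; move: pW; rewrite /W; lia.
(* The determined part loses one cell at either end per row, where a neighbour is unknown. *)
have rows t : t <= D -> forall p, t <= p -> p + t < W -> (F t p).1 = hcell_at (arun y t) p.
  elim: t => [|t IH] tD p; first by rewrite addn0 => _; apply: row0.
  case: p => // p tp pW; rewrite hst //; last by lia.
  by rewrite /= !IH ?local_step //; lia.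
have [h1 h2] := arun_conf y (leq_pmull D (isT : 0 < 2)).
rewrite (conf_at_state h1).
have hW : (arun y D).1.2 + D < W by rewrite /W; lia.
have := ha (arun y D).1.2 _; rewrite /accept_cell rows //=; last by lia.
by rewrite /hcell_at /= eqxx; apply; lia.
Qed.

End Tableau.

(** * Reasoning about programs *)

Section Runs.
Variable G : finType.
Implicit Types (p q : prog G) (s : stacks G).

Definition runs p s s' n : Prop := eval p s = s' /\ cost p s <= n.

Lemma runs_le p s s' n n' : n <= n' -> runs p s s' n -> runs p s s' n'.
Proof. by move=> le [e c]; split=> //; apply: leq_trans le. Qed.

Lemma runs_skip s : runs (Skip G) s s 1. Proof. by split. Qed.

Lemma runs_push s j a : runs (Push j a) s (put s j (a :: get s j)) 1.
Proof. by split. Qed.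

Lemma runs_seq p q s s1 s2 n1 n2 :
  runs p s s1 n1 -> runs q s1 s2 n2 -> runs (Seq p q) s s2 (n1 + n2).
Proof. by move=> [e1 c1] [e2 c2]; split; rewrite /= e1 // leq_add. Qed.

Lemma runs_pop j f s a u s' n : get s j = a :: u ->
  runs (f (Some a)) (put s j u) s' n -> runs (Case j f) s s' n.+1.
Proof. by move=> E [e c]; split; rewrite /= E. Qed.

Lemma runs_empty j f s s' n : get s j = [::] ->
  runs (f None) s s' n -> runs (Case j f) s s' n.+1.
Proof. by move=> E [e c]; split; rewrite /= E. Qed.

Lemma runs_for j f s c (P : seq G -> stacks G -> Prop) :
  P (get s j) (put s j [::]) ->
  (forall a u s1, P (a :: u) s1 -> exists2 s2, runs (f a) s1 s2 c & P u s2) ->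
  exists2 s', runs (For j f) s s' (size (get s j) * c.+1 + 1) & P [::] s'.
Proof.
move=> P0 PS; rewrite /runs /= -/(loop_step f).
elim: (get s j) (put s j [::]) P0 => [|a u IH] s0 P0; first by exists s0.
have [s2 [e2 c2] P2] := PS _ _ _ P0; have [s' [e3 c3] P3] := IH _ P2.
exists s' => //; split; first by rewrite /= e2.
rewrite /= {2}/loop_step /= [1 + _]addnC loop_cost e2 mulSn -addnA.
by rewrite leq_add.
Qed.

Fixpoint seqs (l : seq (prog G)) : prog G :=
  if l is p :: l' then Seq p (seqs l') else Skip G.

(** Describing the final stacks pointwise avoids normalising nested [put]s. *)
Definition does p s n (g : nat -> seq G) : Prop :=
  exists s', [/\ runs p s s' n, size s' = size s & get s' =1 g].

Lemma does_ext p s n n' g g' : does p s n g -> n <= n' -> g =1 g' -> does p s n' g'.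
Proof.
move=> [s' [r z h]] le e; exists s'; split=> //; first exact: runs_le r.
by move=> l; rewrite h e.
Qed.

Lemma does_skip s : does (Skip G) s 1 (get s).
Proof. by exists s; split=> //; apply: runs_skip. Qed.

Lemma does_push s j a : j < size s ->
  does (Push j a) s 1 (fun l => if l == j then a :: get s j else get s l).
Proof.
move=> js; exists (put s j (a :: get s j)); split; [exact: runs_push | exact: size_put | ].
by move=> l; rewrite get_put.
Qed.

Lemma does_seq p q s n1 n2 g1 g2 : does p s n1 g1 ->
  (forall s1, size s1 = size s -> get s1 =1 g1 -> does q s1 n2 g2) ->
  does (Seq p q) s (n1 + n2) g2.
Proof.
move=> [s1 [r1 z1 h1]] /(_ s1 z1 h1) [s2 [r2 z2 h2]]; exists s2; split=> //.
  exact: runs_seq r1 r2.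
by rewrite z2.
Qed.

Lemma does_pop j f s a u n g : get s j = a :: u -> j < size s ->
  (forall s1, size s1 = size s -> (forall l, get s1 l = if l == j then u else get s l) ->
    does (f (Some a)) s1 n g) -> does (Case j f) s n.+1 g.
Proof.
move=> E js h; have [||s' [r z e]] := h (put s j u); first exact: size_put.
  by move=> l; rewrite get_put.
exists s'; split=> //; first exact: runs_pop E r.
by rewrite z size_put.
Qed.

Lemma does_empty j f s n g : get s j = [::] ->
  does (f None) s n g -> does (Case j f) s n.+1 g.
Proof.
by move=> E [s' [r z e]]; exists s'; split=> //; apply: runs_empty E r.
Qed.

Lemma does_for j f s c (P : seq G -> (nat -> seq G) -> Prop) : j < size s ->
  (forall u g g', g =1 g' -> P u g -> P u g') ->
  P (get s j) (fun l => if l == j then [::] else get s l) ->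
  (forall a u s1, size s1 = size s -> P (a :: u) (get s1) ->
     exists2 g, does (f a) s1 c g & P u g) ->
  exists2 g, does (For j f) s (size (get s j) * c.+1 + 1) g & P [::] g.
Proof.
move=> js Pe P0 PS.
have [||s' r [z h]] := @runs_for j f s c (fun u s1 => size s1 = size s /\ P u (get s1)).
- split; first exact: size_put.
  by apply: Pe P0 => l; rewrite get_put.
- move=> a u s1 [z h]; have [g [s2 [r2 z2 e2]] P2] := PS a u s1 z h.
  exists s2 => //; split; first by rewrite z2.
  by apply: Pe P2 => l; rewrite e2.
- by exists (get s') => //; exists s'.
Qed.

Definition pushes o (bs : seq G) : prog G := seqs [seq Push o b | b <- bs].

Lemma does_pushes o bs s : o < size s ->
  does (pushes o bs) s (size bs).+1
    (fun l => if l == o then rev bs ++ get s o else get s l).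
Proof.
elim: bs s => [|b bs IH] s os.
  by apply: does_ext (does_skip s) _ _ => // l; case: eqP => // ->.
apply: (does_seq (n1 := 1) (does_push b os)) => s1 z1 h1.
apply: does_ext (IH s1 _) _ _ => // [|l]; first by rewrite z1.
by rewrite !h1 eqxx; case: eqP => // _; rewrite rev_cons cat_rcons.
Qed.

Definition move_to i j : prog G := For i (fun a => Push j a).

Lemma does_move i j s : i < size s -> j < size s -> i != j ->
  does (move_to i j) s (size (get s i) * 2 + 1)
    (fun l => if l == i then [::] else
              if l == j then rev (get s i) ++ get s j else get s l).
Proof.
move=> si sj ij.
pose P u (g : nat -> seq G) := exists2 v, get s i = v ++ u &
  forall l, g l = if l == i then [::] else
                  if l == j then rev v ++ get s j else get s l.
have [||||g d [v]] := @does_for i (fun a => Push j a) s 1 P.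
- by [].
- by move=> u g g' e [v E h]; exists v => // l; rewrite -e h.
- by exists [::] => // l; case: (eqVneq l j) => [->|] //.
- move=> a u s1 z [v E h]; have sj1 : j < size s1 by rewrite z.
  exists (fun l => if l == j then a :: get s1 j else get s1 l); first exact: does_push.
  exists (rcons v a); first by rewrite cat_rcons.
  move=> l; rewrite !h; case: (eqVneq l j) => [->|] //.
  by rewrite eqxx eq_sym (negbTE ij) rev_rcons.
- by rewrite cats0 => <- e; apply: does_ext d _ e.
Qed.

Definition copy_to i j tmp : prog G :=
  Seq (For i (fun a => Seq (Push j a) (Push tmp a))) (move_to tmp i).

Lemma does_copy i j tmp s : i < size s -> j < size s -> tmp < size s ->
  i != j -> i != tmp -> j != tmp -> get s tmp = [::] ->
  does (copy_to i j tmp) s (size (get s i) * 5 + 2)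
    (fun l => if l == j then rev (get s i) ++ get s j else get s l).
Proof.
move=> si sj st ij it jt t0.
pose P u (g : nat -> seq G) := exists2 v, get s i = v ++ u &
  forall l, g l = if l == i then [::] else if l == tmp then rev v else
                  if l == j then rev v ++ get s j else get s l.
have [||||g d [v vE gE]] := @does_for i (fun a => Seq (Push j a) (Push tmp a)) s 2 P.
- by [].
- by move=> u g g' e [v E h]; exists v => // l; rewrite -e h.
- exists [::] => // l; case: (l == i) => //; case: (eqVneq l tmp) => [-> //|_].
  by case: (eqVneq l j) => [->|].
- move=> a u s1 z [v E h]; have sj1 : j < size s1 by rewrite z.
  eexists.
    apply: (does_seq (n1 := 1) (does_push a sj1)) => s2 z2 h2.
    have st2 : tmp < size s2 by rewrite z2 z.
    by apply: does_ext (does_push a st2) (leqnn _) _ => l; rewrite !h2; reflexivity.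
  exists (rcons v a); first by rewrite cat_rcons.
  move=> l; rewrite !h eqxx; case: (eqVneq l tmp) => [->|_].
    by rewrite !eqxx [tmp == j]eq_sym (negbTE jt) [tmp == i]eq_sym (negbTE it) rev_rcons.
  case: (eqVneq l j) => [->|_] //.
  by rewrite ?eqxx [j == i]eq_sym (negbTE ij) (negbTE jt) rev_rcons.
rewrite cats0 in vE.
apply: does_ext (does_seq (n2 := size (get s i) * 2 + 1) d _) _ (fun=> erefl); last by lia.
move=> s1 z1 h1; have st1 : tmp < size s1 by rewrite z1.
have si1 : i < size s1 by rewrite z1.
apply: does_ext (does_move st1 si1 _) _ _; first by rewrite eq_sym.
  by rewrite h1 gE eq_sym (negbTE it) eqxx size_rev vE.
move=> l; rewrite !h1 !gE !eqxx [tmp == i]eq_sym (negbTE it) revK cats0 -vE.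
case: (eqVneq l tmp) => [->|_]; first by rewrite [tmp == j]eq_sym (negbTE jt) t0.
by case: (eqVneq l i) => [->|_] //; rewrite (negbTE ij).
Qed.

End Runs.

(** Items of a printing template. A hole is filled with the contents of a stack, each digit doubled
    as in the self-delimiting code of numbers. *)
Inductive titem := TLit of seq bool | THole of nat.

Section Print.
Variable tmp : nat.

Definition item_bits (g : nat -> seq bool) (it : titem) : seq bool :=
  match it with TLit bs => bs | THole j => dbl (g j) end.

Definition print_hole o j : prog bool :=
  Seq (For j (fun a => Seq (Push o a) (Seq (Push o a) (Push tmp a)))) (move_to bool tmp j).

Definition print_item o it : prog bool :=
  match it with TLit bs => pushes o bs | THole j => print_hole o j end.

Definition print o its : prog bool := seqs (map (print_item o) its).

Definition item_ok k o it : bool :=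
  if it is THole j then [&& j < k, j != o & j != tmp] else true.

Lemma does_hole o j s : j < size s -> o < size s -> tmp < size s ->
  j != o -> j != tmp -> o != tmp -> get s tmp = [::] ->
  does (print_hole o j) s (size (get s j) * 6 + 2)
    (fun l => if l == o then rev (dbl (get s j)) ++ get s o else get s l).
Proof.
move=> sj so st jo jt ot t0.
pose P u (g : nat -> seq bool) := exists2 v, get s j = v ++ u &
  forall l, g l = if l == j then [::] else if l == tmp then rev v else
                  if l == o then rev (dbl v) ++ get s o else get s l.
have [||||g d [v vE gE]] :=
  @does_for _ j (fun a => Seq (Push o a) (Seq (Push o a) (Push tmp a))) s 3 P.
- by [].
- by move=> u g g' e [v E h]; exists v => // l; rewrite -e h.
- exists [::] => // l; case: (l == j) => //; case: (eqVneq l tmp) => [-> //|_].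
  by case: (eqVneq l o) => [->|].
- move=> a u s1 z [v E h]; have so1 : o < size s1 by rewrite z.
  eexists.
    apply: (does_seq (n1 := 1) (n2 := 2) (does_push a so1)) => s2 z2 h2.
    have so2 : o < size s2 by rewrite z2.
    apply: (does_seq (n1 := 1) (does_push a so2)) => s3 z3 h3.
    have st3 : tmp < size s3 by rewrite z3 z2 z.
    by apply: does_ext (does_push a st3) (leqnn _) _ => l; rewrite !h3 !h2; reflexivity.
  exists (rcons v a); first by rewrite cat_rcons.
  move=> l; rewrite !h !eqxx; case: (eqVneq l tmp) => [->|_].
    by rewrite ?eqxx [tmp == o]eq_sym (negbTE ot) [tmp == j]eq_sym (negbTE jt) rev_rcons.
  case: (eqVneq l o) => [->|_] //.
  by rewrite ?eqxx [o == j]eq_sym (negbTE jo) (negbTE ot) -cats1 dbl_cat rev_cat.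
rewrite cats0 in vE.
apply: does_ext (does_seq (n2 := size (get s j) * 2 + 1) d _) _ (fun=> erefl); last by lia.
move=> s1 z1 h1; have st1 : tmp < size s1 by rewrite z1.
have sj1 : j < size s1 by rewrite z1.
apply: does_ext (does_move st1 sj1 _) _ _; first by rewrite eq_sym.
  by rewrite h1 gE eq_sym (negbTE jt) eqxx size_rev vE.
move=> l; rewrite !h1 !gE !eqxx [tmp == j]eq_sym (negbTE jt) revK cats0 -vE.
case: (eqVneq l tmp) => [->|_]; first by rewrite [tmp == o]eq_sym (negbTE ot) t0.
by case: (eqVneq l j) => [->|_] //; rewrite (negbTE jo).
Qed.

Definition item_size (it : titem) : nat := if it is TLit bs then (size bs).+1 else 6.

Definition items_size its : nat := (sumn (map item_size its)).+1.

Lemma does_print o its s H : o < size s -> tmp < size s -> o != tmp ->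
  get s tmp = [::] -> all (item_ok (size s) o) its ->
  all (fun it => if it is THole j then size (get s j) <= H else true) its ->
  does (print o its) s (items_size its * H.+1)
    (fun l => if l == o then rev (flatten (map (item_bits (get s)) its)) ++ get s o
              else get s l).
Proof.
move=> so st ot t0 ok; elim: its s so st t0 ok => [|it its IH] s so st t0 /=.
  move=> _ _; apply: does_ext (does_skip s) _ _ => // l; by case: eqP => // ->.
move=> /andP[ok1 ok2] /andP[h1 h2].
have d : does (print_item o it) s (item_size it * H.+1)
    (fun l => if l == o then rev (item_bits (get s) it) ++ get s o else get s l).
  case: it ok1 h1 => [bs|j] /= ok1 h1.
    by apply: does_ext (does_pushes bs so) _ _ => //; rewrite leq_pmulr.
  case/and3P: ok1 => sj jo jt.
  apply: does_ext (does_hole sj so st jo jt ot t0) _ (fun=> erefl).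
  by move: (size (get s j)) h1 => n h1; lia.
apply: does_ext (does_seq (n2 := items_size its * H.+1) d _) _ (fun=> erefl); last first.
  by rewrite /items_size /= -mulnDl addnS.
move=> s1 z1 g1; have ok2' : all (item_ok (size s1) o) its by rewrite z1.
have gj l : l != o -> get s1 l = get s l by move=> lo; rewrite g1 (negbTE lo).
have gh : all (fun it => if it is THole j then get s1 j == get s j else true) its.
  by apply: sub_all ok2 => - [//|j] /= /and3P[_ jo _]; rewrite gj.
have bE : map (item_bits (get s1)) its = map (item_bits (get s)) its.
  elim: its gh {IH ok2 h2 ok2'} => //= it' l IHl /andP[h /IHl ->]; congr cons.
  by case: it' h => //= j /eqP ->.
apply: does_ext (IH s1 _ _ _ ok2' _) _ _; rewrite ?z1 //.
- by rewrite gj // eq_sym.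
- elim: its h2 gh {IH ok2 ok2' bE} => //= it' l IHl /andP[h h2] /andP[gh gl].
  by rewrite IHl // andbT; case: it' h gh => //= j h /eqP ->.
- move=> l; rewrite bE !g1 eqxx; case: (eqVneq l o) => [_|_] //.
  by rewrite rev_cat catA.
Qed.

End Print.

(** [binc] stops at the first zero, whereas a loop runs through the whole stack; this is the
    increment as one pass with a carry. *)
Fixpoint carry_bits (c : bool) (s : seq bool) : bool * seq bool :=
  if s is a :: s' then
    let r := carry_bits (c && a) s' in (r.1, (a (+) c) :: r.2)
  else (c, [::]).

Lemma carry_false s : carry_bits false s = (false, s).
Proof. by elim: s => //= a s ->; rewrite addbF. Qed.

Lemma binc_carry s :
  let r := carry_bits true s in binc s = r.2 ++ (if r.1 then [:: true] else [::]).
Proof.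
elim: s => //= - [] s IH /=; first by rewrite IH.
by rewrite carry_false cats0.
Qed.

Lemma carry_rcons c s a :
  carry_bits c (rcons s a) =
  let r := carry_bits c s in (r.1 && a, rcons r.2 (a (+) r.1)).
Proof. by elim: s c => //= b s IH c; rewrite IH. Qed.

Lemma size_binc s : size (binc s) <= (size s).+1.
Proof. by elim: s => //= - [] u IH /=; rewrite ?ltnS. Qed.

Section Incr.
Variables (G : finType) (inj : bool -> G) (one : G -> bool).
Hypothesis oneK : cancel inj one.
Variables (tmp cf : nat).

(* [cf] is nonempty while a carry is pending *)
Definition incr j : prog G :=
  Seq (Push cf (inj true))
  (Seq (For j (fun a => Case cf (fun o =>
      if o is None then Push tmp a else if one a
      then Seq (Push tmp (inj false)) (Push cf (inj true)) else Push tmp (inj true))))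
  (Seq (Case cf (fun o => if o is None then Skip _ else Push tmp (inj true)))
       (move_to G tmp j))).

Lemma does_incr j s bs : get s j = map inj bs -> j < size s -> tmp < size s -> cf < size s ->
  j != tmp -> j != cf -> tmp != cf -> get s tmp = [::] -> get s cf = [::] ->
  does (incr j) s (size bs * 7 + 10)
    (fun l => if l == j then map inj (binc bs) else get s l).
Proof.
move=> gj sj st sc jt jc tc t0 c0.
have tj : (tmp == j) = false by rewrite eq_sym (negbTE jt).
have cj : (cf == j) = false by rewrite eq_sym (negbTE jc).
have ct : (cf == tmp) = false by rewrite eq_sym (negbTE tc).
have {}jt := negbTE jt; have {}jc := negbTE jc; have {}tc := negbTE tc.
pose st_at v c l := if l == j then [::] else if l == tmp then rev (map inj v) else
                    if l == cf then (if c then [:: inj true] else [::]) else get s l.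
apply: does_ext (does_seq (n2 := size bs * 7 + 9) (does_push (inj true) sc) _) _ (fun=> erefl);
  last by lia.
move=> s1 z1 h1.
have sj1 : j < size s1 by rewrite z1.
pose P u (g : nat -> seq G) := exists2 v, map inj bs = map inj v ++ u &
  g =1 st_at (carry_bits true v).2 (carry_bits true v).1.
have [||||g d [v vE gE]] := @does_for _ j (fun a => Case cf (fun o =>
      if o is None then Push tmp a else if one a
      then Seq (Push tmp (inj false)) (Push cf (inj true)) else Push tmp (inj true))) s1 3 P.
- by [].
- by move=> u g g' e [v E h]; exists v => // l; rewrite -e h.
- exists [::]; first by rewrite h1 jc gj.
  move=> l; rewrite h1 /st_at /=; case: (l == j) => //.
  case: (eqVneq l tmp) => [->|_]; first by rewrite tc t0.
  by case: (eqVneq l cf) => [_|] //; rewrite c0.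
- move=> a' u s2 z2 [v E h].
  have [a aE vE] : exists2 a, a' = inj a & map inj bs = map inj (rcons v a) ++ u.
    have nE : nth a' (map inj bs) (size v) = a'.
      by rewrite E nth_cat size_map ltnn subnn.
    have lt : size v < size bs.
      by rewrite -(size_map inj bs) E size_cat size_map /= addnS ltnS leq_addr.
    rewrite (nth_map true) // in nE; exists (nth true bs (size v)) => //.
    by rewrite E map_rcons cat_rcons nE.
  rewrite {a'}aE in E *.
  have st2 : tmp < size s2 by rewrite z2 z1.
  have sc2 : cf < size s2 by rewrite z2 z1.
  exists (st_at (carry_bits true (rcons v a)).2 (carry_bits true (rcons v a)).1); last first.
    by exists (rcons v a).
  rewrite carry_rcons /=; case cE: (carry_bits true v) h => [c v'] /= h.
  case: c cE h => cE h.
    apply: (does_pop (n := 2) (a := inj true) (u := [::])) => //.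
      by rewrite h /st_at cj ct eqxx.
    move=> s3 z3 h3; have st3 : tmp < size s3 by rewrite z3.
    rewrite oneK; case: a E vE => E vE.
      apply: (does_seq (n1 := 1) (does_push (inj false) st3)) => s4 z4 h4.
      have sc4 : cf < size s4 by rewrite z4 z3.
      apply: does_ext (does_push (inj true) sc4) (leqnn _) _ => l.
      rewrite !h4 !h3 !h /st_at eqxx ?tc ?ct ?tj ?cj ?eqxx map_rcons rev_rcons.
      case: (eqVneq l cf) => [->|lc]; first by rewrite cj ct.
      by case: (eqVneq l tmp) => [->|lt]; rewrite ?tj // (negbTE lc).
    apply: does_ext (does_push (inj true) st3) (isT : 1 <= 2) _ => l.
    rewrite !h3 !h /st_at ?tc ?tj eqxx map_rcons rev_rcons.
    case: (eqVneq l tmp) => [->|lt]; first by rewrite tj.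
    by case: (eqVneq l cf) => [->|lc]; rewrite ?cj.
  apply: does_empty; first by rewrite h /st_at cj ct eqxx.
  apply: does_ext (does_push (inj a) st2) (isT : 1 <= 2) _ => l.
  rewrite !h /st_at tj eqxx addbF map_rcons rev_rcons.
  by case: (eqVneq l tmp) => [->|lt]; rewrite ?tj.
rewrite cats0 in vE; have vE' : bs = v by apply: (inj_map (can_inj oneK)).
rewrite -vE' in gE.
apply: does_ext (does_seq (n2 := size bs * 3 + 7) d _) _ (fun=> erefl); last first.
  by rewrite h1 jc gj size_map; lia.
move=> s2 z2 h2; set r := carry_bits true bs in gE.
have st2 : tmp < size s2 by rewrite z2 z1.
have sc2 : cf < size s2 by rewrite z2 z1.
have d2 : does (Case cf (fun o => if o is None then Skip _ else Push tmp (inj true))) s2 2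
    (st_at (binc bs) false).
  have bE := binc_carry bs; rewrite /= -/r in bE.
  case rE: r.1 gE bE => gE bE.
    apply: (does_pop (n := 1) (a := inj true) (u := [::])) => //.
      by rewrite h2 gE /st_at cj ct eqxx.
    move=> s3 z3 h3; have st3 : tmp < size s3 by rewrite z3.
    apply: does_ext (does_push (inj true) st3) (leqnn _) _ => l.
    rewrite !h3 !h2 !gE /st_at tc tj eqxx bE map_cat rev_cat /=.
    case: (eqVneq l tmp) => [->|lt]; first by rewrite tj.
    by case: (eqVneq l cf) => [->|lc]; rewrite ?cj.
  apply: does_empty; first by rewrite h2 gE /st_at cj ct eqxx.
  apply: does_ext (does_skip s2) (leqnn _) _ => l.
  by rewrite h2 gE bE cats0.
apply: does_ext (does_seq (n2 := size bs * 2 + 5) d2 _) _ (fun=> erefl); last by lia.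
move=> s3 z3 h3.
have st3 : tmp < size s3 by rewrite z3 z2 z1.
have sj3 : j < size s3 by rewrite z3 z2.
apply: does_ext (does_move st3 sj3 _) _ _; first by rewrite tj.
  rewrite h3 /st_at tj eqxx size_rev size_map.
  by have := size_binc bs; lia.
move=> l; rewrite !h3 /st_at tj !eqxx revK cats0 ?jt.
case: (eqVneq l tmp) => [->|lt]; first by rewrite tj t0.
case: (eqVneq l j) => // lj.
by case: (eqVneq l cf) => [->|].
Qed.

End Incr.

Definition bincr : nat -> nat -> nat -> prog bool := @incr bool id id.

Lemma does_bincr tmp cf j (s : stacks bool) : j < size s -> tmp < size s -> cf < size s ->
  j != tmp -> j != cf -> tmp != cf -> get s tmp = [::] -> get s cf = [::] ->
  does (bincr tmp cf j) s (size (get s j) * 7 + 10)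
    (fun l => if l == j then binc (get s j) else get s l).
Proof.
move=> sj st sc jt jc tc t0 c0.
have := @does_incr bool id id (fun _ => erefl) tmp cf j s (get s j).
by rewrite !map_id; apply.
Qed.

Section Triples.
Variables (G : finType) (k : nat).
Implicit Types (p q : prog G) (P Q R : (nat -> seq G) -> Prop).

Definition triple p n P Q : Prop := forall s, size s = k -> P (get s) ->
  exists s', [/\ runs p s s' n, size s' = k & Q (get s')].

Lemma triple_seq p q n1 n2 P Q R :
  triple p n1 P Q -> triple q n2 Q R -> triple (Seq p q) (n1 + n2) P R.
Proof.
move=> h1 h2 s sk /(h1 s sk)[s1 [r1 z1 /(h2 s1 z1)[s2 [r2 z2 q2]]]].
by exists s2; split=> //; apply: runs_seq r1 r2.
Qed.

Lemma triple_conseq p n n' P Q P' Q' : triple p n P Q -> n <= n' ->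
  (forall g, P' g -> P g) -> (forall g, Q g -> Q' g) -> triple p n' P' Q'.
Proof.
move=> h le hP hQ s sk /hP/(h s sk)[s' [r z q]]; exists s'; split=> //.
  exact: runs_le r.
exact: hQ.
Qed.

Lemma triple_does p n P Q :
  (forall s, size s = k -> P (get s) ->
     exists2 g, does p s n g & forall g', g' =1 g -> Q g') -> triple p n P Q.
Proof.
move=> h s sk /(h s sk)[g [s' [r z e]] q]; exists s'; split=> //; first by rewrite z.
exact: q.
Qed.

Lemma triple_for j f c n P (Inv : seq G -> (nat -> seq G) -> Prop) : j < k ->
  (forall g, P g -> size (g j) <= n) ->
  (forall g g', P g -> (forall l, g' l = if l == j then [::] else g l) -> Inv (g j) g') ->
  (forall a u, triple (f a) c (Inv (a :: u)) (Inv u)) ->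
  triple (For j f) (n * c.+1 + 1) P (Inv [::]).
Proof.
move=> jk hn h0 hS s sk Ps.
have [||s' r [z q]] := @runs_for G j f s c (fun u s1 => size s1 = k /\ Inv u (get s1)).
- split; first by rewrite size_put ?sk.
  by apply: h0 Ps _ => l; rewrite get_put.
- move=> a u s1 [z1 /(hS a u s1 z1)[s2 [r2 z2 q2]]]; by exists s2.
exists s'; split=> //; apply: runs_le r.
by rewrite leq_add2r leq_mul2r hn ?orbT.
Qed.

End Triples.

Lemma rev_nseq_cat (T : Type) a c (x : T) : rev (nseq a x) ++ nseq c x = nseq (a + c) x.
Proof. by rewrite rev_nseq -nseqD. Qed.

(** * Computing polynomial bounds in unary *)

Section UnaryPoly.
Variables (A A2 S2 : nat).

(** In unary a number can serve directly as the range of a loop. *)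
Definition mult_step src : prog bool :=
  Seq (For A (fun _ => copy_to bool src A2 S2)) (move_to bool A2 A).

Fixpoint power_prog src e : prog bool :=
  if e is e'.+1 then Seq (power_prog src e') (mult_step src) else Push A true.

Definition poly_prog c e src dst : prog bool :=
  Seq (power_prog src e)
  (Seq (For A (fun _ => pushes dst (nseq c true))) (pushes dst (nseq c true))).

Variables (s : stacks bool) (src dst a : nat).
Hypotheses (sA : A < size s) (sA2 : A2 < size s) (sS2 : S2 < size s).
Hypotheses (ss : src < size s) (sd : dst < size s).
Hypothesis un : uniq [:: A; A2; S2; src; dst].
Hypotheses (gsrc : get s src = nseq a true) (gA : get s A = [::]).
Hypotheses (gA2 : get s A2 = [::]) (gS2 : get s S2 = [::]).

Let nA : [/\ (A == A2) = false, (A == S2) = false, (A == src) = false & (A == dst) = false].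
Proof.
move: un; rewrite /= !inE !negb_or -!andbA.
by move=> /and5P[/negbTE -> /negbTE -> /negbTE -> /negbTE ->].
Qed.
Let nA2 : [/\ (A2 == S2) = false, (A2 == src) = false & (A2 == dst) = false].
Proof.
move: un; rewrite /= !inE !negb_or -!andbA => /and5P[_ _ _ _].
by case/and4P => /negbTE -> /negbTE -> /negbTE ->.
Qed.
Let nS2 : [/\ (S2 == src) = false, (S2 == dst) = false & (src == dst) = false].
Proof.
move: un; rewrite /= !inE !negb_or -!andbA => /and5P[_ _ _ _].
by case/and5P => _ _ _ /negbTE -> /andP[/negbTE -> /andP[/negbTE -> _]].
Qed.

Let upA n l : seq bool := if l == A then nseq n true else get s l.

Lemma does_mult s1 c : size s1 = size s -> get s1 =1 upA c ->
  does (mult_step src) s1 (c * (a * 7 + 6) + 2) (upA (c * a)).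
Proof.
move=> z1 h1.
have [AA2 AS2 As Ad] := nA; have [A2S2 A2s A2d] := nA2; have [S2s S2d sd'] := nS2.
have sA1 : A < size s1 by rewrite z1.
have gs1 : get s1 src = nseq a true by rewrite h1 /upA eq_sym As.
pose st d l := if l == A then [::] else if l == A2 then nseq (d * a) true else get s l.
pose P (u : seq bool) (g : nat -> seq bool) := exists2 d, d + size u = c & g =1 st d.
have [||||g d [e eE gE]] := @does_for _ A (fun _ => copy_to bool src A2 S2) s1 (a * 5 + 2) P.
- by [].
- by move=> u g g' e [d E h]; exists d => // l; rewrite -e h.
- exists 0; first by rewrite h1 /upA eqxx size_nseq.
  move=> l; rewrite h1 /upA /st; case: (l == A) => //.
  by case: (eqVneq l A2) => [->|].
- move=> x u s2 z2 [d E h]; exists (st d.+1); last by exists d.+1 => //; rewrite addSnnS.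
  have gs2 : get s2 src = nseq a true.
    by rewrite h /st eq_sym As [src == A2]eq_sym A2s.
  apply: does_ext (does_copy _ _ _ _ _ _ _) _ _; rewrite ?z2 ?z1 ?[src == _]eq_sym ?A2s ?S2s ?A2S2 //.
  + by rewrite h /st eq_sym AS2 eq_sym A2S2.
  + by rewrite gs2 size_nseq.
  move=> l; rewrite gs2 !h /st eqxx [A2 == A]eq_sym AA2 rev_nseq_cat -mulSn.
  by case: (eqVneq l A2) => [->|_] //; rewrite eq_sym AA2.
have cE : size (get s1 A) = c by rewrite h1 /upA eqxx size_nseq.
rewrite cE in d; rewrite addn0 in eE; rewrite eE in gE.
apply: does_ext (does_seq (n2 := c * a * 2 + 1) d _) _ (fun=> erefl); last by nia.
move=> s2 z2 h2.
apply: does_ext (does_move _ _ _) _ _; rewrite ?z2 ?z1 // ?[A2 == A]eq_sym ?AA2 //.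
  by rewrite h2 gE /st eq_sym AA2 eqxx size_nseq.
move=> l; rewrite !h2 !gE /st /upA !eqxx [A2 == A]eq_sym AA2 cats0 rev_nseq.
case: (eqVneq l A2) => [->|_]; first by rewrite [A2 == A]eq_sym AA2 gA2.
by case: (eqVneq l A).
Qed.

Lemma does_power e :
  does (power_prog src e) s (e * (a.+1 ^ e * (a * 7 + 8)) + 1) (upA (a ^ e)).
Proof.
elim: e => [|e IH] /=.
  apply: does_ext (does_push true sA) _ _ => // l.
  by rewrite /upA gA.
apply: does_ext (does_seq IH (fun s1 z1 h1 => does_mult z1 h1)) _ _; last first.
  by move=> l; rewrite expnSr.
have h1 : a ^ e <= a.+1 ^ e by apply: leq_wexpn.
have h2 : 0 < a.+1 ^ e by rewrite expn_gt0.
rewrite expnS; nia.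
Qed.

Definition poly_cost c e n : nat :=
  e * (n.+1 ^ e * (n * 7 + 8)) + 1 + (n ^ e * c.+2 + 1 + c.+1).

Lemma does_poly c e : get s dst = [::] ->
  does (poly_prog c e src dst) s (poly_cost c e a)
    (fun l => if l == dst then nseq (poly c e a) true else get s l).
Proof.
move=> gd; have [AA2 AS2 As Ad] := nA.
apply: does_seq (does_power e) _ => s1 z1 h1.
have sA1 : A < size s1 by rewrite z1.
pose st d l := if l == A then [::] else if l == dst then nseq (d * c) true else get s l.
pose P (u : seq bool) (g : nat -> seq bool) := exists2 d, d + size u = a ^ e & g =1 st d.
have [||||g d [n nE gE]] := @does_for _ A (fun _ => pushes dst (nseq c true)) s1 c.+1 P.
- by [].
- by move=> u g g' q [d E h]; exists d => // l; rewrite -q h.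
- exists 0; first by rewrite h1 /upA eqxx size_nseq.
  move=> l; rewrite h1 /upA /st; case: (l == A) => //.
  by case: (eqVneq l dst) => [->|].
- move=> x u s2 z2 [d E h]; exists (st d.+1); last by exists d.+1 => //; rewrite addSnnS.
  have sd2 : dst < size s2 by rewrite z2 z1.
  apply: does_ext (does_pushes _ sd2) _ _; first by rewrite size_nseq.
  move=> l; rewrite !h /st eqxx [dst == A]eq_sym Ad rev_nseq_cat -mulSn.
  by case: (eqVneq l dst) => [->|_] //; rewrite eq_sym Ad.
have cE : size (get s1 A) = a ^ e by rewrite h1 /upA eqxx size_nseq.
rewrite cE in d; rewrite addn0 in nE; rewrite nE in gE.
apply: (does_seq d) => s2 z2 h2; have sd2 : dst < size s2 by rewrite z2 z1.
apply: does_ext (does_pushes _ sd2) _ _; first by rewrite size_nseq.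
move=> l; rewrite !h2 !gE /st eqxx [dst == A]eq_sym Ad rev_nseq_cat.
case: (eqVneq l dst) => [_|ld]; first by rewrite /poly addnC mulnC.
by case: (eqVneq l A) => [->|].
Qed.

End UnaryPoly.

(** * The reduction *)

Section Names.
Variable G : finType.
Implicit Types (p : prog G) (a : pred nat).

Fixpoint only a p : Prop :=
  match p with
  | Skip => True
  | Push i _ => a i
  | Seq p q => only a p /\ only a q
  | Case i f => a i /\ forall o, only a (f o)
  | For i f => a i /\ forall c, only a (f c)
  end.

Lemma only_avoids a j p : only a p -> ~~ a j -> avoids j p.
Proof.
have ne i : a i -> ~~ a j -> i != j by move=> ai; apply: contraNneq => <-.
elim: p => [|i b|p IHp q IHq|i f IH|i f IH] //=.
- by move=> *; apply: ne.
- by move=> [h1 h2] nj; split; [apply: IHp | apply: IHq].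
- by move=> [h1 h2] nj; split=> [|o]; [apply: ne | apply: IH].
- by move=> [h1 h2] nj; split=> [|o]; [apply: ne | apply: IH].
Qed.

Lemma only_mono a a' p : (forall l, a l -> a' l) -> only a p -> only a' p.
Proof.
move=> aa; elim: p => [|i b|p1 IH1 p2 IH2|i f IHf|i f IHf] //=; first exact: aa.
- by move=> [? ?]; split; [apply: IH1 | apply: IH2].
- by move=> [? ?]; split=> [|c]; [apply: aa | apply: IHf].
- by move=> [? ?]; split=> [|c]; [apply: aa | apply: IHf].
Qed.

Lemma only_pushes a o bs : a o -> only a (pushes o bs : prog G).
Proof. by move=> ao; elim: bs => //= b bs IH; split. Qed.

Lemma wf_pushes k o bs : o < k -> wf k (pushes o bs : prog G).
Proof. by move=> ok; elim: bs => //= b bs IH; split. Qed.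

Lemma wf_move k i j : i < k -> j < k -> i != j -> wf k (move_to G i j).
Proof. by move=> ik jk ij; split=> // a /=; rewrite eq_sym. Qed.

Lemma wf_copy k i j tmp : i < k -> j < k -> tmp < k -> i != j -> i != tmp ->
  wf k (copy_to G i j tmp).
Proof.
move=> ik jk tk ij it; split; last by apply: wf_move; rewrite 1?eq_sym.
by split=> // a; split; rewrite /= eq_sym.
Qed.

End Names.

Lemma print_names k tmp o its : tmp < k -> o < k -> o != tmp -> all (item_ok tmp k o) its ->
  wf k (print tmp o its) /\
  only (fun l => [|| l == tmp, l == o | has (fun it => if it is THole j then l == j else false) its])
    (print tmp o its).
Proof.
move=> tk ok ot; elim: its => //= it its IH /andP[h /IH[w1 o1]].
split; split=> //.
- case: it h {o1} => [bs|j] /= h; first exact: wf_pushes.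
  case/and3P: h => jk jo jt; split; last by apply: wf_move; rewrite 1?eq_sym.
  by split=> // a; rewrite /= ![_ == j]eq_sym.
- case: it h {o1} => [bs|j] /= h; first by apply: only_pushes; rewrite eqxx orbT.
  by do ![split; rewrite ?eqxx ?orbT //].
- by apply: only_mono o1 => l /or3P[->|->|->]; rewrite ?orbT.
Qed.

(** * Printing the circuit of a tableau *)

Section Generator.
Variable M : TM.
Notation Sg := (option (tQ M) * tG M * bool)%type.

Definition Rk (k : 'I_9) (w : {ffun 'I_4 -> Sg}) : bool :=
  let a := w (@Ordinal 4 0 isT) in let b := w (@Ordinal 4 1 isT) in
  let c := w (@Ordinal 4 2 isT) in let d := w (@Ordinal 4 3 isT) in
  match val k with
  | 0 => a == (None, tblank M, false)
  | 1 => (a.1.2 == tin M false) && ~~ a.2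
  | 2 => (a.1.2 == tin M true) && ~~ a.2
  | 3 => a.1.1 == Some (tstart M)
  | 4 => a.1.1 == None
  | 5 => witness_cell a b
  | 6 => a == (None, tblank M, true)
  | 7 => d == (local a.1 b.1 c.1, false)
  | _ => accept_cell a
  end.

Definition kLeft := @Ordinal 9 0 isT.
Definition kBit (b : bool) := if b then @Ordinal 9 2 isT else @Ordinal 9 1 isT.
Definition kStart := @Ordinal 9 3 isT.
Definition kNoHead := @Ordinal 9 4 isT.
Definition kWit := @Ordinal 9 5 isT.
Definition kRight := @Ordinal 9 6 isT.
Definition kStep := @Ordinal 9 7 isT.
Definition kAcc := @Ordinal 9 8 isT.

Variables (S : signature) (B : finAlgebra S) (z o : fcar B).
Variables (G : 'I_9 -> pterm (alg_of_fin B) (option ('I_4 * Sg))) (b : nat).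
Hypothesis G_size : forall k, size (comp (G k) 0).1 <= 2 ^ b.

(** Stacks 3 and 4 hold position and time in unary; 5 and 6 hold, in binary, the number of the
    current block and of the block two before it. By [bin_bits] and [bin_ones] an address is a
    literal followed by one of these counters. *)
Definition trefs (r : sref) : seq titem :=
  match r with
  | Loc q => [:: TLit (dbl (bits b q)); THole 5; TLit [:: false; true]]
  | Prev => [:: TLit (dbl (nseq b true)); THole 6; TLit [:: false; true]]
  end.

Definition tnode (nd : snode B ('I_4 * Sg)) : seq titem :=
  match nd with
  | SVar v =>
      [:: TLit (enc_nat 0 ++ dbl (nseq (dt v.1) true)); THole 4;
          TLit (dbl (false :: nseq (dp v.1) true)); THole 3;
          TLit (dbl (false :: nseq (enum_rank v.2).+1 true) ++ [:: false; true])]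
  | SConst c => [:: TLit (enc_nat 1 ++ enc_nat (enum_rank c))]
  | SGate f rs => TLit (enc_nat 2 ++ enc_nat (enum_rank f)) :: flatten (map trefs rs)
  end.

Definition node_ok (nd : snode B ('I_4 * Sg)) : bool :=
  if nd is SGate f rs then all (fun r => if r is Loc q then q < 2 ^ b else true) rs
  else true.

Lemma valid_refs k (C : seq (node S (fcar B))) : valid_nodes k C ->
  all (fun nd => if nd is NGate f l then all (fun i => i < k + size C) l else true) C.
Proof.
elim: C k => //= nd C IH k /andP[h1 h2]; have := IH _ h2; rewrite addSnnS => ->.
rewrite andbT; case: nd h1 => // f l /andP[_ h]; apply: sub_all h => i lt.
by apply: leq_trans lt _; apply: leq_addr.
Qed.

Lemma snodes_ok k : all node_ok (snodes G z b k).
Proof.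
rewrite /snodes; set n := size _; have nb : n <= blen b := G_size k.
rewrite all_cat; apply/andP; split; first by rewrite all_nseq orbT.
have sv : size (nseq (1 + (blen b - n)) z) = 1 + (blen b - n) by rewrite size_nseq.
(* Placed at the artificial base 1, just to extract from validity that all offsets stay inside the
   block. *)
have := comp_correct (fun=> 0) (fun=> z) (G k) sv (isT : 0 < 1).
have sc := comp_size (G k) (blen b - n) 0; rewrite -/n in sc.
case: (comp (G k) (blen b - n)) sc => ns r /= sn [_ /valid_refs + _].
rewrite all_map size_map sn; apply: sub_all => - [v|c|f rs] //=.
rewrite all_map; apply: sub_all => - [q|] //=.
by move: nb; rewrite /blen; lia.
Qed.

Lemma flatten_trefs (g : nat -> seq bool) i rs :
  g 5 = bin i -> g 6 = bin (i - 2) -> 0 < i ->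
  all (fun r => if r is Loc q then q < 2 ^ b else true) rs ->
  flatten (map (item_bits g) (flatten (map trefs rs))) =
  flatten (map enc_nat (map (aref (i * blen b) (tail b (i - 2))) rs)).
Proof.
move=> g5 g6 i0; elim: rs => //= r rs IH /andP[h /IH <-].
rewrite map_cat flatten_cat; congr cat; rewrite enc_natE.
case: r h => [q|] /= h; rewrite ?g5 ?g6 ?cats0.
  by rewrite bin_bits // dbl_cat catA.
by rewrite /tail bin_ones dbl_cat catA.
Qed.

Lemma tnode_correct (g : nat -> seq bool) t p i nd :
  g 3 = nseq p true -> g 4 = nseq t true -> g 5 = bin i -> g 6 = bin (i - 2) ->
  0 < i -> node_ok nd ->
  flatten (map (item_bits g) (tnode nd)) =
  enc_node (cnode (i * blen b) (tail b (i - 2)) (@var_name _ t p) nd).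
Proof.
move=> g3 g4 g5 g6 i0; case: nd => [[j x]|c|f rs] /= ok.
- rewrite g3 g4 cats0 [enc_nat (var_name _ _ _)]enc_natE bin_cell /cell_bits /=.
  have dc c u : dbl (c :: u) = [:: c; c] ++ dbl u by [].
  by rewrite [t + _]addnC [p + _]addnC !nseqD !(dc, dbl_cat) -!catA.
- by rewrite cats0.
- by rewrite (flatten_trefs g5 g6) // -!catA.
Qed.

Definition tmpl (k : 'I_9) : seq titem := flatten (map tnode (snodes G z b k)).

Lemma tmpl_correct (g : nat -> seq bool) t p i k :
  g 3 = nseq p true -> g 4 = nseq t true -> g 5 = bin i -> g 6 = bin (i - 2) ->
  0 < i ->
  flatten (map (item_bits g) (tmpl k)) =
  flatten (map (@enc_node S (fcar B)) (block G z b (@var_name _) i (k, t, p))).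
Proof.
move=> g3 g4 g5 g6 i0; rewrite /tmpl /block /=.
elim: (snodes G z b k) (snodes_ok k) => //= nd l IH /andP[h /IH <-].
by rewrite map_cat flatten_cat (tnode_correct g3 g4 g5 g6).
Qed.

Lemma tmpl_holes k (a : pred nat) : a 3 -> a 4 -> a 5 -> a 6 ->
  all (fun it => if it is THole j then a j else true) (tmpl k).
Proof.
move=> a3 a4 a5 a6; rewrite /tmpl; elim: (snodes G z b k) => //= nd l IH.
rewrite all_cat IH andbT; case: nd => [v|c|f rs] //=; first by rewrite a3 a4.
by elim: rs => //= - [q|] rs IHrs /=; rewrite ?a5 ?a6 IHrs.
Qed.

Definition half (k : 'I_9) : prog bool :=
  Seq (print 7 2 (tmpl k)) (Seq (bincr 7 8 5) (bincr 7 8 6)).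
(** Once for each of the two chains. *)
Definition emit (k : 'I_9) : prog bool := Seq (half k) (half k).

Definition tsize : nat := \max_(k : 'I_9) items_size (tmpl k).

(** [H] is a common bound for all counters of a run, so that costs need not follow their current
    values. *)
Definition half_cost (H : nat) : nat := tsize * H.+1 + (H * 7 + 10 + (H * 7 + 10)).

Definition bits_of_block i c : seq bool :=
  flatten (map (@enc_node S (fcar B)) (block G z b (@var_name _) i c)).

Lemma does_half s H t p i k : size s = 22 -> get s 7 = [::] -> get s 8 = [::] ->
  get s 3 = nseq p true -> get s 4 = nseq t true ->
  get s 5 = bin i -> get s 6 = bin (i - 2) -> 2 <= i ->
  t <= H -> p <= H -> i <= H ->
  does (half k) s (half_cost H)
    (fun l => if l == 2 then rev (bits_of_block i (k, t, p)) ++ get s 2 else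
              if l == 5 then bin i.+1 else if l == 6 then bin (i.+1 - 2) else get s l).
Proof.
move=> z1 g7 g8 g3 g4 g5 g6 i2 tH pH iH.
have sb n : n <= H -> size (bin n) <= H by move=> h; apply: leq_trans (size_bin n) h.
have d1 : does (print 7 2 (tmpl k)) s (tsize * H.+1)
   (fun l => if l == 2 then rev (bits_of_block i (k, t, p)) ++ get s 2 else get s l).
  apply: does_ext (@does_print 7 2 (tmpl k) s H _ _ _ g7 _ _) _ _; rewrite ?z1 //.
  - by have := tmpl_holes k (a := fun j => [&& j < 22, j != 2 & j != 7]) isT isT isT isT.
  - apply: tmpl_holes; rewrite ?g3 ?g4 ?g5 ?g6 ?size_nseq //; apply: sb => //.
    by lia.
  - by rewrite leq_mul2r; apply/orP; right; apply: (leq_bigmax (F := fun k => items_size (tmpl k)) k).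
  - by move=> l; rewrite (tmpl_correct k g3 g4 g5 g6) // ltnW.
apply: (does_seq d1) => s1 z2 h2.
have d2 : does (bincr 7 8 5) s1 (H * 7 + 10) (fun l => if l == 5 then bin i.+1 else get s1 l).
  apply: does_ext (@does_bincr 7 8 5 s1 _ _ _ _ _ _ _ _) _ _; rewrite ?z2 ?z1 ?h2 //=.
    rewrite g5; have := sb i iH; move: (size _) => n; lia.
  by move=> l; rewrite g5 binc_bin.
apply: (does_seq d2) => s2 z3 h3.
apply: does_ext (@does_bincr 7 8 6 s2 _ _ _ _ _ _ _ _) _ _; rewrite ?z3 ?z2 ?z1 ?h3 ?h2 //=.
  by rewrite g6; have := sb (i - 2) _; move: (size _) => n h; have := h ltac:(lia); lia.
move=> l; rewrite g6 binc_bin h3 h2 (_ : (i - 2).+1 = i.+1 - 2); last by lia.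
by case: (eqVneq l 6) => [->|_] //; case: (eqVneq l 5) => [->|_].
Qed.

Definition body cl : seq bool :=
  flatten (map (@enc_node S (fcar B)) (circ G z o b (@var_name _) cl)).

Lemma body_rcons cl c :
  body (rcons cl c) = body cl ++ bits_of_block (size cl).*2.+2 c ++
                      bits_of_block (size cl).*2.+3 c.
Proof.
by rewrite /body /circ blocks_rcons !map_cat !flatten_cat -!catA.
Qed.

(* [genf n Phi p t fr]: n constraints, together equivalent to [Phi], have been
   printed to stack 2; the head of the generator is at time t, position p. *)
Definition genf (n : nat) (Phi : (nat -> nat -> Sg) -> Prop) (p t : nat)
    (fr : nat -> seq bool) (g : nat -> seq bool) : Prop :=
  exists cl, [/\ size cl = n, forall F, tiles Rk F cl <-> Phi F, g 2 = rev (body cl),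
    [/\ g 3 = nseq p true, g 4 = nseq t true, g 5 = bin n.*2.+2, g 6 = bin n.*2 &
        g 7 = [::]] &
    g 8 = [::] /\ forall l, (l == 1) || (9 <= l) -> g l = fr l].

Lemma genf_conseq n n' (Phi Phi' : (nat -> nat -> Sg) -> Prop) p p' t t' fr fr' g :
  genf n Phi p t fr g -> n = n' -> (forall F, Phi F <-> Phi' F) -> p = p' -> t = t' ->
  (forall l, (l == 1) || (9 <= l) -> fr l = fr' l) -> genf n' Phi' p' t' fr' g.
Proof.
move=> [cl [h1 h2 h3 h4 [h5 h6]]] <- e <- <- ef; exists cl; split=> //.
  by move=> F; rewrite h2 e.
by split=> // l lh; rewrite h6 // ef.
Qed.

Variable H : nat.
Let EC := half_cost H + half_cost H.

Lemma triple_emit k n Phi p t fr : t <= H -> p <= H -> n.*2.+4 <= H ->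
  triple 22 (emit k) EC (genf n Phi p t fr)
    (genf n.+1 (fun F => Phi F /\ Rk k (window F t p)) p t fr).
Proof.
move=> tH pH nH; apply: triple_does => s sz [cl [e1 e2 e3 [e4 e5 e6 e7 e8] [e9 e10]]].
pose b1 := bits_of_block n.*2.+2 (k, t, p); pose b2 := bits_of_block n.*2.+3 (k, t, p).
exists (fun l => if l == 2 then rev b2 ++ rev b1 ++ get s 2 else
    if l == 5 then bin n.*2.+4 else if l == 6 then bin n.*2.+2 else get s l).
  apply: (does_seq (@does_half s H t p n.*2.+2 k sz e8 e9 e4 e5 e6 _ _ tH pH _)) => //.
  - by rewrite e7 subn2.
  - by lia.
  move=> s1 z1 h1.
  apply: does_ext (@does_half s1 H t p n.*2.+3 k _ _ _ _ _ _ _ _ _ _ _) _ _; rewrite ?z1 ?h1 //=.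
    by lia.
  move=> l; rewrite !h1 subn2 /=; case: (eqVneq l 2) => // l2.
  by case: (eqVneq l 5) => // l5; case: (eqVneq l 6).
move=> g gE; exists (rcons cl (k, t, p)); split; rewrite ?gE ?size_rcons ?e1 //=.
- move=> F; rewrite /tiles all_rcons -/(tiles Rk F cl) /=; split.
    by move=> /andP[h1 /e2].
  by move=> [/e2 -> ->].
- by rewrite e3 body_rcons e1 !rev_cat -!catA.
- split=> // l h; rewrite gE -e10 //.
  have [-> -> ->] // : [/\ (l == 2) = false, (l == 5) = false & (l == 6) = false].
  by split; lia.
Qed.

Lemma triple_pos n Phi p t fr :
  triple 22 (Push 3 true) 1 (genf n Phi p t fr) (genf n Phi p.+1 t fr).
Proof.
apply: triple_does => s sz [cl [e1 e2 e3 [e4 e5 e6 e7 e8] [e9 e10]]].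
eexists; first by apply: does_push; rewrite sz.
move=> g gE; exists cl; split=> //; rewrite ?gE //=; first by rewrite e4.
by split=> // l h; rewrite gE -e10 // (_ : (l == 3) = false) //; lia.
Qed.

Lemma triple_time n Phi p t fr :
  triple 22 (Push 4 true) 1 (genf n Phi p t fr) (genf n Phi p t.+1 fr).
Proof.
apply: triple_does => s sz [cl [e1 e2 e3 [e4 e5 e6 e7 e8] [e9 e10]]].
eexists; first by apply: does_push; rewrite sz.
move=> g gE; exists cl; split=> //; rewrite ?gE //=; first by rewrite e5.
by split=> // l h; rewrite gE -e10 // (_ : (l == 4) = false) //; lia.
Qed.

Definition setf (fr : nat -> seq bool) j (u : seq bool) l := if l == j then u else fr l.

Lemma triple_rewind j n Phi p t fr : 9 <= j -> j < 22 -> fr j = [::] ->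
  triple 22 (move_to bool 3 j) (p * 2 + 1) (genf n Phi p t fr)
    (genf n Phi 0 t (setf fr j (nseq p true))).
Proof.
move=> j9 j22 fj; apply: triple_does => s sz [cl [e1 e2 e3 [e4 e5 e6 e7 e8] [e9 e10]]].
have j3 : 3 != j by lia.
eexists.
  apply: does_ext (@does_move _ 3 j s _ _ j3) _ (fun=> erefl); rewrite ?sz //.
  by rewrite e4 size_nseq.
have jl m : m < 9 -> (m == j) = false by lia.
move=> g gE; exists cl; split; rewrite ?gE ?jl //=.
split=> // l h; rewrite gE /setf e4 (e10 j) ?j9 ?orbT // fj cats0 rev_nseq.
rewrite (_ : (l == 3) = false); last by lia.
by case: eqP => // _; apply: e10.
Qed.

Lemma genf_open j n Phi p t fr g g' : 9 <= j -> genf n Phi p t fr g ->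
  (forall l, g' l = if l == j then [::] else g l) ->
  genf n Phi p t (setf fr j [::]) g'.
Proof.
move=> j9 [cl [e1 e2 e3 [e4 e5 e6 e7 e8] [e9 e10]]] gE.
have jl m : m < 9 -> (m == j) = false by lia.
exists cl; split; rewrite ?gE ?jl //.
by split=> // l h; rewrite gE /setf; case: eqP => // _; apply: e10.
Qed.

Lemma triple_sweep j k n Phi p t fr w : 9 <= j -> j < 22 -> size (fr j) = w ->
  p + w <= H -> t <= H -> (n + w).*2.+4 <= H ->
  triple 22 (For j (fun _ => Seq (emit k) (Push 3 true))) (w * EC.+2 + 1)
    (genf n Phi p t fr)
    (genf (n + w)
       (fun F => Phi F /\ forall i, i < w -> Rk k (window F t (p + i)))
       (p + w) t (setf fr j [::])).
Proof.
move=> j9 j22 fj pH tH nH.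
pose Inv (u : seq bool) g := exists2 d, d + size u = w &
  genf (n + d) (fun F => Phi F /\ forall i, i < d -> Rk k (window F t (p + i)))
    (p + d) t (setf fr j [::]) g.
apply: triple_conseq (@triple_for _ 22 j _ EC.+1 w (genf n Phi p t fr) Inv j22 _ _ _) _ _ _ => //.
- by move=> g [cl [_ _ _ _ [_ e]]]; rewrite e ?j9 ?orbT // fj.
- move=> g g' Pg gE; have [cl [_ _ _ _ [_ e]]] := Pg.
  exists 0; first by rewrite e ?j9 ?orbT // fj.
  apply: genf_conseq (genf_open j9 Pg gE) _ _ _ _ _; rewrite ?addn0 // => F.
  by split=> [h|[]].
- move=> a u s sz [d E g].
  have t1 := @triple_emit k (n + d) _ (p + d) t (setf fr j [::]) tH _ _.
  have {t1}[||s1 [r1 z1 g1]] := t1 _ _ _ s sz g; [by rewrite /= in E; lia | by rewrite /= in E; lia | ].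
  have [s2 [r2 z2 g2]] := triple_pos z1 g1.
  exists s2; split=> //; first by apply: runs_le (runs_seq r1 r2); rewrite addn1.
  exists d.+1; first by rewrite addSnnS.
  apply: genf_conseq g2 _ _ _ _ _; rewrite ?addnS // => F; split.
    move=> [[hP hd] hr]; split=> // i; rewrite ltnS leq_eqVlt => /orP[/eqP -> //|].
    exact: hd.
  by move=> [hP hd]; split; [split=> // i id; apply: hd; apply: leqW | apply: hd].
- move=> g [d]; rewrite addn0 => ->; exact.
Qed.

(** Besides fixing the bit of one cell, this forbids the head on the cell after it, so the start
    cell is the only input cell with a head. *)
Definition emit_bit (c : bool) : prog bool :=
  Seq (emit (kBit c)) (Seq (Push 3 true) (emit kNoHead)).

Definition bits_written p (Phi : (nat -> nat -> Sg) -> Prop) (bs : seq bool)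
    (F : nat -> nat -> Sg) : Prop :=
  Phi F /\ forall i, i < size bs ->
    Rk (kBit (nth false bs i)) (window F 0 (p + i)) /\
    Rk kNoHead (window F 0 (p + i).+1).

Lemma triple_bit c n Phi p bs fr : p + (size bs).+1 <= H -> (n + 2).*2.+4 <= H ->
  triple 22 (emit_bit c) (EC + (1 + EC))
    (genf n (bits_written p Phi bs) (p + size bs) 0 fr)
    (genf (n + 2) (bits_written p Phi (rcons bs c)) (p + size (rcons bs c)) 0 fr).
Proof.
move=> pH nH; have pH1 : (p + size bs).+1 <= H by rewrite -addnS.
have nH1 : n.*2.+4 <= H by apply: leq_trans nH; rewrite !ltnS leq_double leq_addr.
have nH2 : n.+1.*2.+4 <= H by apply: leq_trans nH; rewrite !ltnS leq_double addn2.
apply: (triple_seq (@triple_emit (kBit c) n (bits_written p Phi bs) (p + size bs) 0 fr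
  (leq0n H) (ltnW pH1) nH1)).
apply: (triple_seq (@triple_pos _ _ _ _ _)).
apply: triple_conseq (@triple_emit kNoHead n.+1 (fun F => bits_written p Phi bs F /\
    Rk (kBit c) (window F 0 (p + size bs))) _ 0 fr (leq0n H) pH1 nH2) _ _ _ => //.
move=> g gE; apply: genf_conseq gE _ _ _ _ _; rewrite ?addn2 ?size_rcons ?addnS // => F.
rewrite /bits_written size_rcons; split.
  move=> [[[hP h] h1] h2]; split=> // i; rewrite ltnS leq_eqVlt => /orP[/eqP ->|ib].
    by rewrite nth_rcons ltnn eqxx.
  by rewrite nth_rcons ib; apply: h.
move=> [hP h]; have := h (size bs) (ltnSn _); rewrite nth_rcons ltnn eqxx => - [h1 h2].
split=> //; split=> //; split=> // i ib.
by have := h i (leqW ib); rewrite nth_rcons ib.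
Qed.

Lemma triple_input bs v n Phi p fr : fr 9 = v ->
  p + size bs + (size v).*2 <= H -> (n + (size v).*2.*2).*2.+4 <= H ->
  triple 22 (For 9 (fun c => Seq (emit_bit c) (emit_bit c)))
    (size v * (EC + (1 + EC) + (EC + (1 + EC))).+1 + 1)
    (genf n (bits_written p Phi bs) (p + size bs) 0 fr)
    (genf (n + (size v).*2.*2) (bits_written p Phi (bs ++ dbl v))
       (p + size (bs ++ dbl v)) 0 (setf fr 9 [::])).
Proof.
move=> fv pH nH.
pose Inv (u : seq bool) g := exists2 w, v = w ++ u &
  genf (n + (size w).*2.*2) (bits_written p Phi (bs ++ dbl w)) (p + size (bs ++ dbl w))
    0 (setf fr 9 [::]) g.
apply: triple_conseq (@triple_for _ 22 9 _ _ (size v)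
  (genf n (bits_written p Phi bs) (p + size bs) 0 fr) Inv _ _ _ _) (leqnn _) _ _ => //.
- by move=> g [cl [_ _ _ _ [_ e]]]; rewrite e // fv.
- move=> g g' Pg gE; have [cl [_ _ _ _ [_ e]]] := Pg.
  exists [::]; first by rewrite e.
  by rewrite cats0 addn0; apply: genf_open gE.
- move=> a u s sz [w vE g]; set bs1 := bs ++ dbl w in g.
  have lt : size w < size v by rewrite vE size_cat /= addnS ltnS leq_addr.
  have e1 : size bs1 = size bs + (size w).*2 by rewrite size_cat size_dbl.
  have pH1 : p + (size bs1).+1 <= H.
    by rewrite e1; move: (size v) (size w) (size bs) lt pH => n1 n2 n3; lia.
  have pH2 : p + (size (rcons bs1 a)).+1 <= H.
    by rewrite size_rcons e1; move: (size v) (size w) (size bs) lt pH => n1 n2 n3; lia.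
  have nH1 : (n + (size w).*2.*2 + 2).*2.+4 <= H.
    by move: (size v) (size w) lt nH => n1 n2; lia.
  have nH2 : (n + (size w).*2.*2 + 2 + 2).*2.+4 <= H.
    by move: (size v) (size w) lt nH => n1 n2; lia.
  have [s1 [r1 z1 g1]] := triple_bit a pH1 nH1 sz g.
  have [s2 [r2 z2 g2]] := triple_bit a pH2 nH2 z1 g1.
  exists s2; split=> //; first exact: runs_seq r1 r2.
  exists (rcons w a); first by rewrite cat_rcons.
  have -> : bs ++ dbl (rcons w a) = rcons (rcons bs1 a) a.
    by rewrite -cats1 dbl_cat -!cats1 -!catA.
  apply: genf_conseq g2 _ _ _ _ _ => //.
  by rewrite size_rcons; move: (size w) => n1; lia.
- by move=> g [w]; rewrite cats0 => <-.
Qed.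

Definition row_prog : prog bool :=
  Seq (For 17 (fun _ => Seq (emit kStep) (Push 3 true)))
      (Seq (move_to bool 3 17) (Push 4 true)).

Lemma triple_rows n Phi w d fr : fr 17 = nseq w true -> size (fr 16) = d ->
  w <= H -> d <= H -> (n + d * w).*2.+4 <= H ->
  triple 22 (For 16 (fun _ => row_prog)) (d * (w * EC.+2 + 1 + (w * 2 + 1 + 1)).+1 + 1)
    (genf n Phi 0 0 fr)
    (genf (n + d * w)
       (fun F => Phi F /\ forall t i, t < d -> i < w -> Rk kStep (window F t i))
       0 d (setf fr 16 [::])).
Proof.
move=> f17 f16 wH dH nH.
pose Inv (u : seq bool) g := exists2 t, t + size u = d &
  genf (n + t * w)
    (fun F => Phi F /\ forall t' i, t' < t -> i < w -> Rk kStep (window F t' i))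
    0 t (setf fr 16 [::]) g.
apply: triple_conseq (@triple_for _ 22 16 _ _ d (genf n Phi 0 0 fr) Inv _ _ _ _) (leqnn _) _ _ => //.
- by move=> g [cl [_ _ _ _ [_ e]]]; rewrite e // f16.
- move=> g g' Pg gE; have [cl [_ _ _ _ [_ e]]] := Pg.
  exists 0; first by rewrite e.
  apply: genf_conseq (genf_open _ Pg gE) _ _ _ _ _; rewrite ?addn0 // => F.
  by split=> [h|[]].
- move=> a u s sz [t tE g]; rewrite /= in tE.
  have td : t < d by rewrite -tE addnS ltnS leq_addr.
  have nH1 : (n + t * w + w).*2.+4 <= H by move: td nH; clear; nia.
  have f17' : size (setf fr 16 [::] 17) = w by rewrite /setf /= f17 size_nseq.
  have [s1 [r1 z1 g1]] := @triple_sweep 17 kStep _ _ 0 t (setf fr 16 [::]) w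
    isT isT f17' wH (ltnW (leq_trans td dH)) nH1 s sz g.
  have [s2 [r2 z2 g2]] := @triple_rewind 17 _ _ _ _ _ isT isT erefl s1 z1 g1.
  have [s3 [r3 z3 g3]] := triple_time z2 g2.
  exists s3; split=> //; first by apply: runs_seq r1 _; apply: runs_seq r2 r3.
  exists t.+1; first by rewrite addSnnS.
  apply: genf_conseq g3 _ _ _ _ _ => //.
  + by rewrite mulSn addnAC addnA.
  + move=> F; split=> [[[hP h] h']|[hP h]].
      split=> // t' i; rewrite ltnS leq_eqVlt => /orP[/eqP -> iw|]; last exact: h.
      by have := h' i iw; rewrite add0n.
    split; last by move=> i iw; rewrite add0n; apply: h.
    by split=> // t' i t't; apply: h; apply: leqW.
  + move=> l _; rewrite /setf add0n; case: (eqVneq l 17) => [->|_] //=.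
- by move=> g [t]; rewrite addn0 => ->.
Qed.

Definition size_items := [:: TLit (dbl (bits b 0)); THole 5; TLit [:: false; true]].
Definition out_items := [:: TLit (dbl (nseq b true)); THole 6; TLit [:: false; true]].

(** The number of nodes precedes the nodes in the code but is known only after they have been
    printed. It is therefore put on the output stack 1 now, and the nodes follow from stack 2 by way
    of 7, which keeps their order. The last push is the dummy top symbol that the compiled machine
    removes. *)
Definition final_prog : prog bool :=
  Seq (print 7 1 size_items) (Seq (move_to bool 2 7) (Seq (move_to bool 7 1)
  (Seq (print 7 1 out_items) (Seq (bincr 7 8 6) (Seq (print 7 1 out_items)
  (Push 1 true)))))).

Lemma instance_codeE cl :
  instance_code G z o b (@var_name _) cl =
  (dbl (bits b 0) ++ dbl (bin (size cl).*2.+2) ++ [:: false; true]) ++ body cl ++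
  (dbl (nseq b true) ++ dbl (bin (size cl).*2) ++ [:: false; true]) ++
  (dbl (nseq b true) ++ dbl (bin (size cl).*2.+1) ++ [:: false; true]).
Proof.
rewrite /instance_code /enc_instance size_circ // -/(body cl) !enc_natE.
rewrite -[_ * blen b]addn0 bin_bits ?expn_gt0 // !bin_ones !dbl_cat.
by rewrite -!catA.
Qed.

Definition final_cost N : nat :=
  items_size size_items * H.+1 + (N * 2 + 1 + (N * 2 + 1 + (items_size out_items * H.+1 +
  (H * 7 + 10 + (items_size out_items * H.+1 + 1))))).

Lemma does_final s cl N : size s = 22 -> get s 1 = [::] -> get s 2 = rev (body cl) ->
  get s 5 = bin (size cl).*2.+2 -> get s 6 = bin (size cl).*2 -> get s 7 = [::] ->
  get s 8 = [::] -> (size cl).*2.+2 <= H -> size (body cl) <= N ->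
  exists2 g, does final_prog s (final_cost N) g &
    g 1 = true :: rev (instance_code G z o b (@var_name _) cl).
Proof.
move=> sz e1 e2 e5 e6 e7 e8 nH bN.
have sb n : n <= H -> size (bin n) <= H by move=> h; apply: leq_trans (size_bin n) h.
pose n := size cl; rewrite -/n in e5 e6 nH.
pose hd := dbl (bits b 0) ++ dbl (bin n.*2.+2) ++ [:: false; true].
pose o1 i := dbl (nseq b true) ++ dbl (bin i) ++ [:: false; true].
pose fin := true :: rev (hd ++ body cl ++ o1 n.*2 ++ o1 n.*2.+1).
exists (fun l => if l == 1 then fin else if l == 2 then [::] else
    if l == 6 then bin n.*2.+1 else get s l); last by rewrite instance_codeE.
apply: does_seq (does_print (H := H) _ _ _ _ _ _) _; rewrite ?sz //=.
  by rewrite e5 andbT; apply: sb.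
move=> s1 z1 h1; rewrite /= e5 e1 cats0 -/hd in h1.
apply: does_seq (does_ext (does_move _ _ _) _ (fun=> erefl)) _; rewrite ?z1 ?sz //.
  by rewrite h1 /= e2 size_rev leq_add2r leq_mul2r bN.
move=> s2 z2 h2; rewrite !h1 /= e2 e7 revK cats0 in h2.
apply: does_seq (does_ext (does_move _ _ _) _ (fun=> erefl)) _; rewrite ?z2 ?z1 ?sz //.
  by rewrite h2 /= leq_add2r leq_mul2r bN.
move=> s3 z3 h3.
have {h1 h2 h3} H3 l : get s3 l = if l == 1 then rev (body cl) ++ rev hd else
    if l == 2 then [::] else get s l.
  rewrite h3 !h2 !h1 /=; case: (eqVneq l 7) => [-> //|_]; by case: (eqVneq l 1).
have sb6 : size (bin n.*2) <= H by apply: sb; lia.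
apply: does_seq (does_print (H := H) _ _ _ _ _ _) _; rewrite ?z3 ?H3 //=.
  by rewrite H3 /= e6 sb6.
move=> s4 z4 h4.
have {h4} H4 l : get s4 l = if l == 1 then rev (o1 n.*2) ++ rev (body cl) ++ rev hd else
    if l == 2 then [::] else get s l.
  by rewrite h4 !H3 /= e6; case: (eqVneq l 1).
apply: does_seq (does_ext (@does_bincr 7 8 6 s4 _ _ _ _ _ _ _ _) _ (fun=> erefl)) _;
  rewrite ?z4 ?H4 //=.
  by rewrite e6; move: (size (bin n.*2)) sb6 => q; lia.
move=> s5 z5 h5.
have {h5} H5 l : get s5 l = if l == 6 then bin n.*2.+1 else
    if l == 1 then rev (o1 n.*2) ++ rev (body cl) ++ rev hd else
    if l == 2 then [::] else get s l.
  by rewrite h5 !H4 /= e6 binc_bin.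
have sb7 : size (get s5 6) <= H by rewrite H5 eqxx; apply: sb; lia.
apply: does_seq (does_print (H := H) _ _ _ _ _ _) _; rewrite ?z5 //; try by rewrite H5.
  by rewrite /= sb7.
move=> s6 z6 h6; apply: does_ext (does_push true _) (leqnn _) _; first by rewrite z6.
move=> l; rewrite !h6; case: (eqVneq l 1) => [_|l1].
  have g6 : get s5 6 = bin n.*2.+1 by rewrite H5.
  have -> : flatten (map (item_bits (get s5)) out_items) = o1 n.*2.+1.
    by rewrite /o1 -g6 /= .
  by rewrite H5 /fin !rev_cat -!catA.
rewrite H5 (negbTE l1); case: (eqVneq l 6) => [->|_] //.
Qed.

Section Main.
Variables (x : seq bool) (c1 k1 cM kM : nat).

Definition wit_len n : nat := poly c1 k1 n.
Definition in_len n : nat := n.*2 + 2 + wit_len n.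
Definition time_len n : nat := poly cM kM (in_len n).

Let n := size x.
Let m := wit_len n.
Let D := time_len n.

Definition empty_st : nat -> seq bool := fun=> [::].
Definition prep0 := setf empty_st 0 (rev x).
Definition prep1 := setf (setf empty_st 9 x) 10 (nseq n true).
Definition prep2 := setf prep1 11 (nseq m true).
Definition prep3 := setf prep2 18 (nseq (in_len n) true).
(** A loop consumes its range, so there is one copy of [D] for each loop: two for the left margin,
    two for the right one, one for the rows. *)
Definition prep4 := setf (setf (setf (setf (setf prep3 12 (nseq D true))
  13 (nseq D true)) 14 (nseq D true)) 15 (nseq D true)) 16 (nseq D true).

Notation holds f := (fun g : nat -> seq bool => g =1 f).

Lemma triple_read :
  triple 22 (For 0 (fun a => Seq (Push 9 a) (Push 10 true))) (n * 3 + 1)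
    (holds prep0) (holds prep1).
Proof.
pose Inv (u : seq bool) (g : nat -> seq bool) := exists2 v, rev x = v ++ u &
  g =1 setf (setf empty_st 9 (rev v)) 10 (nseq (size v) true).
apply: triple_conseq (@triple_for _ 22 0 _ 2 n (holds prep0) Inv _ _ _ _) (leqnn _) _ _ => //.
- by move=> g ->; rewrite size_rev.
- move=> g g' gE g'E; exists [::]; first by rewrite gE.
  by move=> l; rewrite g'E gE /prep0 /setf; do 3?[case: eqP => [->|_] //].
- move=> a u; apply: triple_does => s sz [v vE sE].
  have s9 : 9 < size s by rewrite sz.
  exists (setf (setf empty_st 9 (rev (rcons v a))) 10 (nseq (size (rcons v a)) true)).
    apply: (does_seq (n1 := 1) (does_push a s9)) => s1 z1 h1.
    have s10 : 10 < size s1 by rewrite z1 sz.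
    apply: does_ext (does_push true s10) (leqnn _) _ => l.
    rewrite !h1 !sE /setf /= rev_rcons size_rcons.
    by case: (eqVneq l 10) => // l10; case: (eqVneq l 9).
  move=> g gE; exists (rcons v a) => //; by rewrite cat_rcons.
- move=> g [v]; rewrite cats0 => <- gE l.
  by rewrite gE revK size_rev.
Qed.

Lemma triple_poly c e src dst f a : src < 22 -> dst < 22 ->
  uniq [:: 19; 20; 21; src; dst] -> f src = nseq a true -> f 19 = [::] ->
  f 20 = [::] -> f 21 = [::] -> f dst = [::] ->
  triple 22 (poly_prog 19 20 21 c e src dst) (poly_cost c e a) (holds f)
    (holds (setf f dst (nseq (poly c e a) true))).
Proof.
move=> hs hd un e1 e2 e3 e4 e5; apply: triple_does => s sz sE.
eexists.
  by apply: (does_poly (s := s) (a := a) _ _ _ _ _ un); rewrite ?sz ?sE.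
by move=> g gE l; rewrite gE /setf !sE.
Qed.

Lemma triple_copy src dst f a c : src < 22 -> dst < 22 -> uniq [:: src; dst; 7] ->
  f src = nseq a true -> f dst = nseq c true -> f 7 = [::] ->
  triple 22 (copy_to bool src dst 7) (a * 5 + 2) (holds f)
    (holds (setf f dst (nseq (a + c) true))).
Proof.
move=> hs hd; rewrite /= !inE negb_or andbT => /andP[/andP[u1 u2] u3] e1 e2 e3.
apply: triple_does => s sz sE; eexists.
  apply: does_ext (does_copy _ _ _ u1 u2 u3 _) _ (fun=> erefl); rewrite ?sz ?sE //.
  by rewrite e1 size_nseq.
by move=> g gE l; rewrite gE /setf !sE e1 e2 rev_nseq_cat.
Qed.

Lemma triple_lit o' f bs : o' < 22 ->
  triple 22 (pushes o' bs) (size bs).+1 (holds f) (holds (setf f o' (rev bs ++ f o'))).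
Proof.
move=> ho; apply: triple_does => s sz sE; eexists.
  by apply: does_pushes; rewrite sz.
by move=> g gE l; rewrite gE /setf !sE.
Qed.

Definition pp := poly_prog 19 20 21.

(** The last two steps print the constant blocks 0 and 1 and start the block counters at 2 and 0:
    pushing one and then zero leaves [bin 2] on stack 5, and the empty stack 6 is [bin 0]. *)
Definition prep_prog : prog bool :=
  Seq (For 0 (fun a => Seq (Push 9 a) (Push 10 true)))
  (Seq (pp c1 k1 10 11)
  (Seq (copy_to bool 10 18 7) (Seq (copy_to bool 10 18 7) (Seq (copy_to bool 11 18 7)
  (Seq (pushes 18 [:: true; true])
  (Seq (pp cM kM 18 12) (Seq (pp cM kM 18 13) (Seq (pp cM kM 18 14)
  (Seq (pp cM kM 18 15) (Seq (pp cM kM 18 16)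
  (Seq (pushes 2 (body [::])) (pushes 5 [:: true; false])))))))))))).

Definition prep_cost n : nat :=
  let pM := poly_cost cM kM (in_len n) in
  n * 3 + 1 + (poly_cost c1 k1 n + (n * 5 + 2 + (n * 5 + 2 + (wit_len n * 5 + 2 + (3 +
  (pM + (pM + (pM + (pM + (pM + ((size (body [::])).+1 + 3))))))))))).

Lemma triple_prep :
  triple 22 prep_prog (prep_cost n) (holds prep0) (genf 0 (fun=> True) 0 0 prep4).
Proof.
apply: (triple_seq triple_read).
apply: (triple_seq (@triple_poly c1 k1 10 11 _ n _ _ _ _ _ _ _ _)) => //.
apply: (triple_seq (@triple_copy 10 18 _ n 0 _ _ _ _ _ _)) => //.
apply: (triple_seq (@triple_copy 10 18 _ n (n + 0) _ _ _ _ _ _)) => //.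
apply: (triple_seq (@triple_copy 11 18 _ m (n + (n + 0)) _ _ _ _ _ _)) => //.
apply: (triple_seq (n1 := 3) (Q := holds prep3)).
  apply: triple_conseq (@triple_lit 18 _ [:: true; true] _) (leqnn _) (fun g h => h) _ => // g gE l.
  have nE : in_len n = (m + (n + (n + 0))).+2 by rewrite /in_len -/m; lia.
  by rewrite gE /prep3 nE /prep2 /setf /=; case: (l == 18).
do 5![apply: (triple_seq (@triple_poly cM kM 18 _ _ (in_len n) _ _ _ _ _ _ _ _)) => //].
apply: (triple_seq (@triple_lit 2 _ (body [::]) _)) => //.
apply: triple_conseq (@triple_lit 5 _ [:: true; false] _) (leqnn _) (fun g h => h) _ => // g gE.
exists [::]; split; rewrite ?gE //=.
- by rewrite /setf /= cats0.
- split=> // l /orP[/eqP -> //|l9]; rewrite gE /setf /prep4 /setf.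
  by rewrite (_ : (l == 5) = false) 1?(_ : (l == 2) = false) //; lia.
Qed.

Let L := size (dbl x ++ [:: false; true]).
Let W := 2 * D + L + m + (2 * D).+1.
(** The number of constraints on row 0. Each input bit appears twice with two constraints per copy,
    hence four times [n]; the two summands 2 belong to the separator, and the last 1 is the odd cell
    of the right margin. *)
Let row0 := D + D + 1 + n.*2.*2 + 2 + 2 + m + D + D + 1.
Hypothesis HH : W + D + (row0 + D * W + W).*2.+4 <= H.

Definition sweep j k : prog bool := For j (fun _ => Seq (emit k) (Push 3 true)).

Definition main_prog : prog bool :=
  Seq (sweep 12 kLeft) (Seq (sweep 13 kLeft) (Seq (emit kStart)
  (Seq (For 9 (fun c => Seq (emit_bit c) (emit_bit c)))
  (Seq (emit_bit false) (Seq (emit_bit true) (Seq (sweep 11 kWit)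
  (Seq (sweep 14 kRight) (Seq (sweep 15 kRight) (Seq (emit kRight) (Seq (Push 3 true)
  (Seq (move_to bool 3 17) (Seq (For 16 (fun _ => row_prog)) (sweep 17 kAcc))))))))))))).

Definition main_cost (n m D W : nat) : nat :=
  let sw w := w * EC.+2 + 1 in let eb := EC + (1 + EC) in
  sw D + (sw D + (EC + (n * (eb + eb).+1 + 1 + (eb + (eb + (sw m + (sw D + (sw D +
  (EC + (1 + (W * 2 + 1 + (D * (sw W + (W * 2 + 1 + 1)).+1 + 1 + sw W)))))))))))).

Lemma window_at (F : nat -> nat -> Sg) t p :
  [/\ window F t p (@Ordinal 4 0 isT) = F t p, window F t p (@Ordinal 4 1 isT) = F t p.+1,
      window F t p (@Ordinal 4 2 isT) = F t p.+2 &
      window F t p (@Ordinal 4 3 isT) = F t.+1 p.+1].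
Proof. by rewrite !ffunE /= !addn0 addn1 addn2 addn1. Qed.

Lemma RkE (F : nat -> nat -> Sg) t p :
  ((Rk kLeft (window F t p) = (F t p == (None, tblank M, false))) *
   (Rk kStart (window F t p) = ((F t p).1.1 == Some (tstart M))) *
   (Rk kNoHead (window F t p) = ((F t p).1.1 == None)) *
   (Rk kWit (window F t p) = witness_cell (F t p) (F t p.+1)) *
   (Rk kRight (window F t p) = (F t p == (None, tblank M, true))) *
   (Rk kStep (window F t p) =
     (F t.+1 p.+1 == (local (F t p).1 (F t p.+1).1 (F t p.+2).1, false))) *
   (Rk kAcc (window F t p) = accept_cell (F t p)))%type *
  (forall c, Rk (kBit c) (window F t p) = ((F t p).1.2 == tin M c) && ~~ (F t p).2).
Proof.
have [w0 w1 w2 w3] := window_at F t p.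
by do ![split]; try (case; rewrite /Rk /kBit); rewrite /Rk /= ?w0 ?w1 ?w2 ?w3.
Qed.

Lemma triple_main : exists2 fr,
  triple 22 main_prog (main_cost n m D W) (genf 0 (fun=> True) 0 0 prep4)
    (genf (row0 + D * W + W) (tableau x D m) W D fr) & fr 1 = [::].
Proof.
have LE : L = n.*2 + 2 by rewrite /L size_cat size_dbl.
have WE : W = 2 * D + L + m + (2 * D).+1 by [].
have hW : W <= H by move: HH; lia.
have hD : D <= H by move: HH; lia.
have hn k : k <= row0 + D * W + W -> k.*2.+4 <= H by move: HH; lia.
eexists.
  apply: (triple_seq (@triple_sweep 12 kLeft 0 _ 0 0 prep4 D _ _ _ _ _ _)) => //.
  - by rewrite size_nseq.
  - by apply: hn; rewrite /row0; lia.
  apply: (triple_seq (@triple_sweep 13 kLeft _ _ (0 + D) 0 _ D _ _ _ _ _ _)) => //.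
  - by rewrite size_nseq.
  - by lia.
  - by apply: hn; rewrite /row0; lia.
  apply: (triple_seq (@triple_emit kStart _ _ (0 + D + D) 0 _ _ _ _)) => //.
  - by lia.
  - by apply: hn; rewrite /row0; lia.
  pose phi3 F := ((True /\ forall i, i < D -> Rk kLeft (window F 0 (0 + i))) /\
      forall i, i < D -> Rk kLeft (window F 0 (0 + D + i))) /\
    Rk kStart (window F 0 (0 + D + D)).
  pose fr3 := setf (setf prep4 12 [::]) 13 [::].
  apply: (triple_seq (n1 := n * (EC + (1 + EC) + (EC + (1 + EC))).+1 + 1)
    (Q := genf ((0 + D + D).+1 + n.*2.*2) (bits_written (D + D) phi3 (dbl x))
            (D + D + size (dbl x)) 0 (setf fr3 9 [::]))).
    apply: triple_conseq (@triple_input [::] x (0 + D + D).+1 phi3 (D + D) fr3 _ _ _)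
      (leqnn _) _ (fun g h => h).
    + by [].
    + by rewrite -/n /= addn0; lia.
    + by apply: (hn ((0 + D + D).+1 + (size x).*2.*2)); rewrite -/n /row0; lia.
    move=> g gE; apply: genf_conseq gE _ _ _ _ _ => //.
      by move=> F; split=> [h|[h _]]; [split | exact: h].
    by rewrite addn0.
  apply: (triple_seq (@triple_bit false _ _ _ (dbl x) _ _ _)).
  - by rewrite size_dbl -/n; lia.
  - by apply: hn; rewrite -/n /row0; lia.
  apply: (triple_seq (@triple_bit true _ _ _ (rcons (dbl x) false) _ _ _)).
  - by rewrite size_rcons size_dbl -/n; lia.
  - by apply: hn; rewrite -/n /row0; lia.
  pose y0 := rcons (rcons (dbl x) false) true.
  have y0E : y0 = dbl x ++ [:: false; true] by rewrite /y0 -!cats1 -catA.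
  have y0L : size y0 = L by rewrite y0E.
  rewrite -/y0 y0L.
  apply: (triple_seq (@triple_sweep 11 kWit _ _ _ 0 _ m _ _ _ _ _ _)) => //.
  - by rewrite size_nseq.
  - by lia.
  - by apply: hn; rewrite /row0; lia.
  apply: (triple_seq (@triple_sweep 14 kRight _ _ _ 0 _ D _ _ _ _ _ _)) => //.
  - by rewrite size_nseq.
  - by lia.
  - by apply: hn; rewrite /row0; lia.
  apply: (triple_seq (@triple_sweep 15 kRight _ _ _ 0 _ D _ _ _ _ _ _)) => //.
  - by rewrite size_nseq.
  - by lia.
  - by apply: hn; rewrite /row0; lia.
  apply: (triple_seq (@triple_emit kRight _ _ _ 0 _ _ _ _)) => //.
  - by lia.
  - by apply: hn; rewrite /row0; lia.
  apply: (triple_seq (@triple_pos _ _ _ _ _)).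
  have pW : (D + D + L + m + D + D).+1 = W by rewrite WE; lia.
  rewrite pW.
  apply: (triple_seq (@triple_rewind 17 _ _ _ _ _ _ _ _)) => //.
  apply: (triple_seq (@triple_rows _ _ W D _ _ _ _ _ _)) => //.
  - by rewrite /setf /= size_nseq.
  - by apply: hn; rewrite /row0; lia.
  apply: triple_conseq (@triple_sweep 17 kAcc _ _ 0 D _ W _ _ _ _ _ _) (leqnn _) (fun g h => h) _ => //.
  - by rewrite /setf /= size_nseq.
  - by apply: hn; rewrite /row0; lia.
  move=> g gE; apply: genf_conseq gE _ _ _ _ (fun l _ => erefl); rewrite ?add0n //.
    by rewrite /row0; lia.
  move=> F; split.
  + move=> [[[[[[[[[[_ hl1] hl2] hs] hb] hw] hr1] hr2] hr3] hst] hac].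
    rewrite !RkE in hs hr3; rewrite y0L in hb.
    split.
    * move=> p pD; case: (ltnP p D) => h.
        by have := hl1 p h; rewrite RkE => /eqP.
      have h2 : p - D < D by lia.
      by have := hl2 _ h2; rewrite RkE (_ : 0 + D + (p - D) = p) => [/eqP //|]; lia.
    * by rewrite mul2n -addnn; apply/eqP.
    * rewrite -/L -y0E => i iL; have [] := hb i iL; rewrite !RkE mul2n -addnn.
      by move=> /andP[/eqP -> /negbTE ->] /eqP ->.
    * by move=> i im; have := hw i im; rewrite RkE mul2n -addnn.
    * rewrite -/L mul2n -addnn => i; rewrite ltnS => iD.
      case: (ltnP i D) => h1; first by have := hr1 i h1; rewrite RkE => /eqP.
      case: (ltnP (i - D) D) => h2.
        have := hr2 _ h2; rewrite RkE => /eqP <-; congr (F 0 _); lia.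
      by move/eqP: hr3 => <-; congr (F 0 _); lia.
    * by move=> t p tD pW'; have := hst t p tD pW'; rewrite RkE => /eqP.
    * by move=> p pW'; have := hac p pW'; rewrite RkE.
  + case; rewrite -/L mul2n -addnn -y0E => hl hs hb hw hr hst hac.
    have p1 : phi3 F.
      split; last by rewrite RkE add0n hs.
      by split; [split=> // i iD | move=> i iD]; rewrite RkE hl //; lia.
    have p2 : bits_written (D + D) phi3 y0 F.
      split=> // i; rewrite y0L => iL; have [h1 h2 h3] := hb i iL.
      by rewrite !RkE h1 h2 h3 !eqxx.
    have p3 i : i < m -> Rk kWit (window F 0 (D + D + L + i)) by rewrite RkE; apply: hw.
    have p4 i : i < D -> Rk kRight (window F 0 (D + D + L + m + i)).
      by move=> iD; rewrite RkE hr //; lia.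
    have p5 i : i < D -> Rk kRight (window F 0 (D + D + L + m + D + i)).
      by move=> iD; rewrite RkE -[_ + D + i]addnA hr //; lia.
    have p6 : Rk kRight (window F 0 (D + D + L + m + D + D)).
      by rewrite RkE -[_ + D + D]addnA hr //; lia.
    split; last by move=> i iW; rewrite RkE; apply: hac; move: iW; rewrite add0n WE; lia.
    split; first by split; [split; [split; [split | ] | ] | ].
    by move=> t i tD iW; rewrite RkE; apply/eqP/hst => //; move: iW; rewrite WE; lia.
by [].
Qed.

End Main.

End Generator.

(** A step adds at most one symbol. This bounds the size of the printed circuit by the time spent on
    it. *)
Lemma total_eval (G : finType) k (p : prog G) s : wf k p -> size s = k ->
  total (eval p s) <= total s + cost p s.
Proof.
elim: p s => [|i a|p IHp q IHq|i f IH|i f IH] s /=.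
- by rewrite leq_addr.
- move=> ik sk; have := @total_put _ s i (a :: get s i); rewrite sk => /(_ ik) /=.
  by move: (total _) (total _) (size _) => a1 a2 a3; lia.
- move=> [hp hq] sk; apply: leq_trans (IHq _ hq (size_eval hp sk)) _.
  by rewrite addnA leq_add2r; apply: IHp.
- move=> [ik hf] sk; case E: (get s i) => [|a u].
    by apply: leq_trans (IH _ _ (hf _) sk) _; rewrite leq_add2l.
  apply: leq_trans (IH _ _ (hf _) _) _; first by rewrite size_put sk.
  have := @total_put _ s i u; rewrite sk => /(_ ik); rewrite E /=.
  by move: (total _) (total _) (size _) (cost _ _) => a1 a2 a3 a4; lia.
- move=> [ik hf _] sk; rewrite -/(loop_step f).
  have : total (put s i [::]) <= total s.
    have := @total_put _ s i [::]; rewrite sk => /(_ ik) /=.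
    by move: (total _) (total _) (size _) => a1 a2 a3; lia.
  have : size (put s i [::]) = k by rewrite size_put sk.
  elim: (get s i) (put s i [::]) (total s) 1 => [|a u IHu] s0 T c sk0 hT /=.
    by apply: leq_trans hT _; rewrite leq_addr.
  have h := IH a s0 (hf a) sk0.
  have := IHu _ (T + (cost (f a) s0)) c (size_eval (hf a) sk0) _.
  move/(_ (leq_trans h _)); rewrite leq_add2r => /(_ hT) h2.
  apply: leq_trans h2 _.
  rewrite -[loop_step f _ a]/(c + (cost (f a) s0).+1, eval (f a) s0).
  rewrite [c + _]addnC loop_cost.
  by move: (foldl _ (c, _) _).1 => n; lia.
Qed.

Lemma poly_bounded_poly_cost c e f : poly_bounded f ->
  poly_bounded (fun n => poly_cost c e (f n)).
Proof. by move=> bf; rewrite /poly_cost; pbound. Qed.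

(** * Cost and correctness of the generator *)

Section Hardness.
Variable M : TM.
Notation Sg := (option (tQ M) * tG M * bool)%type.
Variables (S : signature) (B : finAlgebra S) (z o : fcar B).
Variables (G : 'I_9 -> pterm (alg_of_fin B) (option ('I_4 * Sg))) (b : nat).
Hypothesis G_size : forall k, size (comp (G k) 0).1 <= 2 ^ b.
Variables (c1 k1 cM kM : nat).

Notation wlen := (wit_len c1 k1).
Notation tlen := (time_len c1 k1 cM kM).

Definition gen_prog : prog bool :=
  Seq (prep_prog z o G b c1 k1 cM kM) (Seq (main_prog z G b) (final_prog b)).

Definition width n : nat := 2 * tlen n + (n.*2 + 2) + wlen n + (2 * tlen n).+1.
Definition gen_H n : nat :=
  let D := tlen n in
  width n + D + (D + D + 1 + n.*2.*2 + 2 + 2 + wlen n + D + D + 1 +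
    D * width n + width n).*2.+4.
Definition pre_cost n : nat :=
  prep_cost z o G b c1 k1 cM kM n + main_cost z G b (gen_H n) n (wlen n) (tlen n) (width n).
Definition gen_cost n : nat := pre_cost n + final_cost b (gen_H n) (n + pre_cost n).

Lemma gen_cost_poly : poly_bounded gen_cost.
Proof.
have pw : poly_bounded wlen by apply: poly_bounded_poly; apply: poly_bounded_id.
have pi : poly_bounded (in_len c1 k1) by rewrite /in_len; pbound.
have pt : poly_bounded tlen by apply: poly_bounded_poly.
have pW : poly_bounded width by rewrite /width; pbound.
have pH : poly_bounded gen_H by rewrite /gen_H /=; pbound.
have pe : poly_bounded (fun n => half_cost z G b (gen_H n)) by rewrite /half_cost; pbound.
have pp : poly_bounded pre_cost.
  rewrite /pre_cost /prep_cost /main_cost; cbv zeta; pbound; try exact: poly_bounded_poly_cost.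
  exact: poly_bounded_poly_cost poly_bounded_id.
by rewrite /gen_cost /final_cost; cbv zeta; pbound.
Qed.

Lemma wf_incr j : j < 7 -> 1 < j -> wf 22 (bincr 7 8 j).
Proof.
move=> j7 j1; have [n1 n2] : 7 != j /\ 8 != j by lia.
split=> //; split; [split | split; [split | ]] => //.
- by lia.
- by move=> a; split=> // - [[]|] //; case: a.
- by move=> a; split=> // - [[]|] //; case: a => /=; rewrite ?n1 ?n2.
- by case.
- by apply: wf_move => //; lia.
Qed.

Lemma only_incr (a : pred nat) j : a j -> a 7 -> a 8 -> only a (bincr 7 8 j).
Proof.
move=> aj a7 a8; do ?[split=> //].
- by case=> [[]|] //; case: c.
- by case.
Qed.

Definition emit_names (l : nat) : bool := 1 < l < 9.

Lemma emit_wf k : wf 22 (emit z G b k) /\ only emit_names (emit z G b k).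
Proof.
have ih : all (item_ok 7 22 2) (tmpl z G b k).
  by have := tmpl_holes z G b k (a := fun j => [&& j < 22, j != 2 & j != 7]) isT isT isT isT.
have [w1 o1] := print_names (isT : 7 < 22) (isT : 2 < 22) (isT : 2 != 7) ih.
have o2 : only emit_names (print 7 2 (tmpl z G b k)).
  apply: only_mono o1 => l /or3P[/eqP ->|/eqP ->|] //.
  have := tmpl_holes z G b k (a := emit_names) isT isT isT isT.
  elim: (tmpl z G b k) => //= it its IH /andP[h1 h2] /orP[|/IH]; last exact.
  by case: it h1 => // j h1 /eqP ->.
have hw : wf 22 (half z G b k).
  by split=> //; split; apply: wf_incr.
have ho : only emit_names (half z G b k).
  by split=> //; split; apply: only_incr.
by split; split.
Qed.

Lemma emit_avoids k j : 9 <= j -> avoids j (emit z G b k).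
Proof. by move=> j9; apply: only_avoids (emit_wf k).2 _; rewrite /emit_names; lia. Qed.

Lemma wf_sweep j k : 9 <= j -> j < 22 -> wf 22 (sweep z G b j k).
Proof.
move=> j9 j22; split=> // a; first by split=> //; apply: (emit_wf k).1.
by split; [apply: emit_avoids | rewrite /=; lia].
Qed.

Lemma wf_poly_prog c e src dst : src < 19 -> dst < 19 -> src != dst ->
  wf 22 (poly_prog 19 20 21 c e src dst).
Proof.
move=> hs hd sd; split; last first.
  split; last by apply: wf_pushes; lia.
  split=> // _; first by apply: wf_pushes; lia.
  by elim: c => //= c IH; split=> //; lia.
elim: e => //= e IH; split=> //; split; last by apply: wf_move.
split=> // _; first by apply: wf_copy => //; lia.
by split; [split=> [|a]; [lia | split] | split=> [|a] //=; lia].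
Qed.

Lemma gen_wf : wf 22 gen_prog.
Proof.
have we k := (emit_wf k).1.
have wb c : wf 22 (emit_bit z G b c) by do ![split=> //].
have wp items : all (item_ok 7 22 1) items -> wf 22 (print 7 1 items).
  by move=> h; have [] := print_names (isT : 7 < 22) (isT : 1 < 22) (isT : 1 != 7) h.
split; [|split].
- split; first by split=> // a; split.
  split; first exact: wf_poly_prog.
  do 3![split; first exact: wf_copy].
  split; first exact: wf_pushes.
  do 5![split; first exact: wf_poly_prog].
  by split; apply: wf_pushes.
- split; first exact: wf_sweep.
  split; first exact: wf_sweep.
  split; first exact: we.
  split.
    split=> // c.
    by split; (split; last split) => //; apply: emit_avoids.
  split; first exact: wb.
  split; first exact: wb.
  split; first exact: wf_sweep.
  split; first exact: wf_sweep.
  split; first exact: wf_sweep.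
  split; first exact: we.
  split=> //.
  split; first exact: wf_move.
  split; last exact: wf_sweep.
  split=> // _; first by split; [exact: wf_sweep | split=> //; exact: wf_move].
  split; last by split.
  by split=> // a; split=> //; apply: emit_avoids.
- split; first exact: wp.
  split; first exact: wf_move.
  split; first exact: wf_move.
  split; first exact: wp.
  split; first exact: wf_incr.
  split; first exact: wp.
  by [].
Qed.

Lemma gen_correct x : exists cl,
  [/\ cost gen_prog (prog_input id 22 x) <= gen_cost (size x),
      forall F, tiles (@Rk M) F cl <-> tableau x (tlen (size x)) (wlen (size x)) F &
      behead (get (eval gen_prog (prog_input id 22 x)) 1) =
      rev (instance_code G z o b (@var_name _) cl)].
Proof.
set s0 := prog_input id 22 x; set n := size x.
have z0 : size s0 = 22 by apply: size_sm_input.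
have g0 : get s0 =1 prep0 x.
  move=> l; rewrite /s0 /prog_input /sm_input get_put map_id /prep0 /setf /empty_st.
  by case: eqP => // _; rewrite /get nth_nseq if_same.
have LE : size (dbl x ++ [:: false; true]) = n.*2 + 2 by rewrite size_cat size_dbl.
have [|fr tm fr1] := @triple_main M S B z o G b G_size (gen_H n) x c1 k1 cM kM.
  by rewrite LE /gen_H /width.
have [s1 [r1 z1 g1]] := @triple_prep M S B z o G b (gen_H n) x c1 k1 cM kM s0 z0 g0.
have [s2 [r2 z2 g2]] := tm s1 z1 g1.
have r12 := runs_seq r1 r2.
rewrite LE -/n -/(width n) -/(pre_cost n) in r12 g2.
have [cl [e1 e2 e3 [e4 e5 e6 e7 e8] [e9 e10]]] := g2.
have w12 : wf 22 (Seq (prep_prog z o G b c1 k1 cM kM) (main_prog z G b)).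
  by have [h1 [h2 _]] := gen_wf.
have bN : size (body z o G b cl) <= n + pre_cost n.
  rewrite -(size_rev (body z o G b cl)) -e3.
  apply: leq_trans (size_get_total s2 2) _; have [<- c12] := r12.
  apply: leq_trans (total_eval w12 z0) _.
  by rewrite (total_sm_input id (isT : 0 < 22)) leq_add2l.
have hH : (size cl).*2.+2 <= gen_H n by rewrite e1 /gen_H; cbv zeta; lia.
have [g [s3 [r3 z3 h3]] gE] := @does_final M S B z o G b G_size (gen_H n) s2 cl (n + pre_cost n)
  z2 (etrans (e10 1 isT) fr1) e3 (etrans e6 (congr1 (fun k => bin k.*2.+2) (esym e1)))
  (etrans e7 (congr1 (fun k => bin k.*2) (esym e1))) e8 e9 hH bN.
have [ev cc] := runs_seq r1 (runs_seq r2 r3).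
exists cl; split=> //.
- by apply: leq_trans cc _; rewrite /gen_cost /pre_cost LE -/n -/(width n) addnA.
- by rewrite ev h3 gE.
Qed.

End Hardness.

Theorem gadgets_coNP_hard (S : signature) (B : finAlgebra S) : has_gadgets B ->
  forall L' : language, in_coNP L' ->
  exists f, polytime_computable f /\ forall x, L' x <-> CEQV (S := S) B (f x).
Proof.
move=> gad L' [V [c1 [k1 [[M [cM [kM hM]]] hV]]]].
have Sg0 : 0 < #|{: option (tQ M) * tG M * bool}|.
  by apply/card_gt0P; exists (None, tblank M, false).
have [z [o [G [b [Gs GE]]]]] := tiling_CEQV (@Rk M) Sg0 gad.
pose P := gen_prog z o G b c1 k1 cM kM.
pose f x := rev (behead (get (eval P (prog_input id 22 x)) 1)).
exists f; split.
  apply: (@prog_polytime bool id Some P 22 1 true (gen_wf _ _ _ _ _ _ _ _) isT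
    (gen_cost z o G b c1 k1 cM kM)) => //.
  - by move=> x; have [cl []] := gen_correct z o Gs c1 k1 cM kM x.
  - exact: gen_cost_poly.
  - by move=> x; rewrite map_id /f revK.
move=> x; have [cl [_ tE fE]] := gen_correct z o Gs c1 k1 cM kM x.
have -> : f x = instance_code G z o b (@var_name _) cl by rewrite /f fE revK.
rewrite GE.
(* The time bound is computed from the longest admissible witness; on shorter ones the verifier has
   halted earlier and its configuration no longer changes. *)
have key : (exists F, tiles (@Rk M) F cl) <-> ~ L' x.
  have mono w : size w <= wit_len c1 k1 (size x) ->
      poly cM kM (size (pair_enc x w)) <= time_len c1 k1 cM kM (size x).
    move=> wl; rewrite /time_len /poly leq_add2r leq_mul2l; apply/orP; right.
    apply: leq_wexpn; rewrite /in_len /pair_enc -/(dbl x) !size_cat size_dbl /= addnA.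
    by rewrite leq_add2l.
  have stop w : size w <= wit_len c1 k1 (size x) ->
      tacc M (tm_state M (tm_run M (time_len c1 k1 cM kM (size x)) (pair_enc x w))) <->
      V (pair_enc x w).
    by move=> wl; have [hh hv] := hM (pair_enc x w); rewrite (tm_run_mono (mono w wl) hh).
  rewrite hV; split.
    move=> [F /tE tF]; have [w wl acc] := witness_of_tableau tF.
    by exists w; split=> //; apply/stop.
  move=> [w [wl /(stop w wl) acc]]; have [F tF] := tableau_of_witness wl acc.
  by exists F; apply/tE.
rewrite key; split=> [h nh|nn]; first exact: nh h.
exact: NNPP.
Qed.

(** * Machines with an associative memory *)

Section Loops.
Variable G : finType.
Implicit Types (f : G -> prog G) (s : stacks G).

Definition loops f u s s' n : Prop :=
  foldl (fun s a => eval (f a) s) s u = s' /\ (foldl (loop_step f) (0, s) u).1 <= n.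

Lemma loops_nil f s : loops f [::] s s 0. Proof. by []. Qed.

Lemma loops_le f u s s' n m : n <= m -> loops f u s s' n -> loops f u s s' m.
Proof. by move=> le [e c]; split=> //; apply: leq_trans le. Qed.

Lemma loops_cat f u v s s1 s2 n m :
  loops f u s s1 n -> loops f v s1 s2 m -> loops f (u ++ v) s s2 (n + m).
Proof.
move=> [<- c1] [<- c2]; split; rewrite foldl_cat //.
have -> : foldl (loop_step f) (0, s) u =
    ((foldl (loop_step f) (0, s) u).1, foldl (fun s a => eval (f a) s) s u).
  by elim: u (0) s {c1 c2} => //= a u IH k s; rewrite IH.
by move: c1; set k := (foldl _ (0, s) u).1 => c1; rewrite -[k]addn0 loop_cost leq_add.
Qed.

Lemma loops1 f a s s' n : runs (f a) s s' n -> loops f [:: a] s s' n.+1.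
Proof. by move=> [e c]; split. Qed.

Lemma loops_cons f a u s s1 s2 n m :
  runs (f a) s s1 n -> loops f u s1 s2 m -> loops f (a :: u) s s2 (n.+1 + m).
Proof. by move=> /loops1 h1 h2; rewrite -cat1s; apply: loops_cat h1 h2. Qed.

Lemma runs_loops j f s s' n :
  loops f (get s j) (put s j [::]) s' n -> runs (For j f) s s' n.+1.
Proof.
move=> [e c]; split=> //=.
by rewrite -/(loop_step f) -[1]addn0 loop_cost.
Qed.

Lemma does_runs p s n g : does p s n g -> runs p s (mkseq g (size s)) n.
Proof.
move=> [s' [[e c] z h]]; split=> //; rewrite {}e -z.
apply: (@eq_from_nth _ [::]); first by rewrite size_mkseq.
by move=> i lt; rewrite nth_mkseq // -h.
Qed.

End Loops.

Section MemoryMachine.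
Variables (Q E : finType).
Notation G := (bool + (Q + E))%type.
Notation memory := (seq (seq bool * E)).

Definition bsym (b : bool) : G := inl b.
Definition csym (c : Q) : G := inr (inl c).
Definition msym (e : E) : G := inr (inr e).

Definition enc_mem (mem : memory) : seq G :=
  flatten [seq map bsym e.1 ++ [:: msym e.2] | e <- mem].

Definition hits (mem : memory) (key : seq bool) : seq E :=
  [seq e.2 | e <- mem & e.1 == key].

(* Stack 3 holds the control symbol, 4 the digits of the current token (last one on
   top), 5 the same in order, 6 the memory, 7 a binary counter; 8, 9 and 10 are
   scratch. *)
Definition control (F : Q -> Q) : prog G :=
  Case 3 (fun o => if o is Some (inr (inl c)) then Push 3 (csym (F c)) else Skip G).

Definition branch (F : Q -> prog G) : prog G :=
  Case 3 (fun o =>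
    if o is Some (inr (inl c)) then Seq (Push 3 (csym c)) (F c) else Skip G).

(** The key is compared with an entry while the memory streams by: its digits pass to stack 8, and a
    mismatch leaves a mark on stack 10. At the value symbol the key is restored, and the update runs
    if there is no mark. *)
Definition match_bit j (a : G) : prog G :=
  Case j (fun o => if o is Some a' then
      if a' == a then Push 8 a' else Seq (Push 8 a') (Push 10 a')
    else Push 10 a).

Definition match_end j (upd : Q -> E -> Q) e : prog G :=
  Seq (Case j (fun o => if o is Some a then Seq (Push 8 a) (Push 10 a) else Skip G))
  (Seq (move_to G 8 j)
  (Case 10 (fun o => if o is None then control (upd^~ e) else For 10 (fun _ => Skip G)))).

Definition query_step j upd (a : G) : prog G :=
  Seq (Push 9 a) (if a is inr (inr e) then match_end j upd e else match_bit j a).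

Definition query j upd : prog G :=
  Seq (For 6 (query_step j upd)) (move_to G 9 6).

Definition store_prog j e : prog G :=
  Seq (Push 6 (msym e))
  (Seq (move_to G j 8) (For 8 (fun a => Seq (Push 6 a) (Push j a)))).

Definition conf X (c : Q) num key mem cnt tmp mem2 fl : stacks G :=
  [:: [::]; X; [::]; [:: csym c]; num; key; mem; cnt; tmp; mem2; fl; [::]].

(* A search key lies on stack 5 or on stack 7; [o] is the other one. *)
Definition kpos (b : bool) : nat := if b then 5 else 7.
Definition kconf b X c num key o mem tmp mem2 fl : stacks G :=
  if b then conf X c num key mem o tmp mem2 fl else conf X c num o mem key tmp mem2 fl.

Lemma runs_control F X c num key mem cnt tmp mem2 fl :
  runs (control F) (conf X c num key mem cnt tmp mem2 fl)
    (conf X (F c) num key mem cnt tmp mem2 fl) 2.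
Proof. by []. Qed.

Lemma runs_branch F X c num key mem cnt tmp mem2 fl s' n :
  runs (F c) (conf X c num key mem cnt tmp mem2 fl) s' n ->
  runs (branch F) (conf X c num key mem cnt tmp mem2 fl) s' n.+2.
Proof. by move=> [e k]; split. Qed.

Section Query.
Variables (b : bool) (X num o mem : seq G).

Lemma runs_move_key c key tmp mem2 fl :
  runs (move_to G 8 (kpos b)) (kconf b X c num key o mem tmp mem2 fl)
    (kconf b X c num (rev tmp ++ key) o mem [::] mem2 fl) (size tmp * 2 + 1).
Proof.
case: b; rewrite /kconf; set s := conf _ _ _ _ _ _ _ _ _.
  exact (does_runs (@does_move G 8 5 s isT isT isT)).
exact (does_runs (@does_move G 8 7 s isT isT isT)).
Qed.

(** The mark stack stays empty exactly while the key begins with the digits seen, and [tmp] and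
    [key] together always hold the whole key. *)
Lemma match_bits upd c t key tmp mem2 fl : exists key' tmp' fl',
  [/\ loops (query_step (kpos b) upd) (map bsym t)
        (kconf b X c num key o mem tmp mem2 fl)
        (kconf b X c num key' o mem tmp' (rev (map bsym t) ++ mem2) fl') (size t * 5),
      rev tmp' ++ key' = rev tmp ++ key, size fl' <= size fl + size t,
      size key' = size key - size t &
      fl' = [::] <-> fl = [::] /\ key = map bsym t ++ key'].
Proof.
elim: t key tmp mem2 fl => [|a t IH] key tmp mem2 fl /=.
  exists key, tmp, fl; split=> //; rewrite ?addn0 ?subn0 //.
  by split=> // - [].
have step key1 tmp1 fl1 : rev tmp1 ++ key1 = rev tmp ++ key -> size fl1 <= (size fl).+1 ->
    key1 = behead key ->
    runs (query_step (kpos b) upd (bsym a)) (kconf b X c num key o mem tmp mem2 fl)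
      (kconf b X c num key1 o mem tmp1 (bsym a :: mem2) fl1) 4 ->
    (fl1 = [::] <-> fl = [::] /\ key = bsym a :: key1) ->
  exists key' tmp' fl', [/\ loops (query_step (kpos b) upd) (bsym a :: map bsym t)
        (kconf b X c num key o mem tmp mem2 fl)
        (kconf b X c num key' o mem tmp' (rev (bsym a :: map bsym t) ++ mem2) fl')
        ((size t).+1 * 5),
      rev tmp' ++ key' = rev tmp ++ key, size fl' <= size fl + (size t).+1,
      size key' = size key - (size t).+1 &
      fl' = [::] <-> fl = [::] /\ key = bsym a :: map bsym t ++ key'].
  move=> e1 z1 k1 r1 f1; have [key' [tmp' [fl' [l2 e2 z2 k2 f2]]]] := IH key1 tmp1 (bsym a :: mem2) fl1.
  exists key', tmp', fl'; split.
  - by rewrite rev_cons cat_rcons; apply: loops_le (loops_cons r1 l2).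
  - by rewrite e2.
  - by apply: leq_trans z2 _; rewrite addnS -addSn leq_add2r.
  - by rewrite k2 k1 size_behead -subn1 -subnDA.
  - rewrite f2 f1; split; first by case=> - [-> ->] ->.
    by case=> -> kE; rewrite k1 kE.
case: key {IH} step => [|k key] step.
  apply: (step [::] tmp (bsym a :: fl)) => //; first by case: b.
  by split=> // - [].
case: (k =P bsym a) => [kE|ne].
  apply: (step key (k :: tmp) fl) => //.
  - by rewrite rev_cons cat_rcons.
  - by rewrite kE; case: b; rewrite /runs /query_step /match_bit /= /get /= eqxx.
  - by rewrite kE; split=> [->|[]].
apply: (step key (k :: tmp) (k :: fl)) => //.
- by rewrite rev_cons cat_rcons.
- by case: b; rewrite /runs /query_step /match_bit /= /get /= (negbTE (introN eqP ne)).
- by split=> // - [_ [/ne]].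
Qed.

Lemma runs_match_end upd c e key tmp mem2 fl :
  runs (query_step (kpos b) upd (msym e)) (kconf b X c num key o mem tmp mem2 fl)
    (kconf b X (if (fl == [::]) && (key == [::]) then upd c e else c) num
       (rev tmp ++ key) o mem [::] (msym e :: mem2) [::])
    (size (rev tmp ++ key) * 2 + size fl * 2 + 12).
Proof.
have zE : size (rev tmp ++ key) = size tmp + size key by rewrite size_cat size_rev.
pose key1 := behead key; pose tmp1 := if key is k :: _ then k :: tmp else tmp.
pose fl1 := if key is k :: _ then k :: fl else fl.
have r1 : runs (Case (kpos b) (fun o => if o is Some a then Seq (Push 8 a) (Push 10 a) else Skip G))
    (kconf b X c num key o mem tmp (msym e :: mem2) fl)
    (kconf b X c num key1 o mem tmp1 (msym e :: mem2) fl1) 3.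
  by rewrite /key1 /tmp1 /fl1; case: b; case: (key).
have e1 : rev tmp1 ++ key1 = rev tmp ++ key.
  by rewrite /key1 /tmp1; case: (key) => //= k l; rewrite rev_cons cat_rcons.
have z1 : size tmp1 <= size (rev tmp ++ key).
  by rewrite -e1 size_cat size_rev leq_addr.
have z2 : size fl1 <= (size fl).+1 by rewrite /fl1; case: (key).
have fE : (fl == [::]) && (key == [::]) = (fl1 == [::]).
  by rewrite /fl1; case: (key) => [|k l]; rewrite ?eqxx ?andbT ?andbF.
have r2 := runs_move_key c key1 tmp1 (msym e :: mem2) fl1; rewrite {}e1 in r2.
have r3 : runs (Case 10 (fun o => if o is None then control (upd^~ e) else For 10 (fun _ => Skip G)))
    (kconf b X c num (rev tmp ++ key) o mem [::] (msym e :: mem2) fl1)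
    (kconf b X (if fl1 == [::] then upd c e else c) num (rev tmp ++ key) o mem [::]
       (msym e :: mem2) [::]) (size fl1 * 2 + 3).
  case: (fl1) => [|k l]; first by case: b.
  apply: (runs_le (n := (size l * 2).+2)); first by rewrite /=; lia.
  apply: (runs_pop (a := k) (u := l)); first by case: b.
  apply: runs_loops.
  set s1 := put _ _ _; have -> : get s1 10 = l by rewrite /s1 /kconf; case: b.
  have -> : put s1 10 [::] = kconf b X c num (rev tmp ++ key) o mem [::] (msym e :: mem2) [::].
    by rewrite /s1 /kconf; case: b.
  elim: (l) => //= a l' IH; rewrite mulSn.
  by apply: (loops_cons (n := 1) _ IH).
rewrite {}fE; apply: runs_le (runs_seq (n1 := 1) _ (runs_seq r1 (runs_seq r2 r3))); last by case: b.
by move: z1; set k := size (rev tmp ++ key) => z1; lia.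
Qed.

Lemma loops_query upd c m k mem2 :
  loops (query_step (kpos b) upd) (enc_mem m)
    (kconf b X c num k o mem [::] mem2 [::])
    (kconf b X (foldl upd c [seq e.2 | e <- m & map bsym e.1 == k]) num k o mem [::]
       (rev (enc_mem m) ++ mem2) [::])
    (size (enc_mem m) * (size k * 2 + 13)).
Proof.
elim: m c mem2 => [|[t e] m IH] c mem2; first exact: loops_nil.
have [key' [tmp' [fl' [l1 e1 z1 k1 f1]]]] := match_bits upd c t k [::] mem2 [::].
have r2 := runs_match_end upd c e key' tmp' (rev (map bsym t) ++ mem2) fl'.
rewrite e1 /= in r2 z1.
have cE : (fl' == [::]) && (key' == [::]) = (map bsym t == k).
  apply/andP/eqP => [[/eqP/f1[_ ->] /eqP ->]|kE]; first by rewrite cats0.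
  have k0 : key' = [::].
    by apply: size0nil; rewrite k1 -kE size_map subnn.
  by rewrite k0; split=> //; apply/eqP/f1; rewrite k0 cats0.
rewrite {}cE in r2.
have := loops_cat l1 (loops_cons r2 (IH _ _)).
rewrite /enc_mem /= -catA rev_cat -!catA; set s1 := foldl _ _ _ => h.
have -> : foldl upd c [seq e0.2 | e0 <- if map bsym t == k
    then (t, e) :: [seq x <- m | map bsym x.1 == k]
    else [seq x <- m | map bsym x.1 == k]] = s1 by rewrite /s1; case: ifP.
rewrite -/(enc_mem m) /= rev_cons -cats1 -!catA /=.
apply: loops_le h; rewrite size_cat /= size_map -/(enc_mem m).
by move: z1; set q := size (enc_mem m); set r := size k; set v := size t; set w := size fl' => z1; nia.
Qed.

End Query.

Lemma bsym_inj : injective bsym. Proof. by move=> x y []. Qed.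

Definition query_cost M k : nat := (M * (k * 2 + 13)).+1 + (M * 2 + 1).

Lemma runs_query b upd X c num k o m :
  runs (query (kpos b) upd) (kconf b X c num (map bsym k) o (enc_mem m) [::] [::] [::])
    (kconf b X (foldl upd c (hits m k)) num (map bsym k) o (enc_mem m) [::] [::] [::])
    (query_cost (size (enc_mem m)) (size k)).
Proof.
have l1 := loops_query b X num o [::] upd c m (map bsym k) [::].
rewrite (eq_filter (a2 := fun e => e.1 == k)) in l1; last first.
  by move=> e; rewrite (inj_eq (inj_map bsym_inj)).
rewrite cats0 size_map -/(hits m k) in l1.
apply: runs_seq.
  apply: runs_loops; set s := kconf b _ _ _ _ _ _ _ _ _.
  have -> : get s 6 = enc_mem m by rewrite /s; case: b {l1 s}.
  have -> : put s 6 [::] = kconf b X c num (map bsym k) o [::] [::] [::] [::].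
    by rewrite /s; case: b {l1 s}.
  exact: l1.
set c' := foldl _ _ _; rewrite -{2}(revK (enc_mem m)) -(size_rev (enc_mem m)) /kconf.
set u := rev (enc_mem m); case: b {l1}; set s := conf _ _ _ _ _ _ _ _ _.
  have := does_runs (@does_move G 9 6 s isT isT isT).
  by rewrite /= /get /= cats0.
have := does_runs (@does_move G 9 6 s isT isT isT).
by rewrite /= /get /= cats0.
Qed.

Lemma runs_store b e X c num k o m :
  runs (store_prog (kpos b) e) (kconf b X c num (map bsym k) o (enc_mem m) [::] [::] [::])
    (kconf b X c num (map bsym k) o (enc_mem ((k, e) :: m)) [::] [::] [::]) (size k * 5 + 3).
Proof.
set kk := map bsym k; set mm := enc_mem m.
have r1 : runs (Push 6 (msym e)) (kconf b X c num kk o mm [::] [::] [::])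
  (kconf b X c num kk o (msym e :: mm) [::] [::] [::]) 1 by case: b.
have r2 : runs (move_to G (kpos b) 8) (kconf b X c num kk o (msym e :: mm) [::] [::] [::])
  (kconf b X c num [::] o (msym e :: mm) (rev kk) [::] [::]) (size k * 2 + 1).
  rewrite -(size_map bsym k) -/kk -[rev kk]cats0 /kconf.
  case: b {r1}; set s := conf _ _ _ _ _ _ _ _ _.
    exact (does_runs (@does_move G 5 8 s isT isT isT)).
  exact (does_runs (@does_move G 7 8 s isT isT isT)).
have r3 : runs (For 8 (fun a => Seq (Push 6 a) (Push (kpos b) a)))
  (kconf b X c num [::] o (msym e :: mm) (rev kk) [::] [::])
  (kconf b X c num kk o (enc_mem ((k, e) :: m)) [::] [::] [::]) (size k * 3).+1.
  apply: runs_loops; set s := kconf b _ _ _ _ _ _ _ _ _.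
  have -> : get s 8 = rev kk by rewrite /s; case: b {r1 r2 s}.
  have -> : put s 8 [::] = kconf b X c num [::] o (msym e :: mm) [::] [::] [::].
    by rewrite /s; case: b {r1 r2 s}.
  have H u v w : loops (fun a => Seq (Push 6 a) (Push (kpos b) a)) u
      (kconf b X c num v o w [::] [::] [::])
      (kconf b X c num (rev u ++ v) o (rev u ++ w) [::] [::] [::]) (size u * 3).
    elim: u v w => [|a u IH] v w; first exact: loops_nil.
    rewrite rev_cons !cat_rcons; apply: (loops_cons (n := 2) _ (IH _ _)).
    by case: b {r1 r2 s IH}.
  have := H (rev kk) [::] (msym e :: mm).
  rewrite revK cats0 size_rev size_map; congr (loops _ _ _ (kconf _ _ _ _ _ _ _ _ _ _) _).
  by rewrite /enc_mem /= -catA.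
by apply: runs_le (runs_seq r1 (runs_seq r2 r3)); lia.
Qed.

Section Machine.
Variables (pre : bool -> Q -> Q) (evt : Q -> option bool) (upd1 upd2 : Q -> E -> Q).
Variables (store bump : Q -> option E) (fin : Q -> Q).

Record mstate := MState {
  m_ctl : Q; m_num : seq bool; m_mem : memory; m_cnt : seq bool }.

(** The end of a token: look the token up, possibly store a value under it and one under the
    counter, then look up the resulting counter. The second search tells the checker whether all
    announced nodes have been read. *)
Definition msep (st : mstate) : mstate :=
  let key := rev (m_num st) in
  let c1 := foldl upd1 (m_ctl st) (hits (m_mem st) key) in
  let mem1 := if store c1 is Some e then (key, e) :: m_mem st else m_mem st in
  let mem2 := if bump c1 is Some e then (m_cnt st, e) :: mem1 else mem1 in
  let cnt2 := if bump c1 is Some _ then binc (m_cnt st) else m_cnt st in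
  MState (fin (foldl upd2 c1 (hits mem2 cnt2))) [::] mem2 cnt2.

Definition mstep (st : mstate) (b : bool) : mstate :=
  let c := pre b (m_ctl st) in
  match evt c with
  | Some true => MState c (b :: m_num st) (m_mem st) (m_cnt st)
  | Some false => msep (MState c (m_num st) (m_mem st) (m_cnt st))
  | None => MState c (m_num st) (m_mem st) (m_cnt st)
  end.

Definition is_one (a : G) : bool := a == bsym true.

Definition bump_prog e : prog G := Seq (store_prog 7 e) (incr bsym is_one 8 10 7).

Definition sep_prog : prog G :=
  Seq (move_to G 4 5) (Seq (query 5 upd1)
  (Seq (branch (fun c => if store c is Some e then store_prog 5 e else Skip G))
  (Seq (For 5 (fun _ => Skip G))
  (Seq (branch (fun c => if bump c is Some e then bump_prog e else Skip G))
  (Seq (query 7 upd2) (control fin)))))).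

Definition step_prog (a : G) : prog G :=
  Seq (control (pre (is_one a)))
  (branch (fun c => match evt c with
     Some true => Push 4 a | Some false => sep_prog | None => Skip G end)).

Definition repr X (st : mstate) : stacks G :=
  conf X (m_ctl st) (map bsym (m_num st)) [::] (enc_mem (m_mem st))
    (map bsym (m_cnt st)) [::] [::] [::].

Definition sep_cost M n : nat :=
  n * 2 + 1 + (query_cost M n + (n * 5 + 5 + (n * 2 + 1 + (n * 12 + 15 +
  (query_cost (M + n.+1 + n.+1) n.+1 + 2))))).

Lemma query_cost_le M k M' k' : M <= M' -> k <= k' -> query_cost M k <= query_cost M' k'.
Proof. by move=> hM hk; rewrite /query_cost leq_add ?ltnS ?leq_mul ?leq_add ?leq_mul. Qed.

Lemma enc_mem_cons (e : seq bool * E) m : size (enc_mem (e :: m)) = (size e.1).+1 + size (enc_mem m).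
Proof. by rewrite /enc_mem /= !size_cat size_map addn1. Qed.

Lemma runs_sep X st M n : size (enc_mem (m_mem st)) <= M ->
  size (m_num st) <= n -> size (m_cnt st) <= n ->
  runs sep_prog (repr X st) (repr X (msep st)) (sep_cost M n).
Proof.
case: st => c num mem cnt /= zM zn zc; rewrite /repr /msep /=.
set key := rev num; have zk : size key <= n by rewrite size_rev.
set c1 := foldl upd1 _ _; set mem1 := if _ is Some e then _ else mem.
set mem2 := if _ is Some e then _ else mem1; set cnt2 := if _ is Some e then _ else cnt.
set c2 := foldl upd2 _ _.
set C := map bsym cnt.
have r1 : runs (move_to G 4 5) (conf X c (map bsym num) [::] (enc_mem mem) C [::] [::] [::])
    (conf X c [::] (map bsym key) (enc_mem mem) C [::] [::] [::]) (n * 2 + 1).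
  set s := conf _ _ _ _ _ _ _ _ _.
  have := does_runs (@does_move G 4 5 s isT isT isT).
  rewrite /= /get /= cats0 -map_rev size_map => h; apply: runs_le h.
  by rewrite leq_add2r leq_mul2r zn.
have r2 := runs_le (query_cost_le zM zk) (runs_query true upd1 X c [::] key C mem).
have r3 : runs (branch (fun c => if store c is Some e then store_prog 5 e else Skip G))
    (conf X c1 [::] (map bsym key) (enc_mem mem) C [::] [::] [::])
    (conf X c1 [::] (map bsym key) (enc_mem mem1) C [::] [::] [::]) (n * 5 + 5).
  rewrite addnS addnS; apply: runs_branch; rewrite /mem1; case: (store c1) => [e|].
    apply: runs_le (runs_store true e X c1 [::] key C mem).
    by rewrite leq_add2r leq_mul2r zk.
  by apply: runs_le (runs_skip _); lia.
have r4 : runs (For 5 (fun _ => Skip G))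
    (conf X c1 [::] (map bsym key) (enc_mem mem1) C [::] [::] [::])
    (conf X c1 [::] [::] (enc_mem mem1) C [::] [::] [::]) (n * 2 + 1).
  rewrite addn1; apply: runs_loops.
  have H (u : seq G) s : loops (fun _ => Skip G) u s s (size u * 2).
    elim: u => [|a u IH]; first exact: loops_nil.
    by apply: (loops_cons (n := 1) _ IH).
  apply: loops_le (H _ _); rewrite leq_mul2r /=.
  by rewrite /get /= size_map.
have z1 : size (enc_mem mem1) <= M + n.+1.
  rewrite /mem1; case: (store c1) => [e|]; rewrite ?enc_mem_cons /=; lia.
have r5 : runs (branch (fun c => if bump c is Some e then bump_prog e else Skip G))
    (conf X c1 [::] [::] (enc_mem mem1) C [::] [::] [::])
    (conf X c1 [::] [::] (enc_mem mem2) (map bsym cnt2) [::] [::] [::]) (n * 12 + 15).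
  rewrite !addnS -addnS; apply: runs_branch; rewrite /mem2 /cnt2; case: (bump c1) => [e|].
    have q1 := runs_store false e X c1 [::] cnt [::] mem1.
    have q2 : runs (incr bsym is_one 8 10 7)
        (conf X c1 [::] [::] (enc_mem ((cnt, e) :: mem1)) C [::] [::] [::])
        (conf X c1 [::] [::] (enc_mem ((cnt, e) :: mem1)) (map bsym (binc cnt)) [::] [::] [::])
        (size cnt * 7 + 10).
      set s := conf _ _ _ _ _ _ _ _ _.
      exact (does_runs (@does_incr G bsym is_one (fun b => ltac:(by case: b)) 8 10 7 s cnt
        erefl isT isT isT isT isT isT erefl erefl)).
    by apply: runs_le (runs_seq q1 q2); lia.
  by apply: runs_le (runs_skip _); lia.
have z2 : size (enc_mem mem2) <= M + n.+1 + n.+1.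
  rewrite /mem2; case: (bump c1) => [e|]; rewrite ?enc_mem_cons /=; lia.
have z3 : size cnt2 <= n.+1.
  rewrite /cnt2; case: (bump c1) => [e|]; last by lia.
  by have := size_binc cnt; lia.
have r6 := runs_le (query_cost_le z2 z3) (runs_query false upd2 X c1 [::] cnt2 [::] mem2).
have r7 : runs (control fin) (conf X c2 [::] [::] (enc_mem mem2) (map bsym cnt2) [::] [::] [::])
   (conf X (fin c2) [::] [::] (enc_mem mem2) (map bsym cnt2) [::] [::] [::]) 2.
  exact: runs_control.
exact: (runs_seq r1 (runs_seq r2 (runs_seq r3 (runs_seq r4 (runs_seq r5 (runs_seq r6 r7)))))).
Qed.

Lemma runs_step X st b M n : size (enc_mem (m_mem st)) <= M ->
  size (m_num st) <= n -> size (m_cnt st) <= n ->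
  runs (step_prog (bsym b)) (repr X st) (repr X (mstep st b)) (sep_cost M n + 4).
Proof.
move=> zM zn zc; rewrite addnC; set c := pre b (m_ctl st).
apply: (runs_seq (n1 := 2) (s1 := repr X (MState c (m_num st) (m_mem st) (m_cnt st)))).
  by rewrite /is_one; case: (b) @c.
apply: runs_branch; rewrite /mstep -/c.
have h1 : 0 < sep_cost M n by rewrite /sep_cost; lia.
case: (evt c) => [[]|]; [exact: runs_le h1 (runs_push _ _ _) | exact: runs_sep |
  exact: runs_le h1 (runs_skip _)].
Qed.

(** After [i] steps keys have at most [i] digits, and a step adds at most two entries; hence the
    quadratic term. *)
Definition st_bound M (i : nat) (st : mstate) : Prop :=
  [/\ size (enc_mem (m_mem st)) <= M + i * (i.*2 + 2), size (m_num st) <= i &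
      size (m_cnt st) <= i].

Lemma st_bound_step M i st b : st_bound M i st -> st_bound M i.+1 (mstep st b).
Proof.
case: st => c num mem cnt [/= zM zn zc].
have hm : i * (i.*2 + 2) + (i.+1 + i.+1) <= i.+1 * (i.+1.*2 + 2) by nia.
rewrite /mstep /=; set c' := pre b c.
case: (evt c') => [[]|]; [by split=> //=; lia | | by split=> //=; lia].
rewrite /msep /=; set c1 := foldl upd1 _ _; split=> //=.
- case: (bump c1) => [e|]; case: (store c1) => [e'|]; rewrite ?enc_mem_cons /= ?size_rev;
  by move: hm; set p := i * _; set q := i.+1 * _ => hm; lia.
- by case: (bump c1) => [e|]; [have := size_binc cnt; lia | lia].
Qed.

Definition steps_cost M n u : nat := u * (sep_cost (M + n * (n.*2 + 2)) n + 5).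

Lemma loops_steps X st M i n (bs : seq bool) : st_bound M i st -> i + size bs <= n ->
  loops step_prog (map bsym bs) (repr X st) (repr X (foldl mstep st bs))
    (steps_cost M n (size bs)) /\ st_bound M (i + size bs) (foldl mstep st bs).
Proof.
elim: bs st i => [|b bs IH] st i zs le; first by rewrite addn0; split=> //; apply: loops_nil.
have [l2 z2] := IH _ _ (st_bound_step b zs) (leq_trans (eq_leq (addSnnS _ _)) le).
split; last by rewrite addnS -addSn.
have [zM zn zc] := zs.
have r1 : runs (step_prog (bsym b)) (repr X st) (repr X (mstep st b))
    (sep_cost (M + n * (n.*2 + 2)) n + 4).
  apply: runs_step; last 2 first.
  - by move: le => /=; lia.
  - by move: le => /=; lia.
  by apply: leq_trans zM _; rewrite leq_add2l leq_mul //; move: le => /=; lia.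
apply: loops_le (loops_cons r1 l2).
by rewrite /steps_cost /= mulSn; lia.
Qed.


Variables (c0 : Q) (mem0 : memory) (switch : Q -> Q) (acc : Q -> bool).

(** The witness is read before the input, so that the assignment is in memory when nodes are
    evaluated. *)
Definition mrun (x w : seq bool) : mstate :=
  let st := foldl mstep (MState c0 [::] mem0 [::]) w in
  foldl mstep (MState (switch (m_ctl st)) [::] (m_mem st) (m_cnt st)) x.

Fixpoint split_pair (y : seq bool) : seq bool * seq bool :=
  match y with
  | a :: b :: y' =>
      if a == b then let r := split_pair y' in (a :: r.1, r.2) else ([::], y')
  | _ => ([::], [::])
  end.

Lemma split_pair_enc x w : split_pair (pair_enc x w) = (x, w).
Proof. by elim: x => //= a x IH; rewrite eqxx /= IH. Qed.

Lemma size_split y : size (split_pair y).1 + size (split_pair y).2 <= size y.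
Proof.
elim: (size y) {-2}y (leqnn (size y)) => [|n IH] [|a [|b y']] //= le.
case: eqP => _ /=; last by lia.
by have := IH y' (ltnW le); lia.
Qed.

(** Stack 8 holds the first digit of a pending pair. A symbol on stack 10 records that the separator
    has been passed; what follows goes to stack 11. *)
Definition split_step (a : G) : prog G :=
  Case 10 (fun o => if o is Some d then Seq (Push 10 d) (Push 11 a) else
    Case 8 (fun o => if o is Some h then if h == a then Push 0 a else Push 10 a
                     else Push 8 a)).

Definition sconf (xr wr h d : seq G) : stacks G :=
  [:: xr; [::]; [::]; [::]; [::]; [::]; [::]; [::]; h; [::]; d; wr].

Lemma loops_split y xr : exists h d, [/\ size h <= 1, size d <= 1 &
  loops split_step (map bsym y) (sconf xr [::] [::] [::])
    (sconf (rev (map bsym (split_pair y).1) ++ xr) (rev (map bsym (split_pair y).2)) h d)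
    (size y * 4)].
Proof.
have H u xr0 d wr : loops split_step (map bsym u) (sconf xr0 wr [::] [:: d])
    (sconf xr0 (rev (map bsym u) ++ wr) [::] [:: d]) (size u * 4).
  elim: u wr => [|a u IH] wr; first exact: loops_nil.
  rewrite /= rev_cons cat_rcons; exact: (loops_cons (n := 3) _ (IH _)).
elim: (size y) {-2}y (leqnn (size y)) xr => [|n IH] [|a [|b y']] //= le xr.
- by exists [::], [::].
- by exists [::], [::].
- by exists [:: bsym a], [::]; split=> //; apply: loops1.
have r1 : runs (split_step (bsym a)) (sconf xr [::] [::] [::])
    (sconf xr [::] [:: bsym a] [::]) 3 by [].
case: (a =P b) => [<-|ne] /=.
  have [h [d [zh zd l]]] := IH y' (ltnW le) (bsym a :: xr).
  exists h, d; split=> //; rewrite rev_cons cat_rcons.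
  apply: (loops_cons r1 (loops_cons (n := 3) _ l)).
  by rewrite /runs /split_step /= /get /= eqxx.
exists [::], [:: bsym b]; split=> //.
have l := H y' xr (bsym b) [::]; rewrite cats0 in l.
apply: (loops_cons r1 (loops_cons (n := 3) _ l)).
have ab : (bsym a == bsym b) = false by apply/negbTE/eqP => - [].
by rewrite /runs /split_step /= /get /= ab.
Qed.

Definition clear j : prog G := For j (fun _ => Skip G).

Definition run_prog : prog G :=
  Seq (move_to G 0 1) (Seq (For 1 split_step)
  (Seq (clear 8) (Seq (clear 10)
  (Seq (move_to G 0 1) (Seq (move_to G 11 2)
  (Seq (Push 3 (csym c0)) (Seq (pushes 6 (rev (enc_mem mem0)))
  (Seq (For 2 step_prog) (Seq (clear 4) (Seq (control switch)
  (Seq (For 1 step_prog)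
  (branch (fun c => if acc c then Push 11 (bsym true) else Skip G))))))))))))).

Let M0 := size (enc_mem mem0).

Definition run_cost n : nat :=
  n * 2 + 1 + ((n * 4).+1 + (3 + (3 + (n * 2 + 1 + (n * 2 + 1 + (1 + (M0.+1 +
  ((steps_cost M0 n n).+1 + (n * 2 + 1 + (2 + ((steps_cost M0 n n).+1 + 3))))))))))).

Lemma runs_clear j s n : size (get s j) <= n -> runs (clear j) s (put s j [::]) (n * 2 + 1).
Proof.
move=> le; rewrite addn1; apply: runs_loops.
suff H (u : seq G) s0 : loops (fun _ => Skip G) u s0 s0 (size u * 2).
  by apply: loops_le (H _ _); rewrite leq_mul2r le.
elim: u => [|a u IH]; first exact: loops_nil.
exact: (loops_cons (n := 1) _ IH).
Qed.

Lemma runs_run y : exists s',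
  runs run_prog (prog_input bsym 12 y) s' (run_cost (size y)) /\
  (ohead (get s' 11) = Some (bsym true) <->
   acc (m_ctl (mrun (split_pair y).1 (split_pair y).2))).
Proof.
set n := size y; set x := (split_pair y).1; set w := (split_pair y).2.
have zxw := size_split y; rewrite -/x -/w -/n in zxw.
have zx : size x <= n by lia. have zw : size w <= n by lia.
have -> : prog_input bsym 12 y = sconf (rev (map bsym y)) [::] [::] [::] by [].
pose sconf1 X Y Z W H D : stacks G :=
  [:: X; Y; Z; [::]; [::]; [::]; [::]; [::]; H; [::]; D; W].
have r1 : runs (move_to G 0 1) (sconf (rev (map bsym y)) [::] [::] [::])
    (sconf1 [::] (map bsym y) [::] [::] [::] [::]) (n * 2 + 1).
  have := does_runs (@does_move G 0 1 (sconf (rev (map bsym y)) [::] [::] [::]) isT isT isT).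
  by rewrite /= /get /= revK cats0 size_rev size_map.
have [h [d [zh zd l2]]] := loops_split y [::]; rewrite cats0 -/x -/w in l2.
have r2 : runs (For 1 split_step) (sconf1 [::] (map bsym y) [::] [::] [::] [::])
    (sconf (rev (map bsym x)) (rev (map bsym w)) h d) (n * 4).+1.
  exact: runs_loops.
have r3 : runs (clear 8) (sconf (rev (map bsym x)) (rev (map bsym w)) h d)
    (sconf (rev (map bsym x)) (rev (map bsym w)) [::] d) 3 by apply: (runs_clear (n := 1)).
have r4 : runs (clear 10) (sconf (rev (map bsym x)) (rev (map bsym w)) [::] d)
    (sconf (rev (map bsym x)) (rev (map bsym w)) [::] [::]) 3 by apply: (runs_clear (n := 1)).
have r5 : runs (move_to G 0 1) (sconf (rev (map bsym x)) (rev (map bsym w)) [::] [::])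
    (sconf1 [::] (map bsym x) [::] (rev (map bsym w)) [::] [::]) (n * 2 + 1).
  set s := sconf _ _ _ _; have := does_runs (@does_move G 0 1 s isT isT isT).
  rewrite /= /get /= revK cats0 size_rev size_map => h1; apply: runs_le h1.
  by rewrite leq_add2r leq_mul2r zx.
have r6 : runs (move_to G 11 2) (sconf1 [::] (map bsym x) [::] (rev (map bsym w)) [::] [::])
    (sconf1 [::] (map bsym x) (map bsym w) [::] [::] [::]) (n * 2 + 1).
  set s := sconf1 _ _ [::] _ _ _; have := does_runs (@does_move G 11 2 s isT isT isT).
  rewrite /= /get /= revK cats0 size_rev size_map => h1; apply: runs_le h1.
  by rewrite leq_add2r leq_mul2r zw.
pose winit C M : stacks G :=
  [:: [::]; map bsym x; map bsym w; C; [::]; [::]; M; [::]; [::]; [::]; [::]; [::]].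
have r7 : runs (Push 3 (csym c0)) (sconf1 [::] (map bsym x) (map bsym w) [::] [::] [::])
    (winit [:: csym c0] [::]) 1 by [].
have r8 : runs (pushes 6 (rev (enc_mem mem0))) (winit [:: csym c0] [::])
    (winit [:: csym c0] (enc_mem mem0)) M0.+1.
  have := does_runs (@does_pushes G 6 (rev (enc_mem mem0)) (winit [:: csym c0] [::]) isT).
  by rewrite /= /get /= revK cats0 size_rev.
set st0 := MState c0 [::] mem0 [::]; set st1 := foldl mstep st0 w.
have b0 : st_bound M0 0 st0 by split=> //=; rewrite addn0.
have [l9 b9] := loops_steps (n := n) (map bsym x) b0 zw.
have r9 : runs (For 2 step_prog) (winit [:: csym c0] (enc_mem mem0))
    (repr (map bsym x) st1) (steps_cost M0 n n).+1.
  by apply: runs_loops; apply: loops_le l9; rewrite leq_mul2r zw orbT.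
set st2 := MState (switch (m_ctl st1)) [::] (m_mem st1) (m_cnt st1).
have b2 : st_bound M0 (0 + size w) st2 by case: b9 => [h1 _ h3]; split.
have r10 : runs (clear 4) (repr (map bsym x) st1)
    (repr (map bsym x) (MState (m_ctl st1) [::] (m_mem st1) (m_cnt st1))) (n * 2 + 1).
  apply: runs_clear; rewrite /get /= size_map; case: b9 => _ h2 _.
  by apply: leq_trans h2 _.
have r11 : runs (control switch) (repr (map bsym x) (MState (m_ctl st1) [::] (m_mem st1) (m_cnt st1)))
    (repr (map bsym x) st2) 2 by [].
have [l12 _] := loops_steps (n := n) [::] b2 (leq_trans (eq_leq (addnC _ _)) zxw).
set st3 := foldl mstep st2 x in l12.
have r12 : runs (For 1 step_prog) (repr (map bsym x) st2) (repr [::] st3) (steps_cost M0 n n).+1.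
  by apply: runs_loops; apply: loops_le l12; rewrite leq_mul2r zx orbT.
pose fs : stacks G := if acc (m_ctl st3) then put (repr [::] st3) 11 [:: bsym true] else repr [::] st3.
have r13 : runs (branch (fun c => if acc c then Push 11 (bsym true) else Skip G))
    (repr [::] st3) fs 3.
  by apply: runs_branch; rewrite /fs; case: (acc _).
exists fs; split.
  exact: (runs_seq r1 (runs_seq r2 (runs_seq r3 (runs_seq r4 (runs_seq r5 (runs_seq r6
    (runs_seq r7 (runs_seq r8 (runs_seq r9 (runs_seq r10 (runs_seq r11
    (runs_seq r12 r13)))))))))))).
by rewrite /fs /mrun -/st1 -/st2 -/st3; case: (acc _).
Qed.

Lemma wf_query j upd : (j == 5) || (j == 7) -> wf 12 (query j upd).
Proof.
move=> jj; have [n6 n8 n12] : [/\ j != 6, j != 8 & j < 12] by case/orP: jj => /eqP ->.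
have h a : wf 12 (query_step j upd a) /\ avoids 6 (query_step j upd a).
  have hb a' : wf 12 (match_bit j a') /\ avoids 6 (match_bit j a').
    by split; split=> // - [a''|] //=; case: ifP.
  case: a => [a|[a|e]]; try by have [] := hb (inl a).
    by have [] := hb (inr (inl a)); split; split.
  split; split=> //; split.
  - by split=> // - [].
  - split; first by split=> //= _; rewrite eq_sym.
    by split=> // - [a|] //; split=> // - [[|[]]|].
  - by split=> // - [].
  - split; first by split=> //= _; rewrite eq_sym.
    by split=> // - [a|] //; split=> // - [[|[]]|].
by split; [split=> // a; have [] := h a | split].
Qed.

Lemma wf_store j e : (j == 5) || (j == 7) -> wf 12 (store_prog j e).
Proof.
move=> jj; have [n6 n8 n12] : [/\ j != 6, j != 8 & j < 12] by case/orP: jj => /eqP ->.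
split=> //; split; first by split=> //= _; rewrite eq_sym.
by split=> // a; split.
Qed.

Lemma wf_sep : wf 12 sep_prog.
Proof.
split; first by split.
split; first exact: wf_query.
split.
  split=> // - [[|[c|]]|] //; split=> //; case: (store c) => [e|] //; exact: wf_store.
split; first by split.
split; last by split; [exact: wf_query | split=> // - [[|[]]|]].
split=> // - [[|[c|]]|] //; split=> //; case: (bump c) => [e|] //.
split; first exact: wf_store.
split=> //; split; last by split; [split=> // - [] | split].
by split=> // a; split=> // - [a'|] //=; case: (is_one a).
Qed.

Lemma only_sep : only [pred j | 2 < j < 11] sep_prog.
Proof.
have oq j upd : (j == 5) || (j == 7) -> only [pred j | 2 < j < 11] (query j upd).
  move=> jj; have jr : 2 < j < 11 by case/orP: jj => /eqP ->.
  split; last by split.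
  split=> // a; split=> //.
  have hb a' : only [pred j | 2 < j < 11] (match_bit j a').
    by split=> // - [a''|] //=; case: ifP.
  case: a => [a|[a|e]]; try exact: hb.
  split; first by split=> // - [].
  split; first by split.
  by split=> // - [a|] //; split=> // - [[|[]]|].
have os j e : (j == 5) || (j == 7) -> only [pred j | 2 < j < 11] (store_prog j e).
  move=> jj; have jr : 2 < j < 11 by case/orP: jj => /eqP ->.
  by split=> //; split; split=> // a; split.
split; first by split.
split; first exact: oq.
split.
  split=> // - [[|[c|]]|] //; split=> //; case: (store c) => [e|] //; exact: os.
split; first by split.
split; last by split; [exact: oq | split=> // - [[|[]]|]].
split=> // - [[|[c|]]|] //; split=> //; case: (bump c) => [e|] //.
split; first exact: os.
split=> //; split; last by split; [split=> // - [] | split].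
by split=> // a; split=> // - [a'|] //=; case: (is_one a).
Qed.

Lemma wf_step a : wf 12 (step_prog a).
Proof.
split; first by split=> // - [[|[]]|].
split=> // - [[|[c|]]|] //; split=> //; case: (evt c) => [[]|] //; exact: wf_sep.
Qed.

Lemma avoids_step j a : j < 3 -> avoids j (step_prog a).
Proof.
move=> j3; have [n3 n4] : 3 != j /\ 4 != j by lia.
split; first by split=> // - [[|[]]|].
split=> // - [[|[c|]]|] //; split=> //; case: (evt c) => [[]|] //.
by apply: only_avoids only_sep _; rewrite /=; lia.
Qed.

Lemma wf_run : wf 12 run_prog.
Proof.
split; first exact: wf_move.
split.
  by split=> // a; split=> // - [d|] //; split=> // - [h|] //=; case: ifP.
do 2![split; first by split].
do 2![split; first exact: wf_move].
split=> //; split; first exact: wf_pushes.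
split; first by split=> // a; [apply: wf_step | apply: avoids_step].
split; first by split.
split; first by split=> // - [[|[]]|].
split; first by split=> // a; [apply: wf_step | apply: avoids_step].
by split=> // - [[|[c|]]|] //; split=> //; case: (acc c).
Qed.

Lemma run_cost_poly : poly_bounded run_cost.
Proof. by rewrite /run_cost /steps_cost /sep_cost /query_cost; pbound. Qed.

Theorem machine_in_P :
  in_P (fun y => acc (m_ctl (mrun (split_pair y).1 (split_pair y).2))).
Proof.
have h y : cost run_prog (prog_input bsym 12 y) <= run_cost (size y).
  by have [s' [[_ le] _]] := runs_run y.
have [M [c [k hM]]] :=
  prog_in_P (fun _ => None) (bsym true) wf_run (isT : 11 < 12) h run_cost_poly.
exists M, c, k => y; have [h1 h2] := hM y; split=> //; rewrite h2.
by have [s' [[-> _]]] := runs_run y.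
Qed.

End Machine.
End MemoryMachine.

(** * Membership in coNP *)

Section Checker.
Variables (S : signature) (B : finAlgebra S) (b0 : fcar B).
Notation T := (fcar B).
Notation node := (node S (fcar B)).

Inductive entry := ESize | EKind of 'I_3 | EConst of T | EGate of sym S | EVar of T | ENode of T.

Definition entry_code (e : entry) : unit + 'I_3 + T + sym S + T + T :=
  match e with
  | ESize => inl (inl (inl (inl (inl tt))))
  | EKind k => inl (inl (inl (inl (inr k))))
  | EConst c => inl (inl (inl (inr c)))
  | EGate f => inl (inl (inr f))
  | EVar v => inl (inr v)
  | ENode v => inr v
  end.

Definition entry_decode (x : unit + 'I_3 + T + sym S + T + T) : entry :=
  match x with
  | inl (inl (inl (inl (inl _)))) => ESize
  | inl (inl (inl (inl (inr k)))) => EKind k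
  | inl (inl (inl (inr c))) => EConst c
  | inl (inl (inr f)) => EGate f
  | inl (inr v) => EVar v
  | inr v => ENode v
  end.

Lemma entry_codeK : cancel entry_code entry_decode. Proof. by case. Qed.

HB.instance Definition _ := Finite.copy entry (can_type entry_codeK).

(* The modes [MWVal] and [MWKey] read the witness, a list of values and variables
   that preloads the memory with an assignment; the others read the instance. *)
Inductive mode :=
  | MWVal | MWKey of T
  | MSize | MKind | MVar | MConst | MGate
  | MArgs (f : sym S) of 'I_(arity f) & {ffun 'I_(arity f) -> T}
  | MOut1 | MOut2 of T | MEnd of bool | MBad.

Notation args_type := {f : sym S & ('I_(arity f) * {ffun 'I_(arity f) -> T})%type}.

Definition mode_code (m : mode) : bool * bool * bool + T + T + bool + args_type :=
  match m with
  | MWVal => inl (inl (inl (inl (true, true, true))))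
  | MSize => inl (inl (inl (inl (true, true, false))))
  | MKind => inl (inl (inl (inl (true, false, true))))
  | MVar => inl (inl (inl (inl (true, false, false))))
  | MConst => inl (inl (inl (inl (false, true, true))))
  | MGate => inl (inl (inl (inl (false, true, false))))
  | MOut1 => inl (inl (inl (inl (false, false, true))))
  | MBad => inl (inl (inl (inl (false, false, false))))
  | MWKey v => inl (inl (inl (inr v)))
  | MOut2 v => inl (inl (inr v))
  | MEnd b => inl (inr b)
  | MArgs f j vs => inr (Tagged (fun f => ('I_(arity f) * {ffun 'I_(arity f) -> T})%type) (j, vs))
  end.

Definition mode_decode (x : bool * bool * bool + T + T + bool + args_type) : mode :=
  match x with
  | inl (inl (inl (inl (true, true, true)))) => MWVal
  | inl (inl (inl (inl (true, true, false)))) => MSize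
  | inl (inl (inl (inl (true, false, true)))) => MKind
  | inl (inl (inl (inl (true, false, false)))) => MVar
  | inl (inl (inl (inl (false, true, true)))) => MConst
  | inl (inl (inl (inl (false, true, false)))) => MGate
  | inl (inl (inl (inl (false, false, true)))) => MOut1
  | inl (inl (inl (inl (false, false, false)))) => MBad
  | inl (inl (inl (inr v))) => MWKey v
  | inl (inl (inr v)) => MOut2 v
  | inl (inr b) => MEnd b
  | inr (existT f (j, vs)) => MArgs j vs
  end.

Lemma mode_codeK : cancel mode_code mode_decode. Proof. by case. Qed.

HB.instance Definition _ := Finite.copy mode (can_type mode_codeK).


(* pending first bit of a pair, or the event just completed: digit or separator *)
Notation event := (option bool + bool)%type.
(* event, mode, entry found for the current token, last digit read, whether the
   counter has reached the announced size *)
Notation ctl := (event * mode * option entry * bool * bool)%type.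

Definition pre (b : bool) (q : ctl) : ctl :=
  let: (v, m, fo, lb, ae) := q in
  match v with
  | inl (Some h) =>
      if h == b then (inr true, m, fo, b, ae)
      else if b then (inr false, m, fo, lb, ae) else (inl None, MBad, fo, lb, ae)
  | _ => (inl (Some b), m, fo, lb, ae)
  end.

Definition evt (q : ctl) : option bool :=
  if q.1.1.1.1 is inr b then Some b else None.

(** One numeral may be the key of a tag, a constant, an operation symbol, a variable and a node at
    once; the mode selects the kind of entry. *)
Definition wants (m : mode) (e : entry) : bool :=
  match m, e with
  | MWVal, EConst _ | MConst, EConst _ | MKind, EKind _ | MVar, EVar _
  | MGate, EGate _ | MArgs _ _ _, ENode _ | MOut1, ENode _ | MOut2 _, ENode _ => true
  | _, _ => false
  end.

Definition upd1 (q : ctl) (e : entry) : ctl :=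
  let: (v, m, fo, lb, ae) := q in
  (v, m, if wants m e then Some e else fo, lb, ae).

Definition is_size (e : entry) : bool := if e is ESize then true else false.

Definition upd2 (q : ctl) (e : entry) : ctl :=
  let: (v, m, fo, lb, ae) := q in (v, m, fo, lb, ae || is_size e).

Definition kind_mode (k : nat) : mode :=
  match k with 0 => MVar | 1 => MConst | _ => MGate end.

(* [inl]: ready for the next node, possibly with the value of the node just read *)
Definition gate_args f (j : nat) (vs : {ffun 'I_(arity f) -> T}) : option T + mode :=
  if insub j is Some j' then inr (MArgs j' vs) else inl (Some (fop (f := f) vs)).

Definition outcome (m : mode) (fo : option entry) : option T + mode :=
  match m, fo with
  | MWVal, Some (EConst v) => inr (MWKey v)
  | MWKey _, _ => inr MWVal
  | MSize, _ => inl None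
  | MKind, Some (EKind k) => inr (kind_mode k)
  | MVar, Some (EVar v) => inl (Some v)
  | MVar, _ => inl (Some b0)
  | MConst, Some (EConst v) => inl (Some v)
  | MGate, Some (EGate f) => gate_args 0 [ffun _ : 'I_(arity f) => b0]
  | MArgs f j vs, Some (ENode v) => gate_args j.+1 [ffun i => if i == j then v else vs i]
  | MOut1, Some (ENode v) => inr (MOut2 v)
  | MOut2 v1, Some (ENode v) => inr (MEnd (v1 != v))
  | _, _ => inr MBad
  end.

(** A token ending in a zero is not the numeral of any number; sending it to [MBad] ensures that a
    completely parsed word is the code of an instance. The empty token, the numeral of 0, counts as
    ending in a one. *)
Definition checked (lb : bool) m fo : option T + mode :=
  if lb then outcome m fo else inr MBad.

Definition stored (m : mode) : option entry :=
  match m with MSize => Some ESize | MWKey v => Some (EVar v) | _ => None end.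

Definition store (q : ctl) : option entry := stored q.1.1.1.2.

Definition bump (q : ctl) : option entry :=
  let: (v, m, fo, lb, ae) := q in
  if checked lb m fo is inl (Some v) then Some (ENode v) else None.

Definition fin (q : ctl) : ctl :=
  let: (v, m, fo, lb, ae) := q in
  (inr false,
   match checked lb m fo with
   | inl _ => if ae then MOut1 else MKind
   | inr m' => m'
   end, None, true, false).

Definition start (m : mode) : ctl := (inl None, m, None, true, false).

(** The verifier is for the complement of [CEQV], so it rejects only after a complete parse with
    equal outputs; malformed words lie in the complement and are accepted. *)
Definition acc (q : ctl) : bool :=
  ~~ ((q.1.1.1.1 == inr false) && (q.1.1.1.2 == MEnd false)).

Notation memory := (seq (seq bool * entry)).

(* Decoding a tag, a constant or an operation symbol is thus a memory lookup. *)
Definition mem0 : memory :=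
  [seq (bin k, EKind k) | k : 'I_3 <- enum 'I_3] ++
  [seq (bin (enum_rank c), EConst c) | c <- enum T] ++
  [seq (bin (enum_rank f), EGate f) | f <- enum (sym S)].

Notation mst := (mstate (event * mode * option entry * bool * bool)%type entry).
Notation step := (mstep pre evt upd1 upd2 store bump fin).
Notation sep := (msep upd1 upd2 store bump fin).

Definition look (m : mode) (l : seq entry) : option entry :=
  foldl (fun fo e => if wants m e then Some e else fo) None l.

Definition tstate := (mode * memory * seq bool)%type.

(** The machine seen one token at a time; [sepE] and [toks_run] relate this to the run on digits. *)
Definition tstep (s : tstate) (t : seq bool) : tstate :=
  let: (m, mem, cnt) := s in
  let mem1 := if stored m is Some e then (t, e) :: mem else mem in
  match checked (last true t) m (look m (hits mem t)) with
  | inl ov =>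
      let mem2 := if ov is Some v then (cnt, ENode v) :: mem1 else mem1 in
      let cnt2 := if ov is Some _ then binc cnt else cnt in
      (if has is_size (hits mem2 cnt2) then MOut1 else MKind, mem2, cnt2)
  | inr m' => (m', mem1, cnt)
  end.

Definition at_token (v : event) (s : tstate) : mst :=
  MState (v, s.1.1, None, true, false) [::] s.1.2 s.2.

Lemma fold_upd1 v m fo lb ae l :
  foldl upd1 (v, m, fo, lb, ae) l =
  (v, m, foldl (fun fo e => if wants m e then Some e else fo) fo l, lb, ae).
Proof. by elim: l fo => //= e l IH fo; rewrite IH. Qed.

Lemma fold_upd2 v m fo lb ae l :
  foldl upd2 (v, m, fo, lb, ae) l = (v, m, fo, lb, ae || has is_size l).
Proof. by elim: l ae => /= [|e l IH] ae; rewrite ?orbF // IH orbA. Qed.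

Lemma sepE v m t mem cnt :
  sep (MState (v, m, None, last true t, false) (rev t) mem cnt) =
  at_token (inr false) (tstep (m, mem, cnt) t).
Proof.
rewrite /msep /= revK fold_upd1 -/(look m (hits mem t)) /store /=.
case E: (checked _ _ _) => [[v'|]|m'] /=; rewrite fold_upd2 /= E //=.
Qed.

Definition tok (t : seq bool) : seq bool := dbl t ++ [:: false; true].

Lemma digits_run v m t t' mem cnt : ~~ (if v is inl (Some _) then true else false) ->
  foldl step (MState (v, m, None, last true t, false) (rev t) mem cnt) (dbl t' ++ [:: false; true]) =
  at_token (inr false) (tstep (m, mem, cnt) (t ++ t')).
Proof.
elim: t' t v => [|b t' IH] t v hv.
  rewrite cats0 -(sepE (inr false)) /=.
  by case: v hv => [[h|]|c] // _; rewrite /mstep /=.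
have -> : dbl (b :: t') ++ [:: false; true] = b :: b :: (dbl t' ++ [:: false; true]) by [].
have := IH (rcons t b) (inr true) isT; rewrite cat_rcons last_rcons rev_rcons => <-.
by case: v hv => [[h|]|c] // _; rewrite /= /mstep /= eqxx.
Qed.

Lemma tok_run v s t : ~~ (if v is inl (Some _) then true else false) ->
  foldl step (at_token v s) (tok t) = at_token (inr false) (tstep s t).
Proof. by case: s => - [m mem] cnt; apply: (@digits_run v m [::]). Qed.

Definition trun (s : tstate) (ts : seq (seq bool)) : tstate := foldl tstep s ts.

Lemma toks_run v s ts : ~~ (if v is inl (Some _) then true else false) ->
  exists v', foldl step (at_token v s) (flatten (map tok ts)) = at_token v' (trun s ts) /\
    (ts <> [::] -> v' = inr false).
Proof.
elim: ts s v => [|t ts IH] s v hv; first by exists v.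
have [v' [e1 e2]] := IH (tstep s t) (inr false) isT.
exists v'; rewrite /= foldl_cat tok_run // e1; split=> // _.
by case: ts e1 e2 {IH} => [/= e1 _|t' ts _ e2]; [case: e1 | apply: e2].
Qed.

Lemma bad_step (st : mst) b : (m_ctl st).1.1.1.2 = MBad -> (m_ctl (step st b)).1.1.1.2 = MBad.
Proof.
case: st => - [[[[v m] fo] lb] ae] num mem cnt /= ->; rewrite /mstep /=.
have hs v' num' lb' : (m_ctl (sep (MState (v', MBad, fo, lb', ae) num' mem cnt))).1.1.1.2 = MBad.
  by rewrite /msep /= fold_upd1 /= /checked /=; case: lb'; rewrite /= fold_upd2.
case: v => [[h|]|c] //=; case: eqP => //= _; case: b => //=; apply: hs.
Qed.

Lemma bad_run (st : mst) bs :
  (m_ctl st).1.1.1.2 = MBad -> (m_ctl (foldl step st bs)).1.1.1.2 = MBad.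
Proof. by elim: bs st => //= b bs IH st h; apply/IH/bad_step. Qed.

(** A run that ends just after a separator and outside [MBad] has read complete tokens, since [MBad]
    is never left. The partly read token [t] makes the induction go through. *)
Lemma decode_toks v m t mem cnt x :
  ~~ (if v is inl (Some _) then true else false) -> (t = [::] \/ v = inr true) ->
  let st' := foldl step (MState (v, m, None, last true t, false) (rev t) mem cnt) x in
  (m_ctl st').1.1.1.1 = inr false -> (m_ctl st').1.1.1.2 <> MBad ->
  exists2 ts, dbl t ++ x = flatten (map tok ts) &
    (m_ctl st').1.1.1.2 = (trun (m, mem, cnt) ts).1.1.
Proof.
elim: (size x) {-2}x (leqnn (size x)) v m t mem cnt => [|n IH] [|a [|b x']] //= le v m t mem cnt hv tv.
1,2: by move=> vE _; case: tv => [->|vE']; [exists [::] | rewrite vE' in vE].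
  by case: v hv {tv} => [[h|]|c].
have -> : step (MState (v, m, None, last true t, false) (rev t) mem cnt) a =
    MState (inl (Some a), m, None, last true t, false) (rev t) mem cnt.
  by case: v hv {tv} => [[h|]|c].
have le' : size x' <= n by rewrite ltnW.
case: (a =P b) => [<-|ne].
  have -> : step (MState (inl (Some a), m, None, last true t, false) (rev t) mem cnt) a =
      MState (inr true, m, None, last true (rcons t a), false) (rev (rcons t a)) mem cnt.
    by rewrite /mstep /= eqxx /= last_rcons rev_rcons.
  move=> h1 h2.
  have [ts tsE mE] :=
    IH x' le' (inr true) m (rcons t a) mem cnt isT (or_intror erefl) h1 h2.
  by exists ts => //; rewrite -tsE -cats1 dbl_cat -catA.
case: b ne => ne.
  have -> : a = false by case: a ne.
  have -> : step (MState (inl (Some false), m, None, last true t, false) (rev t) mem cnt) true =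
      at_token (inr false) (tstep (m, mem, cnt) t) by rewrite -(sepE (inr false)).
  case sE: (tstep _ t) => [[m1 mem1] cnt1] h1 h2.
  have [ts tsE mE] := IH x' le' (inr false) m1 [::] mem1 cnt1 isT (or_introl erefl) h1 h2.
  exists (t :: ts); last by rewrite -[trun _ (t :: ts)]/(trun (tstep (m, mem, cnt) t) ts) sE.
  by rewrite /= -tsE /tok -catA.
have -> : a = true by case: a ne.
by move=> _ []; apply: bad_run.
Qed.

Lemma mem_hits (mem : memory) k e : (e \in hits mem k) = ((k, e) \in mem).
Proof.
apply/mapP/idP => [[[k' e'] + ->]|h]; last by exists (k, e); rewrite // mem_filter eqxx.
by rewrite mem_filter => /andP[/eqP <-].
Qed.

Lemma look_cat m l1 l2 : look m (l1 ++ l2) =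
  foldl (fun fo e => if wants m e then Some e else fo) (look m l1) l2.
Proof. exact: foldl_cat. Qed.

Lemma look_rcons m l e : look m (rcons l e) = if wants m e then Some e else look m l.
Proof. by rewrite -cats1 look_cat. Qed.

Lemma look_some m l e : look m l = Some e -> (e \in l) && wants m e.
Proof.
elim/last_ind: l => // l e' IH; rewrite look_rcons mem_rcons inE.
case: ifP => [we [<-]|_ /IH/andP[-> ->]]; first by rewrite eqxx we.
by rewrite orbT.
Qed.

Lemma look_uniq m l e : e \in l -> wants m e ->
  (forall e', e' \in l -> wants m e' -> e' = e) -> look m l = Some e.
Proof.
elim/last_ind: l => // l e' IH; rewrite look_rcons mem_rcons inE => /orP[/eqP <- ->//|el] we h.
case: ifP => [we'|_]; first by rewrite (h e') // mem_rcons mem_head.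
by apply: IH => // e'' ll; apply: h; rewrite mem_rcons inE ll orbT.
Qed.

Lemma look_filter m l : look m l = look m (filter (wants m) l).
Proof.
rewrite /look; elim: l None => //= e l IH fo.
by case: ifP => we /=; rewrite ?we IH.
Qed.

Lemma mem0P k e : (k, e) \in mem0 ->
  match e with
  | EKind j => k = bin j
  | EConst c => k = bin (enum_rank c)
  | EGate f => k = bin (enum_rank f)
  | _ => False
  end.
Proof. by rewrite !mem_cat => /or3P[] /mapP[x _ [-> ->]]. Qed.

Lemma mem0_kind (j : 'I_3) : (bin j, EKind j) \in mem0.
Proof. by rewrite mem_cat map_f ?mem_enum. Qed.

Lemma mem0_const (c : T) : (bin (enum_rank c), EConst c) \in mem0.
Proof.
by rewrite !mem_cat (map_f (fun c => (bin (enum_rank c), EConst c))) ?mem_enum ?orbT.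
Qed.

Lemma mem0_gate (f : sym S) : (bin (enum_rank f), EGate f) \in mem0.
Proof.
by rewrite !mem_cat (map_f (fun f => (bin (enum_rank f), EGate f))) ?mem_enum ?orbT.
Qed.

Lemma bad_trun mem cnt ts : (trun (MBad, mem, cnt) ts).1.1 = MBad.
Proof.
elim: ts mem cnt => //= t ts IH mem cnt; rewrite /tstep /checked /=.
by case: (last true t) => /=.
Qed.

Lemma trun_cons s t ts : trun s (t :: ts) = trun (tstep s t) ts. Proof. by []. Qed.

Lemma trun_cat s u v : trun s (u ++ v) = trun (trun s u) v. Proof. exact: foldl_cat. Qed.

Arguments tstep : simpl never.
Arguments trun : simpl never.

(** * Evaluating and parsing the nodes of a circuit *)

Section Nodes.
Variables (evs : memory) (N : nat).
Hypothesis evs_var : all (fun e => if e.2 is EVar _ then true else false) evs.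

Let memw := evs ++ mem0.

Definition assignment (i : nat) : T :=
  if look MVar (hits memw (bin i)) is Some (EVar v) then v else b0.

Definition node_mem (vals : seq T) : memory :=
  [seq (bin i, ENode (nth b0 vals i)) | i <- rev (iota 0 (size vals))] ++
  (bin N, ESize) :: memw.

Lemma node_mem_rcons vals v :
  node_mem (rcons vals v) = (bin (size vals), ENode v) :: node_mem vals.
Proof.
rewrite /node_mem size_rcons -(addn1 (size vals)) iotaD rev_cat /= nth_rcons ltnn eqxx.
congr (_ :: _ ++ _); apply/eq_in_map => i.
by rewrite mem_rev mem_iota add0n => /andP[_ h]; rewrite nth_rcons h.
Qed.

Lemma node_memP vals k e : (k, e) \in node_mem vals ->
  match e with
  | ENode v => exists2 i, i < size vals & k = bin i /\ v = nth b0 vals i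
  | ESize => k = bin N
  | EKind j => k = bin j
  | EConst c => k = bin (enum_rank c)
  | EGate f => k = bin (enum_rank f)
  | EVar v => True
  end.
Proof.
rewrite mem_cat inE mem_cat => /or4P[/mapP[i]|/eqP[-> ->] //|h|/mem0P]; last by case: e.
  by rewrite mem_rev mem_iota add0n => /andP[_ h] [-> ->]; exists i.
by have := allP evs_var _ h; case: e {h}.
Qed.

Lemma node_mem_node vals i : i < size vals -> (bin i, ENode (nth b0 vals i)) \in node_mem vals.
Proof.
move=> h; rewrite mem_cat (map_f (fun i => (bin i, ENode (nth b0 vals i)))) //.
by rewrite mem_rev mem_iota.
Qed.

Lemma node_mem0 vals ke : ke \in mem0 -> ke \in node_mem vals.
Proof. by move=> h; rewrite mem_cat inE mem_cat h !orbT. Qed.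

Lemma look_node m vals i : (forall e, wants m e = if e is ENode _ then true else false) ->
  i < size vals -> look m (hits (node_mem vals) (bin i)) = Some (ENode (nth b0 vals i)).
Proof.
move=> hm h; apply: look_uniq; rewrite ?hm ?mem_hits ?node_mem_node // => e.
by rewrite mem_hits hm => /node_memP; case: e => // v [j _ [/bin_inj <- ->]].
Qed.

Lemma look_kind vals (j : 'I_3) : look MKind (hits (node_mem vals) (bin j)) = Some (EKind j).
Proof.
apply: look_uniq => //; first by rewrite mem_hits node_mem0 ?mem0_kind.
by move=> e; rewrite mem_hits => /node_memP; case: e => // j' /bin_inj/val_inj ->.
Qed.

Lemma look_const vals c : look MConst (hits (node_mem vals) (bin (enum_rank c))) = Some (EConst c).
Proof.
apply: look_uniq => //; first by rewrite mem_hits node_mem0 ?mem0_const.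
by move=> e; rewrite mem_hits => /node_memP; case: e => // c' /bin_inj/val_inj/enum_rank_inj ->.
Qed.

Lemma look_gate vals f : look MGate (hits (node_mem vals) (bin (enum_rank f))) = Some (EGate f).
Proof.
apply: look_uniq => //; first by rewrite mem_hits node_mem0 ?mem0_gate.
by move=> e; rewrite mem_hits => /node_memP; case: e => // f' /bin_inj/val_inj/enum_rank_inj ->.
Qed.

Lemma look_var vals t : look MVar (hits (node_mem vals) t) = look MVar (hits memw t).
Proof.
rewrite look_filter [RHS]look_filter; congr look.
rewrite /node_mem /hits filter_cat map_cat filter_cat.
set l := [seq _ <- _ | wants _ _]; have -> : l = [::].
  rewrite /l; elim: (rev _) => //= i r IH.
  by case: ifP.
by rewrite /=; case: ifP.
Qed.

Definition next (vals : seq T) : tstate :=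
  (if size vals == N then MOut1 else MKind, node_mem vals, bin (size vals)).

Definition after vals (o : option T + mode) : tstate :=
  match o with
  | inl (Some v) => next (rcons vals v)
  | inl None => next vals
  | inr m => (m, node_mem vals, bin (size vals))
  end.

Lemma has_size vals : has is_size (hits (node_mem vals) (bin (size vals))) = (size vals == N).
Proof.
apply/hasP/eqP => [[e]|nE].
  by rewrite mem_hits => /node_memP; case: e => // /bin_inj.
by exists ESize => //; rewrite mem_hits nE mem_cat mem_head orbT.
Qed.

Lemma tstep_node m vals t : stored m = None ->
  (forall fo, checked (last true t) m fo <> inl None) ->
  tstep (m, node_mem vals, bin (size vals)) t =
  after vals (checked (last true t) m (look m (hits (node_mem vals) t))).
Proof.
move=> sm nn; rewrite /tstep sm.
case E: (checked _ _ _) => [[v|]|m'] //=; last by case: (nn _ E).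
by rewrite binc_bin -node_mem_rcons /next -(size_rcons vals v) has_size.
Qed.

Lemma gate_args_some f j vs : @gate_args f j vs <> inl None.
Proof. by rewrite /gate_args; case: insub. Qed.

Lemma args_step vals f (j : 'I_(arity f)) vs i : i < size vals ->
  tstep (MArgs j vs, node_mem vals, bin (size vals)) (bin i) =
  after vals (gate_args j.+1 [ffun i0 => if i0 == j then nth b0 vals i else vs i0]).
Proof.
move=> h; rewrite tstep_node //; last first.
  move=> fo; rewrite /checked; case: ifP => //= _.
  by case: fo => // - [] //= *; apply: gate_args_some.
by rewrite look_node //= last_bin.
Qed.

Lemma args_run vals f j (vs : {ffun 'I_(arity f) -> T}) ins :
  j + size ins = arity f -> all (fun i => i < size vals) ins ->
  trun (after vals (gate_args j vs)) (map bin ins) =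
  next (rcons vals (fop (f := f) (fun i : 'I_(arity f) =>
    if i < j then vs i else nth b0 vals (nth 0 ins (i - j))))).
Proof.
elim: ins j vs => [|i ins IH] j vs /=.
  rewrite addn0 => jE _; rewrite /gate_args insubF ?jE ?ltnn //=.
  congr (next (rcons _ (fop _))); apply: functional_extensionality => i.
  by rewrite ltn_ord.
move=> jE /andP[hi hins]; have lt : j < arity f by rewrite -jE addnS ltnS leq_addr.
rewrite /gate_args insubT trun_cons /= args_step // IH ?addSn -?addnS //.
congr (next (rcons _ (fop _))); apply: functional_extensionality => k.
rewrite ffunE ltnS leq_eqVlt -val_eqE /=.
case: eqP => [->|ne] /=; first by rewrite ltnn subnn.
case: ltnP => // h; have [d dE] : exists d, k - j = d.+1.
  by exists (k - j).-1; rewrite prednK // subn_gt0 ltn_neqAle h andbT eq_sym; apply/eqP.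
by rewrite dE /= subnS dE.
Qed.

Definition node_valid (n : nat) (nd : node) : bool :=
  if nd is NGate f ins then (size ins == arity f) && all (fun i => i < n) ins else true.

Definition toks (nd : node) : seq (seq bool) :=
  match nd with
  | NVar i => [:: bin 0; bin i]
  | NConst c => [:: bin 1; bin (enum_rank c)]
  | NGate f ins => [:: bin 2, bin (enum_rank f) & map bin ins]
  end.

Lemma kind_step vals k : k < 3 ->
  tstep (MKind, node_mem vals, bin (size vals)) (bin k) =
  (kind_mode k, node_mem vals, bin (size vals)).
Proof.
move=> k3; rewrite tstep_node //; last first.
  by move=> fo; rewrite /checked; case: ifP => //= _; case: fo => // - [].
by rewrite -[k]/(val (Ordinal k3)) look_kind last_bin.
Qed.

Lemma var_step vals i :
  tstep (MVar, node_mem vals, bin (size vals)) (bin i) = next (rcons vals (assignment i)).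
Proof.
rewrite tstep_node //; last first.
  by move=> fo; rewrite /checked; case: ifP => //= _; case: fo => // - [].
rewrite look_var last_bin /= /assignment; case E: (look _ _) => [e|] //.
by case/look_some/andP: E => _; case: e.
Qed.

Lemma const_step vals c :
  tstep (MConst, node_mem vals, bin (size vals)) (bin (enum_rank c)) = next (rcons vals c).
Proof.
rewrite tstep_node //; last first.
  by move=> fo; rewrite /checked; case: ifP => //= _; case: fo => // - [].
by rewrite look_const last_bin.
Qed.

Lemma gate_step vals f :
  tstep (MGate, node_mem vals, bin (size vals)) (bin (enum_rank f)) =
  after vals (gate_args 0 [ffun _ : 'I_(arity f) => b0]).
Proof.
rewrite tstep_node //; last first.
  move=> fo; rewrite /checked; case: ifP => //= _.
  by case: fo => // - [] //= *; apply: gate_args_some.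
by rewrite look_gate last_bin.
Qed.

Lemma node_run vals nd : node_valid (size vals) nd ->
  trun (MKind, node_mem vals, bin (size vals)) (toks nd) =
  next (rcons vals (eval_node (A := alg_of_fin B) assignment vals nd)).
Proof.
case: nd => [i|c|f ins] ok.
- by rewrite !trun_cons kind_step // var_step.
- by rewrite !trun_cons kind_step // const_step.
case/andP: ok => /eqP zi hi.
rewrite !trun_cons kind_step // gate_step args_run //.
congr (next (rcons _ _)); rewrite /eval_node /=; congr fop.
apply: functional_extensionality => j; rewrite subn0; apply: set_nth_default.
by apply: (allP hi); rewrite mem_nth // zi.
Qed.

Definition reads_node (m : mode) : bool :=
  match m with MKind | MVar | MConst | MGate | MArgs _ _ _ | MOut1 | MOut2 _ | MEnd _ => true
  | _ => false end.

(** A run that reaches [MEnd] has passed every check, so each token is a numeral with an entry of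
    the kind its mode wants; only a variable name may lack an entry, because [b0] is its default. *)
Lemma step_inv m vals t ts b :
  (trun (m, node_mem vals, bin (size vals)) (t :: ts)).1.1 = MEnd b -> reads_node m ->
  t = bin (bval t) /\
  (m = MVar \/ exists2 e, (t, e) \in node_mem vals & wants m e).
Proof.
move=> + rm; rewrite trun_cons tstep_node; last first.
- move=> fo; rewrite /checked; case: ifP => // _.
  by case: m rm => //= *; case: fo => // - [] //= *; apply: gate_args_some.
- by case: m rm.
rewrite /checked; case lt: (last true t); last by rewrite bad_trun.
move=> h; split; first by rewrite bin_bval.
case E: (look m _) h => [e|].
  by move=> _; right; exists e; case/andP: (look_some E); rewrite ?mem_hits.
have [->|->] : outcome m None = inr MBad \/ m = MVar.
- by case: (m) rm => // *; first [by left | by right].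
- by rewrite /= bad_trun.
- by left.
Qed.

Lemma args_back vals f j (vs : {ffun 'I_(arity f) -> T}) ts b : j <= arity f ->
  (trun (after vals (gate_args j vs)) ts).1.1 = MEnd b ->
  exists ins ts', [/\ j + size ins = arity f, all (fun i => i < size vals) ins &
    ts = map bin ins ++ ts'].
Proof.
elim: ts j vs => [|t ts IH] j vs.
  rewrite leq_eqVlt => /orP[/eqP jE _|lt]; first by exists [::], [::]; rewrite addn0.
  by rewrite /gate_args insubT.
rewrite leq_eqVlt => /orP[/eqP jE _|lt]; first by exists [::], (t :: ts); rewrite addn0.
rewrite /gate_args insubT /= => h.
have [_ [//|[e te we]]] := step_inv h isT.
case: e te we => // v /node_memP[i hi [tE vE]] _.
rewrite tE trun_cons args_step // in h.
have [ins [ts' [zi ai ->]]] := IH j.+1 _ lt h.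
by exists (i :: ins), ts'; rewrite /= -zi addnS hi tE.
Qed.

Lemma node_back vals ts b :
  (trun (MKind, node_mem vals, bin (size vals)) ts).1.1 = MEnd b ->
  exists nd ts', ts = toks nd ++ ts' /\ node_valid (size vals) nd.
Proof.
case: ts => [|t ts] // h; have [_ [//|[e te we]]] := step_inv h isT.
case: e te we => // k /node_memP tE _.
rewrite tE trun_cons kind_step // in h *.
case: k h {tE} => - [|[|[|//]]] /= _; case: ts => [|t' ts] // h.
- have [-> _] := step_inv h isT; by exists (NVar _ _ (bval t')), ts.
- have [_ [//|[e te we]]] := step_inv h isT.
  by case: e te we => // c /node_memP -> _; exists (NConst _ c), ts.
have [_ [//|[e te we]]] := step_inv h isT.
case: e te we => // f /node_memP tE _.
rewrite tE trun_cons gate_step in h.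
have [ins [ts' [zi ai ->]]] := args_back (leq0n _) h.
by exists (NGate _ f ins), ts'; rewrite tE /= -zi eqxx.
Qed.

Lemma out_back vals ts b :
  (trun (MOut1, node_mem vals, bin (size vals)) ts).1.1 = MEnd b ->
  exists g1 g2, [/\ ts = [:: bin g1; bin g2], g1 < size vals & g2 < size vals].
Proof.
have st m t fo : (if m is MOut1 then true else if m is MOut2 _ then true else false) ->
    checked (last true t) m fo <> inl None.
  by rewrite /checked; case: ifP => // _; case: m => //= [_|v _]; case: fo => // - [].
case: ts => [|t1 ts] // h; have [_ [//|[e te we]]] := step_inv h isT.
case: e te we => // v1 /node_memP[g1 h1 [t1E _]] _.
rewrite t1E trun_cons tstep_node // in h; last by move=> fo; apply: st.
rewrite look_node // last_bin /= in h.
case: ts h => [|t2 ts] // h; have [_ [//|[e te we]]] := step_inv h isT.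
case: e te we => // v2 /node_memP[g2 h2 [t2E _]] _.
rewrite t2E trun_cons tstep_node // in h; last by move=> fo; apply: st.
rewrite look_node // last_bin /= in h.
case: ts h => [|t3 ts] h; first by exists g1, g2; rewrite t1E t2E.
by have [_ [//|[e _]]] := step_inv h isT.
Qed.

Lemma out_run vals g1 g2 : g1 < size vals -> g2 < size vals ->
  (trun (MOut1, node_mem vals, bin (size vals)) [:: bin g1; bin g2]).1.1 =
  MEnd (nth b0 vals g1 != nth b0 vals g2).
Proof.
have st m t fo : (if m is MOut1 then true else if m is MOut2 _ then true else false) ->
    checked (last true t) m fo <> inl None.
  by rewrite /checked; case: ifP => // _; case: m => //= [_|v _]; case: fo => // - [].
move=> h1 h2; rewrite !trun_cons tstep_node //; last by move=> fo; apply: st.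
rewrite look_node // last_bin /= tstep_node //; last by move=> fo; apply: st.
by rewrite look_node // last_bin.
Qed.

Lemma circuit_run vals C : valid_nodes (size vals) C -> size vals + size C = N ->
  trun (next vals) (flatten (map toks C)) = next (run_from assignment vals C).
Proof.
elim: C vals => [|nd C IH] vals //= /andP[ok vC] zN.
have zr : size vals != N by rewrite -zN; lia.
rewrite trun_cat /next (negbTE zr) node_run // IH //.
  by rewrite size_rcons.
by rewrite size_rcons addSnnS.
Qed.

(** The induction is on the number of tokens, since a node takes a varying number of them. *)
Lemma circuit_back vals ts b : size vals <= N -> (trun (next vals) ts).1.1 = MEnd b ->
  exists C g1 g2, [/\ ts = flatten (map toks C) ++ [:: bin g1; bin g2],
    valid_nodes (size vals) C, size vals + size C = N & (g1 < N) && (g2 < N)].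
Proof.
elim: (size ts) {-2}ts (leqnn (size ts)) vals => [|n IH] {}ts le vals; rewrite leq_eqVlt.
  by case: ts le => // _ /orP[/eqP zN|lt]; rewrite /next /= ?zN ?eqxx // ltn_eqF.
case/orP=> [/eqP zN|lt]; rewrite /next.
  rewrite zN eqxx -zN => /out_back[g1 [g2 [-> h1 h2]]].
  by exists [::], g1, g2; rewrite addn0 h1 h2.
rewrite ltn_eqF // => h; have [nd [ts' [tsE ok]]] := node_back h.
rewrite tsE trun_cat node_run // in h.
have zt : size ts' <= n.
  by move: le; rewrite tsE size_cat; case: (nd) => [i|c|f ins] /=; lia.
have [|C [g1 [g2 [tE vC zN hg]]]] := IH ts' zt _ _ h; first by rewrite size_rcons.
exists (nd :: C), g1, g2; rewrite size_rcons in vC zN; split=> //=.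
- by rewrite tsE tE catA.
- by rewrite vC andbT.
- by rewrite -zN addSnnS.
Qed.

End Nodes.


Definition is_var (e : seq bool * entry) : bool := if e.2 is EVar _ then true else false.

Notation run := (mrun pre evt upd1 upd2 store bump fin (start MWVal) mem0 (fun _ => start MSize)).
Notation wrun := (foldl step (MState (start MWVal) [::] mem0 [::])).

Definition reads_witness (m : mode) : bool :=
  match m with MWVal | MWKey _ | MBad => true | _ => false end.

(** Whatever the witness is, it adds only values of variables and leaves the counter empty. Even a
    malformed one stands for an assignment and cannot cause wrong acceptance. *)
Lemma witness_mem w : exists2 evs, all is_var evs &
  m_mem (wrun w) = evs ++ mem0 /\ m_cnt (wrun w) = [::].
Proof.
pose inv (st : mst) := reads_witness (m_ctl st).1.1.1.2 /\ exists2 evs, all is_var evs &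
  m_mem st = evs ++ mem0 /\ m_cnt st = [::].
suff H st : inv st -> inv (foldl step st w).
  by case: (H (MState (start MWVal) [::] mem0 [::])) => //; split=> //; exists [::].
elim: w st => //= b w IH st hst; apply: IH.
case: st hst => - [[[[v m] fo] lb] ae] num mem cnt [/= wm [evs ve [-> ->]]].
have hs v' num' lb' : inv (sep (MState (v', m, fo, lb', ae) num' (evs ++ mem0) [::])).
  rewrite /msep /= fold_upd1; move: (foldl _ fo _) => fo'.
  have [m' cE wm'] : exists2 m', checked lb' m fo' = inr m' & reads_witness m'.
    rewrite /checked; case: lb'; last by exists MBad.
    case: (m) wm => // [|v1|] _; [|by exists MWVal|by exists MBad].
    by case: fo' => [[]|] *; first [by exists MBad | eexists].
  rewrite /= /store /= cE fold_upd2 /= cE; split=> //=.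
  case: (m) wm => // [|v1|] _; try by exists evs.
  by exists ((rev num', EVar v1) :: evs).
have keep v' num' fo'' lb' ae' : inv (MState (v', m, fo'', lb', ae') num' (evs ++ mem0) [::]).
  by split=> //; exists evs.
rewrite /mstep /=; case: v => [[h|]|c] /=; try exact: keep.
case: (h == b) => /=; first exact: keep.
by case: b => /=; [exact: hs | split=> //; exists evs].
Qed.

Lemma size_step evs t : all is_var evs -> last true t ->
  tstep (MSize, evs ++ mem0, [::]) t = next evs (bval t) [::].
Proof.
move=> ve lt; rewrite /next -(has_size (bval t) ve [::]) /node_mem /tstep /checked lt.
by rewrite /= bin_bval.
Qed.

Definition instance_toks (C : seq node) g1 g2 : seq (seq bool) :=
  bin (size C) :: flatten (map toks C) ++ [:: bin g1; bin g2].

Lemma enc_toks C g1 g2 : enc_instance C g1 g2 = flatten (map tok (instance_toks C g1 g2)).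
Proof.
rewrite /enc_instance /instance_toks /enc_node /toks.
rewrite -[enc_nat]/(fun n => tok (bin n)); move: tok bin => tk bn.
rewrite /= map_cat flatten_cat /= cats0; congr (_ ++ _ ++ _).
elim: C => //= nd C IH; rewrite map_cat flatten_cat -IH; congr cat.
by case: nd => [i|c|f ins] /=; rewrite ?cats0 // -map_comp.
Qed.

Lemma run_instance w evs C g1 g2 : all is_var evs ->
  m_mem (wrun w) = evs ++ mem0 -> m_cnt (wrun w) = [::] -> valid_instance C g1 g2 ->
  acc (m_ctl (run (enc_instance C g1 g2) w)) =
  (nth b0 (run_from (assignment evs) [::] C) g1 != nth b0 (run_from (assignment evs) [::] C) g2).
Proof.
move=> ve mE cE /and3P[vC h1 h2]; rewrite /mrun mE cE enc_toks.
have [v' [-> vE]] := @toks_run (inl None) (MSize, evs ++ mem0, [::]) (instance_toks C g1 g2) isT.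
rewrite vE // /acc /= trun_cons size_step ?last_bin // bvalK.
rewrite trun_cat circuit_run //.
set vals := run_from _ _ _; have zv : size vals = size C by rewrite size_run.
rewrite /next zv eqxx -{2}zv out_run ?zv //.
case: (nth b0 vals g1 != nth b0 vals g2); last by rewrite eqxx.
by apply/eqP.
Qed.

(** Contrapositively, a word that encodes no instance is accepted with every witness. *)
Lemma run_back w x : ~~ acc (m_ctl (run x w)) ->
  exists (C : seq node) g1 g2, valid_instance C g1 g2 /\ enc_instance C g1 g2 = x.
Proof.
have [evs ve [mE cE]] := witness_mem w; rewrite /mrun mE cE negbK.
set st := foldl step _ x => /andP[/eqP hv /eqP hm].
have [|ts xE mE'] := @decode_toks (inl None) MSize [::] (evs ++ mem0) [::] x isT (or_introl erefl) hv.
  by rewrite -/st hm.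
rewrite -/st hm in mE'; rewrite /= in xE.
case: ts mE' xE => // t ts; rewrite trun_cons => mE' xE.
case lt: (last true t); last first.
  by move: mE'; rewrite /tstep /checked lt /= bad_trun.
rewrite size_step // in mE'.
have [C [g1 [g2 [tsE vC zC /andP[h1 h2]]]]] := circuit_back (vals := [::]) ve (leq0n _) (esym mE').
rewrite add0n in zC; exists C, g1, g2; split.
  by apply/and3P; split; rewrite ?zC.
by rewrite xE enc_toks tsE /instance_toks zC bin_bval.
Qed.

Definition var_index (nd : node) : option nat := if nd is NVar i then Some i else None.

(* 0 is included because [a 0] is the default value of [eval_node]. *)
Definition vars (C : seq node) : seq nat := 0 :: pmap var_index C.

Lemma run_from_vars a a' vals C : {in vars C, a =1 a'} ->
  run_from a vals C = run_from a' vals C.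
Proof.
elim: C vals => //= nd C IH vals h; rewrite /vars /= in h.
rewrite IH; last first.
  move=> i; rewrite inE => /orP[/eqP ->|hi]; first by apply: h; rewrite mem_head.
  by apply: h; case: (nd) => *; rewrite /= ?inE hi ?orbT.
congr (run_from _ (rcons _ _)); case: nd h => [i|c|f ins] h //=.
  by apply: h; rewrite /= !inE eqxx orbT.
by rewrite (h 0) ?mem_head.
Qed.

Definition wit_toks (a : nat -> T) (l : seq nat) : seq (seq bool) :=
  flatten [seq [:: bin (enum_rank (a i)); bin i] | i <- l].

Definition var_entries (a : nat -> T) (l : seq nat) : memory :=
  rev [seq (bin i, EVar (a i)) | i <- l].

Lemma wit_run a l evs : all is_var evs ->
  trun (MWVal, evs ++ mem0, [::]) (wit_toks a l) =
  (MWVal, var_entries a l ++ evs ++ mem0, [::]).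
Proof.
elim: l evs => [|i l IH] evs ve //.
rewrite /wit_toks /= -/(wit_toks a l) !trun_cons.
have -> : tstep (MWVal, evs ++ mem0, [::]) (bin (enum_rank (a i))) =
    (MWKey (a i), evs ++ mem0, [::]).
  rewrite /tstep /checked last_bin (look_uniq (e := EConst (a i))) //.
    by rewrite mem_hits mem_cat mem0_const orbT.
  move=> e; rewrite mem_hits mem_cat => /orP[/(allP ve)|/mem0P]; case: e => // c.
  by move=> /bin_inj/val_inj/enum_rank_inj ->.
have -> : tstep (MWKey (a i), evs ++ mem0, [::]) (bin i) =
    (MWVal, ((bin i, EVar (a i)) :: evs) ++ mem0, [::]).
  by rewrite /tstep /checked last_bin.
by rewrite IH //= /var_entries /= rev_cons cat_rcons.
Qed.

Definition witness a l : seq bool := flatten (map tok (wit_toks a l)).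

Lemma witness_wrun a l : m_mem (wrun (witness a l)) = var_entries a l ++ mem0 /\
  m_cnt (wrun (witness a l)) = [::].
Proof.
have [v' [E _]] := @toks_run (inl None) (MWVal, mem0, [::]) (wit_toks a l) isT.
by rewrite -[MState _ _ _ _]/(at_token (inl None) (MWVal, mem0, [::])) E
  (@wit_run a l [::]).
Qed.

Lemma witness_assignment a l : {in l, assignment (var_entries a l) =1 a}.
Proof.
move=> i il; rewrite /assignment (look_uniq (e := EVar (a i))) //.
  by rewrite mem_hits mem_cat mem_rev (map_f (fun i => (bin i, EVar (a i)))).
move=> e; rewrite mem_hits mem_cat => /orP[|/mem0P]; last by case: e.
by rewrite mem_rev => /mapP[j _ [/bin_inj <- ->]].
Qed.

Lemma size_tok t : size (tok t) = (size t).*2 + 2.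
Proof. by rewrite size_cat size_dbl. Qed.

(** Apart from the added variable 0, each name in the witness occurs in the circuit and is paid for
    by the code of the instance; its value costs a constant. *)
Lemma size_witness a C g1 g2 :
  size (witness a (vars C)) <= poly (2 * #|T| + 4) 1 (size (enc_instance C g1 g2)).
Proof.
have r (c : T) : size (bin (enum_rank c)) <= #|T|.
  by apply: leq_trans (size_bin _) _; exact: ltnW (ltn_ord _).
have E l : size (witness a l) <= \sum_(i <- l) (2 * #|T| + 4 + size (enc_nat i)).
  elim: l => [|i l IH]; first by rewrite big_nil.
  rewrite big_cons -[witness a _]/(tok (bin (enum_rank (a i))) ++ tok (bin i) ++ witness a l).
  rewrite size_cat (size_cat (tok (bin i))) -[enc_nat i]/(tok (bin i)) !size_tok.
  by have := r (a i); lia.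
apply: leq_trans (E _) _; rewrite /poly expn1 /vars big_cons addnC.
have F : \sum_(i <- pmap var_index C) (2 * #|T| + 4 + size (enc_nat i)) <=
    (2 * #|T| + 3) * size (flatten (map (@enc_node S T) C)).
  elim: C => [|nd C IH]; first by rewrite big_nil.
  rewrite -[flatten _]/(enc_node nd ++ flatten (map (@enc_node S T) C)) size_cat mulnDr.
  case: nd => [i|c|f ins]; try exact: leq_trans IH (leq_addl _ _).
  rewrite -[pmap _ _]/(i :: pmap var_index C) big_cons leq_add //.
  rewrite -[enc_node _]/(enc_nat 0 ++ enc_nat i) (size_cat (enc_nat 0)).
  by rewrite -[size (enc_nat 0)]/2; move: (size (enc_nat i)) #|T| => p q; nia.
rewrite /enc_instance (size_cat (enc_nat _)) (size_cat (flatten _)).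
have : 2 <= size (enc_nat (size C)) by rewrite enc_natE size_cat leq_addl.
rewrite -[size (enc_nat 0)]/2 => z2; apply: leq_trans (leq_add F (leqnn _)) _; move: z2.
set p := size (flatten _); set u := size (enc_nat (size C)).
by move: p u (size _) #|T| => p u r' t; nia.
Qed.

Theorem CEQV_in_coNP : in_coNP (CEQV (S := S) B).
Proof.
exists (fun y => acc (m_ctl (run (split_pair y).1 (split_pair y).2))), (2 * #|T| + 4), 1.
split; first exact: machine_in_P.
move=> x; split; last first.
  move=> [w [_]]; rewrite split_pair_enc /= => ha [C [g1 [g2 [vi [xE eq]]]]].
  have [evs ve [mE cE]] := witness_mem w.
  move: ha; rewrite -xE (run_instance ve mE cE vi) => /eqP[].
  case/and3P: vi => _ h1 h2.
  by have := eq (assignment evs); rewrite !(set_nth_default b0) // size_run.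
(* The empty witness settles words that are no instances; if it is not accepted, [x] is a proper
   instance and a falsifying assignment can be written down. *)
move=> nx; case ha: (acc (m_ctl (run x [::]))).
  by exists [::]; rewrite split_pair_enc.
have [C [g1 [g2 [vi xE]]]] := run_back (negbT ha).
have [a na] : exists a : nat -> T, nth (a 0) (circuit_values (A := alg_of_fin B) a C) g1 <>
    nth (a 0) (circuit_values (A := alg_of_fin B) a C) g2.
  apply: NNPP => h; apply: nx; exists C, g1, g2; split=> //; split=> // a.
  by apply: NNPP => h'; apply: h; exists a.
exists (witness a (vars C)); rewrite split_pair_enc -xE size_witness; split=> //.
have [mE cE] := witness_wrun a (vars C).
have ve : all is_var (var_entries a (vars C)).
  by rewrite /var_entries all_rev all_map; apply/allP.
rewrite /= (run_instance ve mE cE vi); apply/eqP.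
rewrite (run_from_vars _ (@witness_assignment a (vars C))).
case/and3P: vi => _ h1 h2.
by move: na; rewrite !(set_nth_default b0 (a 0)) // size_run.
Qed.

End Checker.

Theorem theorem2p12 (S : signature) (A : finAlgebra S) :
  CM_variety (alg_of_fin A) ->
  (forall A' : finAlgebra S,
     (exists h : fcar A -> fcar A',
        is_hom (A := alg_of_fin A) (B := alg_of_fin A') h /\
        forall y : fcar A', exists x, h x = y) ->
     ~ coNP_complete (CEQV A')) ->
  nilpotent (alg_of_fin A).
Proof.
move=> CM noq; apply: NNPP => /(nonnilpotent_quotient CM)[B [h [hom sur gad]]].
apply: (noq B); first by exists h.
split; last exact: gadgets_coNP_hard.
(* The checker needs a default element of [B]; the gadgets provide one. *)
by have [z _] := gad; apply: CEQV_in_coNP z.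
Qed.
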